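(* Let $(V,\|\cdot\|_V)$ be a nontrivial real Banach space, let $T\in(0,\infty)$, $f\in\mathcal C^{0,1}([0,T]\times V,V)$, let $Y,E\colon[0,T]\to V$ be strongly measurable functions, for every $x\in V$, $s\in[0,T]$ let $X^x_{s,(\cdot)}=(X^x_{s,t})_{t\in[s,T]}\colon[s,T]\to V$ be a continuous function which satisfies for all $t\in[s,T]$ that $X^x_{s,t}=x+\int_s^t f(\tau,X^x_{s,\tau})\,d\tau$, and assume for all $t\in[0,T]$ that $\int_0^T[\|f(\tau,Y_\tau)\|_V+\|E_\tau\|_V]\,d\tau<\infty$ and $Y_t=Y_0+\int_0^t[f(\tau,Y_\tau)+E_\tau]\,d\tau$. Then: (i) the function $\{(u,r)\in[0,T]^2:u\le r\}\times V\ni(s,t,x)\mapsto X^x_{s,t}\in V$ belongs to $\mathcal C^{0,0,1}(\{(u,r)\in[0,T]^2:u\le r\}\times V,V)$; (ii) the function $\{(u,r)\in(0,T)^2:u<r\}\times V\ni(s,t,x)\mapsto X^x_{s,t}\in V$ is continuously differentiable; (iii) for all $t\in[0,T]$ the function $[0,t]\ni\tau\mapsto(\frac{\partial}{\partial x}X^{Y_\tau}_{\tau,t})E_\tau\in V$ is strongly measurable; (iv) for all $t\in[0,T]$ it holds that $\int_0^t\|(\frac{\partial}{\partial x}X^{Y_\tau}_{\tau,t})E_\tau\|_V\,d\tau<\infty$; and (v) for all $s\in[0,T]$, $t\in[s,T]$ it holds that $$Y_t=X^{Y_s}_{s,t}+\int_s^t\big(\tfrac{\partial}{\partial x}X^{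Y_\tau}_{\tau,t}\big)E_\tau\,d\tau.$$
   Context: $L(V)$ denotes the Banach space of bounded linear operators $V\to V$ with the operator norm. $\mathcal C^{0,1}([0,T]\times V,V)$ is the set of continuous functions $f\colon[0,T]\times V\to V$ such that for every $t$ the map $x\mapsto f(t,x)$ is Fréchet differentiable and $(t,x)\mapsto(\frac{\partial}{\partial x}f)(t,x)\in L(V)$ is jointly continuous. Similarly, for $D\subseteq\mathbb R^2$, $\mathcal C^{0,0,1}(D\times V,V)$ is the set of continuous functions $(s,t,x)\mapsto g(s,t,x)$ on $D\times V$ which are Fréchet differentiable in $x$ with $(s,t,x)\mapsto\frac{\partial}{\partial x}g(s,t,x)\in L(V)$ jointly continuous. In (ii), continuously differentiable means continuously Fréchet differentiable on the given open subset of $\mathbb R^2\times V$. A function from an interval to a Banach space is strongly measurable if it is measurable and has separable range. Integrals of $V$-valued functions are Bochner integrals with respect to Lebesgue measure. $\frac{\partial}{\partial x}X^{Y_\tau}_{\tau,t}\in L(V)$ denotes the Fréchet derivative of $V\ni x\mapsto X^x_{\tau,t}\in V$ evaluated at $x=Y_\tau$. *)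

(* Defs.v *)
From HB Require Import structures.
From mathcomp Require Import all_boot all_order all_algebra.
From mathcomp Require Import all_classical all_reals all_analysis.

Set Implicit Arguments.
Unset Strict Implicit.
Unset Printing Implicit Defensive.

Import Order.TTheory GRing.Theory Num.Theory.
Import numFieldNormedType.Exports.

Local Open Scope classical_set_scope.
Local Open Scope ring_scope.

(* The operator norm, extended-real valued so that it is [+oo] on unbounded
   linear maps. *)
Definition opnorm (R : realType) (U W : normedModType R) (L : U -> W) : \bar R :=
  ereal_sup [set `|L v|%:E | v in [set v : U | `|v| <= 1]].

(* Continuity on A of an operator-valued map, for the operator norm on L(U, W)
   and the topology induced by P on A. *)
Definition L_continuous_on (R : realType) (P : topologicalType)
    (U W : normedModType R) (A : set P) (D : P -> U -> W) : Prop :=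
  forall p, A p -> opnorm (D q \- D p) @[q --> within A (nbhs p)] --> 0%E.

Definition C01 (R : realType) (V : normedModType R) (I : set R)
    (f : R -> V -> V) : Prop :=
  [/\ {within I `*` setT, continuous (fun p : R * V => f p.1 p.2)},
      (forall t x, I t -> differentiable (f t) x) &
      L_continuous_on (I `*` setT) (fun p : R * V => 'd (f p.1) (p.2))].

Definition C001 (R : realType) (V : normedModType R) (A : set (R * R))
    (g : R -> R -> V -> V) : Prop :=
  [/\ {within A `*` setT,
        continuous (fun p : R * R * V => g p.1.1 p.1.2 p.2)},
      (forall s t x, A (s, t) -> differentiable (g s t) x) &
      L_continuous_on (A `*` setT)
        (fun p : R * R * V => 'd (g p.1.1 p.1.2) (p.2))].

(* To be used with A open. *)
Definition continuously_differentiable_on (R : realType)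
    (U W : normedModType R) (A : set U) (F : U -> W) : Prop :=
  (forall p, A p -> differentiable F p) /\
  L_continuous_on A (fun p => 'd F p).

(* Measurable for the Borel sigma-algebra of V, with separable range. *)
Definition strongly_measurable (R : realType) (V : normedModType R)
    (d : measure_display) (S : measurableType d) (D : set S) (f : S -> V)
    : Prop :=
  measurable_fun D (f : S -> g_sigma_algebraType (@open V)) /\
  exists A : set V, [/\ countable A, A `<=` f @` D & f @` D `<=` closure A].

Definition bochner_simple (R : realType) (V : normedModType R)
    (d : measure_display) (S : measurableType d)
    (mu : {measure set S -> \bar R}) (D : set S) (s : S -> V) : Prop :=
  [/\ finite_set (s @` D),
      (forall c, measurable (D `&` s @^-1` [set c])) &
      (forall c, c != 0 -> (mu (D `&` s @^-1` [set c]) < +oo)%E)].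

(* The sum has finite support when s is Bochner simple on D. *)
Definition bochner_sintegral (R : realType) (V : normedModType R)
    (d : measure_display) (S : measurableType d)
    (mu : {measure set S -> \bar R}) (D : set S) (s : S -> V) : V :=
  \sum_(c \in [set: V]) fine (mu (D `&` s @^-1` [set c])) *: c.

Definition is_bochner_integral (R : realType) (V : normedModType R)
    (d : measure_display) (S : measurableType d)
    (mu : {measure set S -> \bar R}) (D : set S) (f : S -> V) (v : V) : Prop :=
  strongly_measurable D f /\
  exists s : nat -> S -> V,
    [/\ forall n, bochner_simple mu D (s n),
        (\int[mu]_(x in D) `|f x - s n x|%:E)%E @[n --> \oo] --> 0%E &
        bochner_sintegral mu D (s n) @[n --> \oo] --> v].

(* Unspecified when f is not Bochner integrable on D. *)
Definition bochner_integral (R : realType) (V : normedModType R)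
    (d : measure_display) (S : measurableType d)
    (mu : {measure set S -> \bar R}) (D : set S) (f : S -> V) : V :=
  get [set v | is_bochner_integral mu D f v].

(* Main.v *)
(** Trajectories starting near [(s0, x0)] stay, by Gronwall's lemma, in a tube
    around the trajectory through [(s0, x0)] on which [f] is uniformly strictly
    differentiable. Hence on that tube the flow maps proportional increments of
    the initial value to almost proportional increments, so that its difference
    quotients are Cauchy and their limit is a strict derivative, uniformly in the
    times; this avoids solving the variational equation and gives (i). With the
    flow property [X s t x = X u t (X s u x)] it also gives strict differentiability
    in [(s, t, x)], hence (ii).

    For (v) let [err a b] be [X b t (Y b) - X a t (Y a)] minus the integral of
    [D X r t (Y r) (E r)] over [[a, b]]. It is additive in the interval, and strict
    differentiability bounds it by [e * ((b - a) + \int_a^b `|E|)] on small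
    intervals, hence on [[s, t]], for every [e > 0]. This replaces a chain rule for
    absolutely continuous curves. *)

(* Balls of [V] need not be compact, so uniformity can only come from compactness in time: estimates
   are proved near one instant of a fixed curve and glued along the interval by
   [interval_concatenation]; the width of the tube results from this.

   The relation [y - z = k *: (y' - z')] between two pairs of initial values involves no derivative,
   so Gronwall's inequality can carry it along the flow before anything is known to be
   differentiable. Since [k] is free, it compares increments of different lengths (Cauchy property,
   homogeneity) and with different base points (additivity, strictness).

   For two nearby pairs of times, uniform closeness of the two flows is not proportional to the
   increment; almost proportionality first enlarges the increment to a fixed length, at which
   closeness suffices.

   The Borel sets of a product of non-separable spaces can exceed the product sigma-algebra, so
   pairing measurable maps needs separability of their ranges; this is built into
   [countably_based]. *)
Require Import Defs.
From HB Require Import structures.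
From mathcomp Require Import all_boot all_order all_algebra.
From mathcomp Require Import all_classical all_reals all_analysis.
From mathcomp Require Import measurable_realfun ring lra.

Set Implicit Arguments.
Unset Strict Implicit.
Unset Printing Implicit Defensive.

Import Order.TTheory GRing.Theory Num.Theory.
Import numFieldNormedType.Exports.

Local Open Scope classical_set_scope.
Local Open Scope ring_scope.

(** * Strong measurability *)

(* For a map into a normed space this is strong measurability; unlike that notion
   it makes sense for any target and is visibly stable under pairing and under
   composition with a map that is continuous on a set containing the range. *)
Definition countably_based (d : measure_display) (S : measurableType d)
    (Z : topologicalType) (D : set S) (h : S -> Z) : Prop :=
  exists (I : countType) (B : I -> set S),
    [/\ forall i, measurable (B i), forall i, B i `<=` D &
        forall x, D x -> forall U, nbhs (h x) U ->
          exists2 i, B i x & forall y, B i y -> U (h y)].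

Section countably_based_theory.
Context (d : measure_display) (S : measurableType d).
Implicit Types (D : set S).

Lemma countably_based_pair (Z W : topologicalType) D (f : S -> Z) (g : S -> W) :
  countably_based D f -> countably_based D g ->
  countably_based D (fun x => (f x, g x)).
Proof.
move=> [I [B [mB BD HB]]] [J [C [mC CD HC]]].
exists (I * J)%type, (fun ij => B ij.1 `&` C ij.2); split.
- by move=> [i j] /=; apply: measurableI.
- by move=> [i j] /= x [/BD].
- move=> x Dx U [[U1 U2] /= [nU1 nU2] U12].
  have [i Bx Bi] := HB _ Dx _ nU1; have [j Cx Cj] := HC _ Dx _ nU2.
  exists (i, j) => //= y [By Cy]; apply: U12; split=> /=; [exact: Bi|exact: Cj].
Qed.

Lemma countably_based_comp (Z W : topologicalType) D (h : S -> Z) (A : set Z)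
    (G : Z -> W) :
  (forall x, D x -> A (h x)) -> {within A, continuous G} ->
  countably_based D h -> countably_based D (G \o h).
Proof.
move=> DA /subspace_continuousP cG [I [B [mB BD HB]]].
exists I, B; split => // x Dx U nU.
have /HB := cG _ (DA _ Dx) _ nU => /(_ Dx) [i Bx Bi].
by exists i => // y By; apply: Bi => //; exact/DA/(BD i).
Qed.

Lemma countably_based_subset (Z : topologicalType) D D' (h : S -> Z) :
  measurable D' -> D' `<=` D -> countably_based D h -> countably_based D' h.
Proof.
move=> mD' DD [I [B [mB BD HB]]].
exists I, (fun i => B i `&` D'); split.
- by move=> i; exact: measurableI.
- by move=> i x [].
- move=> x Dx U /(HB _ (DD _ Dx)) [i Bx Bi].
  by exists i => // y [/Bi].
Qed.

Lemma countably_based_cst (Z : topologicalType) D (z : Z) :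
  measurable D -> countably_based D (fun=> z).
Proof.
move=> mD; exists unit, (fun=> D); split=> [//|_ x //|x Dx U /nbhs_singleton Uz].
by exists tt.
Qed.

Lemma countably_based_eq (Z : topologicalType) D (f g : S -> Z) :
  (forall x, D x -> f x = g x) -> countably_based D f -> countably_based D g.
Proof.
move=> fg [I [B [mB BD HB]]]; exists I, B; split=> // x Dx U.
rewrite -(fg _ Dx) => /(HB _ Dx) [i Bx Bi]; exists i => // y By.
by rewrite -fg; [exact: Bi|exact: (BD i)].
Qed.

Lemma countably_based_preimage (Z : topologicalType) D (h : S -> Z) (U : set Z) :
  countably_based D h -> open U -> measurable (D `&` h @^-1` U).
Proof.
move=> [I [B [mB BD HB]]] oU.
have -> : D `&` h @^-1` U = \bigcup_(i in [set i | B i `<=` h @^-1` U]) B i.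
  apply/seteqP; split=> x.
    move=> [Dx Ux]; have [|i Bx Bi] := HB _ Dx U; first exact: open_nbhs_nbhs.
    by exists i.
  by move=> [i BU Bx]; split; [exact: (BD i)|exact: BU].
rewrite bigcup_mkcond; apply: countable_bigcupT_measurable => //.
by move=> i; case: ifP.
Qed.

Context (R : realType).

Lemma countably_based_measurable D (h : S -> R) :
  countably_based D h -> measurable_fun D h.
Proof.
move=> ch; apply: (measurability _ (RGenOpens.measurableE R)).
by move=> _ [_ [a [b ->]] <-]; apply: countably_based_preimage => //;
  exact: interval_open.
Qed.

Context (V : normedModType R).

Lemma countably_based_strongly_measurable D (h : S -> V) :
  countably_based D h -> strongly_measurable D h.
Proof.
move=> ch; split.
  apply: (@measurability _ _ S (g_sigma_algebraType (@open V)) D h (@open V) erefl).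
  by move=> _ [U oU <-]; exact: countably_based_preimage.
have [I [B [mB BD HB]]] := ch.
(* One value of [h] is taken from each nonempty basic set; these values form the countable dense
   subset of the range. The value 0 for empty sets is a placeholder, excluded below. *)
have /choice [y yP] : forall i, exists y : V,
    B i !=set0 -> exists2 x, B i x & h x = y.
  move=> i; have [[x Bx]|nB] := pselect (B i !=set0).
    by exists (h x) => _; exists x.
  by exists 0.
exists (y @` [set i | B i !=set0]); split.
- rewrite -bigcup_imset1; apply: bigcup_countable => // i _; exact: countable1.
- by move=> _ [i /yP [x Bx <-] <-]; exists x => //; exact: (BD i).
- move=> _ [x Dx <-] U /HB -/(_ Dx) [i Bx Bi].
  have Bi0 : B i !=set0 by exists x.
  exists (y i); split; first by exists i.
  by have [z Bz <-] := yP _ Bi0; exact: Bi.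
Qed.

Lemma countable_approximation D (h : S -> V) (A : set V) :
  countable A -> h @` D `<=` closure A ->
  exists a : nat -> V, forall x, D x -> forall e, 0 < e ->
    exists n, `|h x - a n| < e.
Proof.
move=> /pcard_surjP [a aA] hA; exists a => x Dx e e0.
have [||z [/aA [n _ <-]]] := hA (h x) _ (ball (h x) e).
- by exists x.
- exact: nbhsx_ballx.
by rewrite -ball_normE => hz; exists n.
Qed.

Lemma strongly_measurable_countably_based D (h : S -> V) :
  measurable D -> strongly_measurable D h -> countably_based D h.
Proof.
move=> mD [mh [A [cA _ Ad]]].
have [a aP] := countable_approximation cA Ad.
pose I := (nat * nat)%type.
(* Radii [1/(m+1)] below [e / 2] suffice: two points of one such ball around [a n] are at distance
   less than [e]. *)
exists I, (fun i : I => D `&` h @^-1` ball (a i.1) i.2.+1%:R^-1); split.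
- move=> i; apply: mh => //; apply: sub_sigma_algebra.
  exact: ball_open.
- by move=> i x [].
- move=> x Dx U /nbhs_ballP [e /= e0 eU].
  have [m me] : exists m : nat, (m.+1%:R^-1 : R) < e / 2.
    exists (Num.truncn (e / 2)^-1).
    rewrite -[ltRHS]invrK ltf_pV2 ?posrE ?invr_gt0 ?divr_gt0 //.
    exact: truncnS_gt.
  have [|n ne] := aP x Dx m.+1%:R^-1; first by rewrite invr_gt0.
  exists (n, m) => /=; first by split => //; rewrite -ball_normE/= distrC.
  move=> y [Dy]; rewrite -ball_normE /= => ye; apply: eU.
  rewrite -ball_normE /=.
  rewrite -(subrK (a n) (h x)) -addrA (le_lt_trans (ler_normD _ _)) //.
  by rewrite (lt_le_trans (ltrD ne ye))// [leRHS]splitr lerD// ltW.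
Qed.

End countably_based_theory.

(** * The Bochner integral *)

(** The values lie in an arbitrary type so that two simple maps can be paired; functions of both are
    then compositions with the pair, which serves as a common refinement. *)
Definition simple_on (d : measure_display) (S : measurableType d) (Z : Type)
    (D : set S) (p : S -> Z) : Prop :=
  finite_set (p @` D) /\ forall z, measurable (D `&` p @^-1` [set z]).

Section simple_on_theory.
Context (d : measure_display) (S : measurableType d) (D : set S).

Lemma simple_on_preimage (Z : choiceType) (p : S -> Z) (A : set Z) :
  D `&` p @^-1` A = \bigcup_(z in p @` D `&` A) (D `&` p @^-1` [set z]).
Proof.
apply/seteqP; split => [x [Dx Ax]|x [z [_ Az] [Dx /= px]]].
  by exists (p x) => //; split => //; exists x.
by split => //=; rewrite px.
Qed.

Lemma measurable_simple_on_preimage (Z : choiceType) (p : S -> Z) (A : set Z) :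
  simple_on D p -> measurable (D `&` p @^-1` A).
Proof.
move=> [fp mp]; rewrite simple_on_preimage; apply: fin_bigcup_measurable => //.
exact: sub_finite_set fp.
Qed.

Lemma simple_on_comp (Z : choiceType) (W : Type) (p : S -> Z) (g : Z -> W) :
  simple_on D p -> simple_on D (g \o p).
Proof.
move=> sp; split; first by rewrite -image_comp; apply: finite_image; case: sp.
by move=> w; exact: (measurable_simple_on_preimage (g @^-1` [set w])).
Qed.

Lemma simple_on_pair (Z W : Type) (p : S -> Z) (q : S -> W) :
  simple_on D p -> simple_on D q -> simple_on D (fun x => (p x, q x)).
Proof.
move=> [fp mp] [fq mq]; split.
  apply: (@sub_finite_set _ _ ((p @` D) `*` (q @` D))).
    by move=> _ [x Dx <-]; split; exists x.
  exact: finite_setX.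
move=> [z w]; rewrite (_ : _ `&` _ =
  (D `&` p @^-1` [set z]) `&` (D `&` q @^-1` [set w])); first exact: measurableI.
by apply/seteqP; split => [x [Dx /= [<- <-]]//|x [[Dx /= <-] [_ /= <-]]].
Qed.

Lemma simple_on_countably_based (Z : topologicalType) (p : S -> Z) :
  simple_on D p -> countably_based D p.
Proof.
move=> [fp mp]; pose s := finmap.enum_fset (fset_set (p @` D)).
exists 'I_(size s), (fun i => D `&` p @^-1` [set tnth (in_tuple s) i]); split.
- by move=> i; exact: mp.
- by move=> i x [].
- move=> x Dx U nU.
  have : p x \in s by rewrite /s in_fset_set// inE; exists x.
  move=> /seq_tnthP [i pxi]; exists i; first by split.
  by move=> y [_ /= ->]; rewrite -pxi; exact: nbhs_singleton.
Qed.

End simple_on_theory.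

(** * Integrals of simple functions *)

Section sintegral.
Context (d : measure_display) (S : measurableType d) (R : realType)
  (mu : {measure set S -> \bar R}) (D : set S).
Hypotheses (mD : measurable D) (muD : (mu D < +oo)%E).

Let m (Z : Type) (p : S -> Z) z := fine (mu (D `&` p @^-1` [set z])).

Lemma fin_num_sub_measure (A : set S) :
  measurable (D `&` A) -> mu (D `&` A) \is a fin_num.
Proof.
move=> mA; rewrite ge0_fin_numE //; apply: le_lt_trans muD.
by apply: le_measure; rewrite ?inE.
Qed.

Lemma fine_measure_simple_on (Z : choiceType) (p : S -> Z) (A : set Z) :
  simple_on D p ->
  fine (mu (D `&` p @^-1` A)) = \sum_(z \in p @` D) if z \in A then m p z else 0.
Proof.
move=> sp; rewrite simple_on_preimage measure_fin_bigcup //.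
- rewrite -fsbig_mkcondr.
  rewrite (@eq_fsbigr _ _ _ _ _ (fun z => (m p z)%:E)).
    by rewrite fsumEFin //; apply: sub_finite_set (proj1 sp).
  by move=> z _; rewrite fineK // fin_num_sub_measure //; case: sp.
- by apply: sub_finite_set (proj1 sp).
- exact: trivIset_preimage1_in.
- by move=> z _; case: sp.
Qed.

Lemma bochner_simpleP (V : normedModType R) (s : S -> V) :
  bochner_simple mu D s <-> simple_on D s.
Proof.
split=> [[]//|[fs ms]]; split=> // c _.
by rewrite -ge0_fin_numE // fin_num_sub_measure.
Qed.

(** Fibres of [g \o p] are unions of fibres of [p], so the sum may be taken over any finer
    partition. With [p] a pair of simple maps this makes additivity a termwise identity. *)
Lemma bochner_sintegral_comp (V : normedModType R) (Z : choiceType)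
    (p : S -> Z) (g : Z -> V) : simple_on D p ->
  bochner_sintegral mu D (g \o p) = \sum_(z \in p @` D) m p z *: g z.
Proof.
move=> sp; have fp := proj1 sp.
(* Values outside the image have an empty fibre, so the sum over all of [V] reduces to the finite
   image. *)
rewrite /bochner_sintegral -(@fsbig_widen _ _ _ _ (g @` (p @` D))) //; last first.
  move=> c [_ nc] /=; rewrite (_ : _ `&` _ = set0) ?measure0 ?scale0r //.
  apply/seteqP; split=> // x [Dx /= gpx]; apply: nc.
  by exists (p x) => //; exists x.
under eq_fsbigr => c _.
  rewrite (_ : mu _ = mu (D `&` p @^-1` (g @^-1` [set c]))) //.
  rewrite fine_measure_simple_on // fsbig_finite // scaler_suml -fsbig_finite //.
  over.
rewrite /= exchange_fsbig //; last exact: finite_image.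
apply: eq_fsbigr => z; rewrite inE => Pz.
rewrite (fsbigD1 (g z)) //=; first last.
- by exists z.
- exact: finite_image.
rewrite ifT ?inE // fsbig1 ?addr0 // => c [_ /= /eqP cz].
by rewrite ifF ?scale0r //; apply/negbTE; rewrite notin_setE /= => gz; rewrite gz eqxx in cz.
Qed.

Lemma integral_simple_on (Z : choiceType) (p : S -> Z) (h : Z -> R) :
  simple_on D p -> (forall z, 0 <= h z) ->
  (\int[mu]_(x in D) (h (p x))%:E = (\sum_(z \in p @` D) m p z * h z)%:E)%E.
Proof.
move=> sp h0; have fp := proj1 sp; have mp := proj2 sp.
transitivity (\int[mu]_(x in D)
   \sum_(z \in p @` D) (h z * \1_(D `&` p @^-1` [set z]) x)%:E)%E.
  apply: eq_integral => x; rewrite inE => Dx.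
  rewrite (fsbigD1 (p x)) //=; last by exists x.
  rewrite fsbig1 ?adde0 ?indicE ?mem_set ?mulr1 //.
  by move=> z [_ /= zp]; rewrite indicE memNset ?mulr0 // => -[_ /= /esym].
rewrite ge0_integral_fsum //; last 2 first.
- move=> z; apply/measurable_EFinP; apply: measurable_funM.
    exact: measurable_cst.
  exact/measurable_indic/mp.
- by move=> z x _; rewrite lee_fin mulr_ge0.
rewrite -fsumEFin //; apply: eq_fsbigr => z _.
rewrite (integralZl_indic mD (fun=> D `&` p @^-1` [set z])) //; last first.
  by move=> hz; have := h0 z; rewrite leNgt hz.
rewrite integral_indic // EFinM muleC; congr (_ * _)%E.
by rewrite setIAC setIid /m fineK //; exact: fin_num_sub_measure.
Qed.

Lemma le_norm_sintegral (V : normedModType R) (s : S -> V) : simple_on D s ->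
  (`|bochner_sintegral mu D s|%:E <= \int[mu]_(x in D) `|s x|%:E)%E.
Proof.
move=> ss; rewrite (integral_simple_on (h := fun v : V => `|v|)) // lee_fin.
rewrite (_ : s = id \o s) // (bochner_sintegral_comp id ss) !fsbig_finite //;
  try by case: ss.
apply: le_trans (ler_norm_sum _ _ _) _; apply: ler_sum => z _.
by rewrite normrZ ger0_norm ?fine_ge0.
Qed.

Lemma bochner_sintegralD (V : normedModType R) (s t : S -> V) :
  simple_on D s -> simple_on D t ->
  bochner_sintegral mu D (s \+ t) =
  bochner_sintegral mu D s + bochner_sintegral mu D t.
Proof.
move=> ss st; have sst := simple_on_pair ss st.
rewrite [LHS](bochner_sintegral_comp (fun vw => vw.1 + vw.2) sst).
rewrite (bochner_sintegral_comp fst sst) (bochner_sintegral_comp snd sst).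
rewrite -fsbig_split; last by case: sst.
by apply: eq_fsbigr => z _; rewrite scalerDr.
Qed.

Lemma bochner_sintegral_linear (V W : normedModType R) (L : {linear V -> W})
    (s : S -> V) : simple_on D s ->
  bochner_sintegral mu D (L \o s) = L (bochner_sintegral mu D s).
Proof.
move=> ss; rewrite (bochner_sintegral_comp L ss).
rewrite [in RHS](_ : s = id \o s) // (bochner_sintegral_comp id ss).
rewrite !fsbig_finite; try by case: ss.
by rewrite linear_sum; apply: eq_bigr => z _; rewrite linearZ.
Qed.

End sintegral.

Lemma linear_bound_continuous (R : realType) (V W : normedModType R)
    (L : {linear V -> W}) (K : R) :
  (forall v, `|L v| <= K * `|v|) -> continuous L.
Proof.
move=> LK; apply: bounded_linear_continuous; apply/linear_boundedP.
exists `|K|; split; first exact: num_real.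
move=> M KM x; apply: le_trans (LK x) _; apply: ler_wpM2r => //.
by apply: le_trans (ltW KM); exact: ler_norm.
Qed.

Lemma cvg_EFinP (R : realType) (u : nat -> R) (l : R) :
  (u n)%:E @[n --> \oo] --> l%:E <-> u n @[n --> \oo] --> l.
Proof.
split=> [/fine_cvgP [] //|ul].
by apply: (proj2 (fine_cvgP (fun n => (u n)%:E) l)); split => //; exact: nearW.
Qed.

(** * Linearity, uniqueness and existence of the Bochner integral *)

Section bochner_theory.
Context (d : measure_display) (S : measurableType d) (R : realType)
  (mu : {measure set S -> \bar R}) (D : set S).
Hypotheses (mD : measurable D) (muD : (mu D < +oo)%E).

Lemma measurable_norm (V : normedModType R) (f : S -> V) :
  countably_based D f -> measurable_fun D (fun x => `|f x|%:E).
Proof.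
move=> cf; apply/measurable_EFinP; apply: countably_based_measurable.
apply: (countably_based_comp (A := setT) (G := fun v : V => `|v|) _ _ cf) => //.
by apply: continuous_subspaceT; exact: norm_continuous.
Qed.

Lemma countably_basedD (V : normedModType R) (f g : S -> V) :
  countably_based D f -> countably_based D g -> countably_based D (f \+ g).
Proof.
move=> cf cg; have cfg := countably_based_pair cf cg.
apply: (countably_based_comp (A := setT) (G := fun p : V * V => p.1 + p.2) _ _ cfg) => //.
by apply: continuous_subspaceT => x; exact: add_continuous.
Qed.

Lemma countably_basedB (V : normedModType R) (f g : S -> V) :
  countably_based D f -> countably_based D g -> countably_based D (f \- g).
Proof.
move=> cf cg; apply: countably_basedD => //.
apply: (countably_based_comp (A := setT) (G := -%R) _ _ cg) => //.
by apply: continuous_subspaceT; exact: opp_continuous.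
Qed.

Lemma le_integral_normD (U V W : normedModType R) (f : S -> U) (g : S -> V)
    (h : S -> W) :
  countably_based D f -> countably_based D g -> countably_based D h ->
  (forall x, D x -> `|h x| <= `|f x| + `|g x|) ->
  (\int[mu]_(x in D) `|h x|%:E <=
   \int[mu]_(x in D) `|f x|%:E + \int[mu]_(x in D) `|g x|%:E)%E.
Proof.
move=> /measurable_norm mf /measurable_norm mg /measurable_norm mh hfg.
rewrite -ge0_integralD //; apply: ge0_le_integral => //.
exact: emeasurable_funD.
Qed.

(** The bound passes to the limit from simple functions, since the norm of [s n] is at most that of
    [f] plus that of [f - s n]. Applied to [f \- f] it yields uniqueness of the integral. *)
Lemma is_bochner_integral_le_norm (V : normedModType R) (f : S -> V) (v : V) :
  is_bochner_integral mu D f v -> (`|v|%:E <= \int[mu]_(x in D) `|f x|%:E)%E.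
Proof.
move=> [/(strongly_measurable_countably_based mD) cf [s [ss cs cv]]].
have {}ss n : simple_on D (s n) by exact/(bochner_simpleP mD muD).
apply: (@lee_cvg_to _ \oo _ _ (fun n => `|bochner_sintegral mu D (s n)|%:E)
  (fun n => \int[mu]_(x in D) `|f x|%:E + \int[mu]_(x in D) `|f x - s n x|%:E)%E).
- by apply: (proj2 (cvg_EFinP _ _)); exact: cvg_norm cv.
- rewrite -[X in _ --> X]adde0; apply: cvgeD => //.
    by rewrite fin_num_adde_defl.
  exact: cvg_cst.
- apply: filterE => n; apply: le_trans (le_norm_sintegral mD muD (ss n)) _.
  have cs' := simple_on_countably_based (ss n).
  apply: (le_integral_normD cf (countably_basedB cf cs')) => //.
  move=> x _ /=; rewrite -{1}(subKr (f x) (s n x)).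
  exact: ler_normB.
Qed.

Lemma is_bochner_integralD (V : normedModType R) (f g : S -> V) (v w : V) :
  is_bochner_integral mu D f v -> is_bochner_integral mu D g w ->
  is_bochner_integral mu D (f \+ g) (v + w).
Proof.
move=> [/(strongly_measurable_countably_based mD) cf [s [ss cs cv]]].
move=> [/(strongly_measurable_countably_based mD) cg [t [st ct cw]]].
have {}ss n : simple_on D (s n) by exact/(bochner_simpleP mD muD).
have {}st n : simple_on D (t n) by exact/(bochner_simpleP mD muD).
split.
  exact/countably_based_strongly_measurable/countably_basedD.
exists (fun n => s n \+ t n); split.
- move=> n; apply/bochner_simpleP => //.
  exact: (simple_on_comp (fun vw : V * V => vw.1 + vw.2) (simple_on_pair (ss n) (st n))).
- apply: (@squeeze_cvge _ _ _ _ (cst 0%E) _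
    (fun n => \int[mu]_(x in D) `|f x - s n x|%:E +
              \int[mu]_(x in D) `|g x - t n x|%:E)%E).
  + apply: filterE => n; rewrite integral_ge0//=.
    have cs' := simple_on_countably_based (ss n).
    have ct' := simple_on_countably_based (st n).
    apply: (le_integral_normD (countably_basedB cf cs') (countably_basedB cg ct')).
      by apply: countably_basedB; exact: countably_basedD.
    by move=> x _ /=; rewrite opprD addrACA ler_normD.
  + exact: cvg_cst.
  + by rewrite -[X in _ --> X]adde0; apply: cvgeD.
- under eq_fun do rewrite (bochner_sintegralD mD muD (ss _) (st _)).
  exact: cvgD.
Qed.

Lemma is_bochner_integral_linear (V W : normedModType R) (L : {linear V -> W})
    (K : R) (f : S -> V) (v : V) :
  (forall x, `|L x| <= K * `|x|) -> is_bochner_integral mu D f v ->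
  is_bochner_integral mu D (L \o f) (L v).
Proof.
move=> LK [/(strongly_measurable_countably_based mD) cf [s [ss cs cv]]].
have {}ss n : simple_on D (s n) by exact/(bochner_simpleP mD muD).
have cL := linear_bound_continuous LK.
have cLf (g : S -> V) : countably_based D g -> countably_based D (L \o g).
  move=> cg; apply: (countably_based_comp (A := setT) _ _ cg) => //.
  exact: continuous_subspaceT.
split; first exact/countably_based_strongly_measurable/cLf.
exists (fun n => L \o s n); split.
- by move=> n; apply/bochner_simpleP => //; exact: simple_on_comp.
- apply: (@squeeze_cvge _ _ _ _ (cst 0%E) _
    (fun n => `|K|%:E * \int[mu]_(x in D) `|f x - s n x|%:E)%E).
  + apply: filterE => n; rewrite integral_ge0//=.
    have cs' := simple_on_countably_based (ss n).
    rewrite -ge0_integralZl_EFin //; last first.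
      exact/measurable_norm/countably_basedB.
    apply: ge0_le_integral => //.
    * by apply/measurable_norm/countably_basedB; exact: cLf.
    * apply: measurable_funeM; exact/measurable_norm/countably_basedB.
    * move=> x Dx; rewrite -EFinM lee_fin -linearB (le_trans (LK _)) //.
      by rewrite ler_wpM2r // ler_norm.
  + exact: cvg_cst.
  + by rewrite -[X in _ --> X](mule0 `|K|%:E); apply: cvgeZl.
- under eq_fun do rewrite (bochner_sintegral_linear mD muD _ (ss _)).
  by apply: continuous_cvg => //; exact: cL.
Qed.

Lemma eq_is_bochner_integral (V : normedModType R) (f g : S -> V) (v : V) :
  (forall x, D x -> f x = g x) ->
  is_bochner_integral mu D f v -> is_bochner_integral mu D g v.
Proof.
move=> fg [/(strongly_measurable_countably_based mD) cf [s [ss cs cv]]].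
split; first exact/countably_based_strongly_measurable/(countably_based_eq fg).
exists s; split=> //; apply: cvg_trans cs; apply: near_eq_cvg.
by apply: filterE => n; apply: eq_integral => x; rewrite inE => /fg ->.
Qed.

Lemma is_bochner_integralB (V : normedModType R) (f g : S -> V) (v w : V) :
  is_bochner_integral mu D f v -> is_bochner_integral mu D g w ->
  is_bochner_integral mu D (f \- g) (v - w).
Proof.
move=> fv /(is_bochner_integral_linear (L := -%R) (K := 1)) gw.
by apply: is_bochner_integralD => //; apply: gw => x; rewrite normrN mul1r.
Qed.

Lemma is_bochner_integral_unique (V : normedModType R) (f : S -> V) (v w : V) :
  is_bochner_integral mu D f v -> is_bochner_integral mu D f w -> v = w.
Proof.
move=> fv fw; have := is_bochner_integral_le_norm (is_bochner_integralB fv fw).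
rewrite integral0_eq => [|x _]; last by rewrite /= subrr normr0.
by rewrite lee_fin normr_le0 subr_eq0 => /eqP.
Qed.

Lemma bochner_integralE (V : normedModType R) (f : S -> V) (v : V) :
  is_bochner_integral mu D f v -> bochner_integral mu D f = v.
Proof.
move=> fv; apply: get_unique => // w fw.
exact: is_bochner_integral_unique fw fv.
Qed.

(** Having 0 among the candidates keeps the error below [|f x|], the majorant for dominated
    convergence; density of the points [a n] makes the error tend to 0. *)
Lemma simple_approximation (V : normedModType R) (f : S -> V) :
  countably_based D f -> exists s : nat -> S -> V,
    [/\ forall n, simple_on D (s n),
        forall n x, D x -> `|f x - s n x| <= `|f x| &
        forall x, D x -> `|f x - s n x| @[n --> \oo] --> 0].
Proof.
move=> cf; have [_ [A [cA _ Ad]]] := countably_based_strongly_measurable cf.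
have [a aP] := countable_approximation cA Ad.
(* [s n x] is a point of [0, a 0, ..., a (n - 1)] nearest to [f x]. *)
pose s := fix s n x : V := if n is n'.+1 then
  if `|f x - a n'| < `|f x - s n' x| then a n' else s n' x else 0.
have sS n x : `|f x - s n.+1 x| = Num.min `|f x - a n| `|f x - s n x|.
  by rewrite /= minEle; case: ltgtP.
have mono m n x : (m <= n)%N -> `|f x - s n x| <= `|f x - s m x|.
  move=> /subnK <-; elim: (n - m)%N => // k; rewrite addSn sS.
  by apply: le_trans; rewrite ge_min lexx orbT.
have ss n : simple_on D (s n).
  elim: n => [|n IH].
    split; first by apply: (@sub_finite_set _ _ [set 0]) => // _ [x _ <-].
    move=> z; have [->|z0] := eqVneq z 0.
      by rewrite (_ : _ `&` _ = D)//; apply/seteqP; split => x // [].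
    rewrite (_ : _ `&` _ = set0)//; apply/seteqP; split => x // [_ /= z0'].
    by rewrite -z0' eqxx in z0.
  have mfa := measurable_norm (countably_basedB cf (countably_based_cst (a n) mD)).
  have mfs := measurable_norm (countably_basedB cf (simple_on_countably_based IH)).
  pose E := D `&` [set x | (`|f x - a n|%:E < `|f x - s n x|%:E)%E].
  have mE : measurable E by exact: emeasurable_fun_lt.
  split.
    apply: (@sub_finite_set _ _ ([set a n] `|` s n @` D)).
      move=> _ [x Dx <-] /=; case: ifP => _; [by left|right].
      by exists x.
    by rewrite finite_setU; split => //; case: IH.
  (* A fibre of [s n.+1] is cut along [E], where the new candidate [a n] is strictly nearer than the
     old choice. *)
  move=> z; rewrite (_ : _ `&` _ = (E `&` (D `&` (cst (a n)) @^-1` [set z])) `|`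
     ((D `\` E) `&` (D `&` s n @^-1` [set z]))).
    apply: measurableU; apply: measurableI => //; [|exact: measurableD|by case: IH].
    have [->|an] := eqVneq (a n) z.
      by rewrite (_ : _ `&` _ = D)//; apply/seteqP; split => x // [].
    rewrite (_ : _ `&` _ = set0)//; apply/seteqP; split => x // [_ /= anz].
    by rewrite anz eqxx in an.
  apply/seteqP; split => x.
    move=> [Dx /=]; case: ifPn => [lt az|nlt sz]; [left|right]; split => //.
    split => // -[_ /=]; by rewrite lte_fin (negbTE nlt).
  move=> [[[_ /=]]|[[Dx nE] [_ /= sz]]].
    by rewrite lte_fin => -> [].
  split => //=; rewrite ifF //; apply/negP => lt; apply: nE; split => //=.
exists s; split => //.
- by move=> n x _; apply: le_trans (mono 0%N n x _) _ => //=; rewrite subr0.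
- move=> x Dx; apply/cvgr0Pnorm_lt => e e0.
  have [n ne] := aP x Dx e e0; exists n.+1 => // k /= nk.
  rewrite normr_id; apply: le_lt_trans (mono _ _ _ nk) _.
  by rewrite sS; apply: le_lt_trans ne; rewrite ge_min lexx.
Qed.

Lemma is_bochner_integral_exists (V : completeNormedModType R) (f : S -> V) :
  strongly_measurable D f -> (\int[mu]_(x in D) `|f x|%:E < +oo)%E ->
  exists v, is_bochner_integral mu D f v.
Proof.
move=> /(strongly_measurable_countably_based mD) cf iff.
have [s [ss sf scvg]] := simple_approximation cf.
have mfs n := measurable_norm (countably_basedB cf (simple_on_countably_based (ss n))).
have c0 : (\int[mu]_(x in D) `|f x - s n x|%:E)%E @[n --> \oo] --> 0%E.
  have [|||||_ + _] := @dominated_convergence _ _ _ mu _ mD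
    (fun n x => `|f x - s n x|%:E) (cst 0%E) (fun x => `|f x|%:E).
  - exact: mfs.
  - exact: measurable_cst.
  - apply: aeW => x Dx; by apply: (proj2 (cvg_EFinP _ _)); exact: scvg.
  - apply/integrableP; split; first exact: measurable_norm.
    by under eq_integral do rewrite abse_EFin normr_id.
  - by apply: aeW => x n Dx; rewrite abse_EFin normr_id lee_fin sf.
  move=> H; apply: cvg_trans H; apply: near_eq_cvg; apply: filterE => n.
  by apply: eq_integral => x _; rewrite sube0 abse_EFin normr_id.
(* The integrals of the approximations are Cauchy: the integral of [s m - s n] is at most the sum of
   two approximation errors, both below [e / 2] from [N] on. *)
have /cvg_ex [v cv] : cvg (bochner_sintegral mu D (s n) @[n --> \oo]).
  apply/cauchy_cvgP; apply/cauchy_ballP => e e0.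
  have e2 : 0 < e / 2 by rewrite divr_gt0.
  have /fine_cvgP [fin0 /cvgr0Pnorm_lt /(_ _ e2) lt0] := c0.
  have [N _ HN] := filterI fin0 lt0.
  pose Q := [set y | exists2 n, (N <= n)%N & bochner_sintegral mu D (s n) = y].
  have nQ : nbhs (bochner_sintegral mu D (s n) @[n --> \oo]) Q.
    by exists N => // n /= Nn; exists n.
  exists (Q, Q) => // -[_ _] [[m Nm <-] [n Nn <-]] /=.
  rewrite -ball_normE /= -lte_fin.
  have [fm lm] := HN _ Nm; have [fn ln] := HN _ Nn.
  rewrite -[X in _ - X]scale1r -scaleNr.
  rewrite -(bochner_sintegral_linear mD muD ( *:%R (-1)) (ss n)).
  have sn' : simple_on D ( *:%R (-1) \o s n) by exact: simple_on_comp.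
  rewrite -bochner_sintegralD //.
  have smn := simple_on_comp (fun vw : V * V => vw.1 + vw.2) (simple_on_pair (ss m) sn').
  apply: (le_lt_trans (le_norm_sintegral mD muD smn)).
  apply: (@le_lt_trans _ _ (\int[mu]_(x in D) `|f x - s m x|%:E +
                            \int[mu]_(x in D) `|f x - s n x|%:E)%E).
    apply: le_integral_normD => //; try exact: countably_basedB cf (simple_on_countably_based _).
      exact: simple_on_countably_based.
    move=> x _ /=; rewrite scaleN1r [X in _ <= X + _]distrC.
    by rewrite -{1}(subrK (f x) (s m x)) -addrA ler_normD.
  rewrite -(fineK fm) -(fineK fn) -EFinD lte_fin [ltRHS]splitr ltrD //.
    exact: le_lt_trans (ler_norm _) lm.
  exact: le_lt_trans (ler_norm _) ln.
exists v; split; first exact: countably_based_strongly_measurable.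
by exists s; split => // n; exact/bochner_simpleP.
Qed.

End bochner_theory.

(** Measurability is put in the form that survives pairing and continuous composition; on a
    measurable set it amounts to strong measurability. *)
Definition bochner_integrable (R : realType) (V : normedModType R)
    (d : measure_display) (S : measurableType d)
    (mu : {measure set S -> \bar R}) (D : set S) (f : S -> V) : Prop :=
  countably_based D f /\ (\int[mu]_(x in D) `|f x|%:E < +oo)%E.

Section bochner_integrable_theory.
Context (d : measure_display) (S : measurableType d) (R : realType)
  (mu : {measure set S -> \bar R}) (D : set S) (V : completeNormedModType R).
Hypotheses (mD : measurable D) (muD : (mu D < +oo)%E).
Implicit Types f g : S -> V.

Lemma bochner_integralP f : bochner_integrable mu D f ->
  is_bochner_integral mu D f (bochner_integral mu D f).
Proof.
move=> [/countably_based_strongly_measurable mf iff].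
by apply: getPex; exact: is_bochner_integral_exists.
Qed.

Lemma bochner_integrableD f g : bochner_integrable mu D f ->
  bochner_integrable mu D g -> bochner_integrable mu D (f \+ g).
Proof.
move=> [cf ff] [cg gg]; split; first exact: countably_basedD.
apply: (@le_lt_trans _ _ (\int[mu]_(x in D) `|f x|%:E + \int[mu]_(x in D) `|g x|%:E)%E).
  apply: le_integral_normD => //; first exact: countably_basedD.
  by move=> x _; exact: ler_normD.
by rewrite lte_add_pinfty.
Qed.

Lemma bochner_integrable_linear (W : normedModType R) (L : {linear V -> W}) K f :
  (forall x, `|L x| <= K * `|x|) ->
  bochner_integrable mu D f -> bochner_integrable mu D (L \o f).
Proof.
move=> LK [cf ff].
have cL := linear_bound_continuous LK.
have cLf : countably_based D (L \o f).
  apply: (countably_based_comp (A := setT) _ _ cf) => //.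
  exact: continuous_subspaceT.
split => //; apply: (@le_lt_trans _ _ (`|K|%:E * \int[mu]_(x in D) `|f x|%:E)%E).
  rewrite -ge0_integralZl_EFin //; last exact: measurable_norm.
  apply: ge0_le_integral => //.
  - exact: measurable_norm.
  - by apply: measurable_funeM; exact: measurable_norm.
  - move=> x Dx; rewrite -EFinM lee_fin (le_trans (LK _)) //.
    by rewrite ler_wpM2r // ler_norm.
by rewrite lte_mul_pinfty.
Qed.

Lemma bochner_integrableN f :
  bochner_integrable mu D f -> bochner_integrable mu D (-%R \o f).
Proof.
by apply: (@bochner_integrable_linear _ -%R 1) => x; rewrite normrN mul1r.
Qed.

Lemma bochner_integrableB f g : bochner_integrable mu D f ->
  bochner_integrable mu D g -> bochner_integrable mu D (f \- g).
Proof. by move=> ff /bochner_integrableN; exact: bochner_integrableD. Qed.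

Lemma bochner_integralD f g : bochner_integrable mu D f ->
  bochner_integrable mu D g ->
  bochner_integral mu D (f \+ g) = bochner_integral mu D f + bochner_integral mu D g.
Proof.
by move=> ff gg; apply: bochner_integralE => //; apply: is_bochner_integralD => //;
  exact: bochner_integralP.
Qed.

Lemma bochner_integralB f g : bochner_integrable mu D f ->
  bochner_integrable mu D g ->
  bochner_integral mu D (f \- g) = bochner_integral mu D f - bochner_integral mu D g.
Proof.
by move=> ff gg; apply: bochner_integralE => //; apply: is_bochner_integralB => //;
  exact: bochner_integralP.
Qed.

Lemma bochner_integral_linear (W : normedModType R) (L : {linear V -> W}) K f :
  (forall x, `|L x| <= K * `|x|) -> bochner_integrable mu D f ->
  bochner_integral mu D (L \o f) = L (bochner_integral mu D f).
Proof.
move=> LK ff; apply: bochner_integralE => //.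
by apply: is_bochner_integral_linear => //; exact: bochner_integralP.
Qed.

Lemma le_norm_bochner_integral f : bochner_integrable mu D f ->
  (`|bochner_integral mu D f|%:E <= \int[mu]_(x in D) `|f x|%:E)%E.
Proof.
by move=> ff; apply: is_bochner_integral_le_norm => //; exact: bochner_integralP.
Qed.

Lemma eq_bochner_integral f g : (forall x, D x -> f x = g x) ->
  bochner_integrable mu D f ->
  bochner_integral mu D f = bochner_integral mu D g.
Proof.
move=> fg ff; apply/esym/bochner_integralE => //.
by apply: eq_is_bochner_integral fg _ => //; exact: bochner_integralP.
Qed.

Lemma sub_bochner_integrable (A : set S) f : measurable A -> A `<=` D ->
  bochner_integrable mu D f -> bochner_integrable mu A f.
Proof.
move=> mA AD [cf ff]; split; first exact: countably_based_subset cf.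
apply: le_lt_trans ff; apply: ge0_subset_integral => //.
exact: measurable_norm.
Qed.

End bochner_integrable_theory.

(** Extension by zero moves integrals over different sets to a common domain, where additivity in
    the domain becomes additivity in the integrand. *)
Lemma is_bochner_integral_patch (d : measure_display) (S : measurableType d)
    (R : realType) (mu : {measure set S -> \bar R}) (A D : set S)
    (V : normedModType R) (f : S -> V) (v : V) :
  measurable A -> measurable D -> (mu D < +oo)%E -> A `<=` D ->
  is_bochner_integral mu A f v ->
  is_bochner_integral mu D (patch (fun=> 0) A f) v.
Proof.
move=> mA mD muD AD [sf [s [ss cs cv]]].
have muA : (mu A < +oo)%E.
  by apply: le_lt_trans muD; apply: le_measure; rewrite ?inE.
have fibre (W : Type) (g : S -> W) (w0 : W) (B : set W) :
    D `&` (patch (fun=> w0) A g) @^-1` B =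
    (A `&` g @^-1` B) `|` ((D `\` A) `&` (fun=> w0) @^-1` B).
  apply/seteqP; split => x.
    move=> [Dx]; rewrite /preimage /= /patch; case: ifPn.
      by rewrite inE => Ax Bx; left.
    by rewrite notin_setE => nAx Bx; right.
  move=> [[Ax Bx]|[[Dx nAx] Bx]].
    by split; [exact: AD|rewrite /preimage /= /patch mem_set].
  by split => //; rewrite /preimage /= /patch memNset.
have mcst (W : Type) (w0 : W) (B : set W) :
    measurable ((D `\` A) `&` (fun=> w0) @^-1` B).
  rewrite preimage_cst; case: ifP => _; rewrite ?setIT ?setI0 //.
  exact: measurableD.
split.
  move/(strongly_measurable_countably_based mA) : sf => cf.
  apply: countably_based_strongly_measurable.
  have [I [B [mB BA HB]]] := cf.
  exists (option I), (fun i => if i is Some i then B i else D `\` A); split.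
  - by move=> [i|]; [exact: mB|exact: measurableD].
  - by move=> [i|] x; [move=> /(BA i)/AD|move=> []].
  - move=> x Dx U; rewrite /patch; case: ifPn => [|nA].
      rewrite inE => Ax nU; have [i Bx Bi] := HB x Ax U nU.
      exists (Some i) => // y By; rewrite /patch mem_set; [exact: Bi|].
      exact: (BA i).
    move=> /nbhs_singleton U0; exists None; first by split => //; rewrite -notin_setE.
    move=> y [_ nAy].
    by rewrite /patch memNset.
exists (fun n => patch (fun=> 0) A (s n)); split.
- move=> n; apply/bochner_simpleP => //.
  have /(bochner_simpleP mA muA) [fs ms] := ss n.
  split.
    apply: (@sub_finite_set _ _ ([set 0] `|` s n @` A)).
      move=> _ [x Dx <-]; rewrite /patch; case: ifPn; [right|by left].
      by exists x => //; rewrite -inE.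
    by rewrite finite_setU; split.
  by move=> z; rewrite fibre; apply: measurableU.
- apply: cvg_trans cs; apply: near_eq_cvg; apply: filterE => n.
  have {1}-> : A = D `&` A by apply/esym/setIidPr.
  rewrite integral_mkcondr; apply: eq_integral => x _.
  by rewrite /patch; case: ifP => // _; rewrite subrr normr0.
- rewrite (_ : (fun n => _) = (fun n => bochner_sintegral mu A (s n))) //.
  apply: funext => n; rewrite /bochner_sintegral; apply: eq_fsbigr => c _.
  (* Only the fibre over 0 grows, and its term in the sum is a multiple of 0. *)
  have [->|c0] := eqVneq c 0; first by rewrite !scaler0.
  rewrite fibre preimage_cst memNset ?setI0 ?setU0 // => c0'.
  by rewrite -c0' eqxx in c0.
Qed.

(** * Integrals over compact intervals *)

Section interval_integral.
Context (R : realType).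
Notation mu := (@lebesgue_measure R).
Implicit Types a b c : R.

Lemma lebesgue_measure_itvcc a b : a <= b -> mu `[a, b] = (b - a)%:E.
Proof.
rewrite lebesgue_measure_itv /= lte_fin; case: ltgtP => //.
by move=> ->; rewrite subrr.
Qed.

Lemma lebesgue_measure_itvcc_fin a b : (mu `[a, b] < +oo)%E.
Proof. by rewrite lebesgue_measure_itv /=; case: ifP => // _; rewrite ltry. Qed.

Lemma countably_based_id (D : set R) :
  measurable D -> countably_based D (@id R).
Proof.
move=> mD; exists (rat * rat)%type,
  (fun pq => D `&` `]ratr pq.1, ratr pq.2[%classic); split.
- by move=> pq; apply: measurableI.
- by move=> pq x [].
- move=> x Dx U /nbhs_ballP [e /= e0 eU].
  have [p] := @rat_in_itvoo R (x - e) x ltac:(lra).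
  have [q] := @rat_in_itvoo R x (x + e) ltac:(lra).
  rewrite !in_itv /= => /andP[xq qe] /andP[ep px].
  exists (p, q); first by split => //=; rewrite in_itv /= px.
  move=> y [_ /=]; rewrite in_itv /= => /andP[py yq]; apply: eU.
  by rewrite /ball /= ltr_distl; apply/andP; split; lra.
Qed.

Context (V : completeNormedModType R).
Implicit Types f g : R -> V.

Lemma within_continuous_countably_based (D : set R) (Z : topologicalType) (f : R -> Z) :
  measurable D -> {within D, continuous f} -> countably_based D f.
Proof.
move=> mD cf; exact: (countably_based_comp (A := D) _ cf (countably_based_id mD)).
Qed.

Lemma bochner_integrable_itv_continuous a b f :
  {within `[a, b], continuous f} -> bochner_integrable mu `[a, b] f.
Proof.
move=> cf; split; first exact: within_continuous_countably_based.
have /integrableP [_] : mu.-integrable `[a, b] (EFin \o (fun x => `|f x|)).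
  apply: continuous_compact_integrable; first exact: segment_compact.
  by move=> x; apply: continuous_comp; [exact: cf|exact: norm_continuous].
apply: le_lt_trans; rewrite le_eqVlt; apply/orP; left; apply/eqP.
by apply: eq_integral => x _; rewrite /= normr_id.
Qed.

Lemma le_norm_bochner_integral_itv a b f K : a <= b ->
  bochner_integrable mu `[a, b] f -> (forall r, a <= r <= b -> `|f r| <= K) ->
  `|bochner_integral mu `[a, b] f| <= K * (b - a).
Proof.
move=> ab ff fK; rewrite -lee_fin.
apply: le_trans (le_norm_bochner_integral _ _ ff) _ => //.
  exact: lebesgue_measure_itvcc_fin.
rewrite EFinM -lebesgue_measure_itvcc // -integral_cst //.
apply: ge0_le_integral => //.
by apply: measurable_norm => //; case: ff.
Qed.

Lemma bochner_integral_itv0 a f :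
  bochner_integrable mu `[a, a] f -> bochner_integral mu `[a, a] f = 0.
Proof.
move=> ff; apply/eqP; rewrite -normr_le0 -(mulr0 `|f a|) -[X in _ * X](subrr a).
apply: le_norm_bochner_integral_itv => // r /le_anti ->; exact: lexx.
Qed.

(** The factor [L] is kept in the integrand, which is thus an exact derivative; no division by [L]
    occurs, and [L] may be 0. *)
Lemma integral_expR a b (L B : R) : a <= b ->
  (\int[mu]_(x in `[a, b]) (B * (L * expR (L * (x - a))))%:E)%E =
  (B * (expR (L * (b - a)) - 1))%:E.
Proof.
rewrite le_eqVlt => /orP[/eqP <-|ab].
  rewrite set_itv1 integral_set1 subrr mulr0 expR0 subrr mulr0 //.
have dF (C x : R) : is_derive x 1 (fun x => C * expR (L * (x - a)))
    (C * (L * expR (L * (x - a)))).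
  have h1 : is_derive x 1 (fun x => L * (x - a)) L.
    by apply: is_derive_eq; rewrite subr0 /GRing.scale /= mulr1.
  have h2 := @is_derive1_comp _ expR (fun x => L * (x - a)) _ _ _ (is_derive_expR _) h1.
  apply: is_derive_eq; rewrite /GRing.scale /=; ring.
have cF (C x : R) : {for x, continuous (fun x => C * expR (L * (x - a)))}.
  by apply: differentiable_continuous; apply/derivable1_diffP; exact: (@ex_derive _ _ _ _ _ _ _ (dF _ x)).
rewrite (@continuous_FTC2 _ _ (fun x => B * expR (L * (x - a)))) //.
- rewrite -EFinB; congr EFin; rewrite [a - a]subrr mulr0 expR0; ring.
- apply: continuous_subspaceT => x.
  under eq_fun do rewrite mulrA.
  exact: cF.
- split; first by move=> x _; exact: (@ex_derive _ _ _ _ _ _ _ (dF _ x)).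
  + by apply: cvg_at_right_filter; exact: cF.
  + by apply: cvg_at_left_filter; exact: cF.
- by move=> x _; rewrite derive1E derive_val.
Qed.

Lemma le_norm_bochner_integral_expR a b f (L B : R) : a <= b ->
  bochner_integrable mu `[a, b] f ->
  (forall r, a <= r <= b -> `|f r| <= B * (L * expR (L * (r - a)))) ->
  `|bochner_integral mu `[a, b] f| <= B * (expR (L * (b - a)) - 1).
Proof.
move=> ab ff fB; rewrite -lee_fin.
apply: le_trans (le_norm_bochner_integral _ _ ff) _ => //.
  exact: lebesgue_measure_itvcc_fin.
rewrite -integral_expR //; apply: ge0_le_integral => //.
- by apply: measurable_norm => //; case: ff.
- apply/measurable_EFinP; apply: measurable_funM; first exact: measurable_cst.
  apply: measurable_funM; first exact: measurable_cst.
  apply: measurableT_comp; first exact: measurable_expR.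
  apply: measurable_funM; first exact: measurable_cst.
  exact: measurable_funB.
Qed.

Lemma bochner_integrable_sub_itv a b c e f : a <= b -> c <= e ->
  bochner_integrable mu `[a, e] f -> bochner_integrable mu `[b, c] f.
Proof.
move=> ab ce; apply: sub_bochner_integrable => // x /=.
by rewrite !in_itv /= => /andP[bx xc]; rewrite (le_trans ab bx) (le_trans xc ce).
Qed.

Lemma bochner_integral_itv_split a b c f : a <= b <= c ->
  bochner_integrable mu `[a, c] f ->
  bochner_integral mu `[a, c] f =
  bochner_integral mu `[a, b] f + bochner_integral mu `[b, c] f.
Proof.
move=> /andP[ab bc] ff.
have muac := lebesgue_measure_itvcc_fin a c.
have f1 : bochner_integrable mu `[a, b] f by exact: bochner_integrable_sub_itv ff.
have f2 : bochner_integrable mu `[b, c] f by exact: bochner_integrable_sub_itv ff.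
have s1 : `[a, b] `<=` `[a, c].
  by move=> x /=; rewrite !in_itv /= => /andP[-> /le_trans]; apply.
have s2 : `[b, c] `<=` `[a, c].
  by move=> x /=; rewrite !in_itv /= => /andP[/(le_trans ab) -> ->].
have mi x y : measurable (`[x, y]%classic : set (measurableTypeR R)) by exact: measurable_itv.
have i1 := is_bochner_integral_patch (mi _ _) (mi _ _) muac s1
  (bochner_integralP (mi _ _) (lebesgue_measure_itvcc_fin _ _) f1).
have i2 := is_bochner_integral_patch (mi _ _) (mi _ _) muac s2
  (bochner_integralP (mi _ _) (lebesgue_measure_itvcc_fin _ _) f2).
have i3 := bochner_integralP (mi _ _) muac ff.
(* On [[a, c]] the function [f] minus the two extensions by zero vanishes except at [b], where it
   equals [- f b] since [b] lies in both subintervals; so the integral of its norm is 0. *)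
have := is_bochner_integralB (mi _ _) muac i3 (is_bochner_integralD (mi _ _) muac i1 i2).
move=> /(is_bochner_integral_le_norm (mi _ _) muac).
rewrite (_ : (\int[mu]_(x in _) _)%E = 0%E).
  by rewrite lee_fin normr_le0 subr_eq0 => /eqP.
rewrite -[RHS](integral_set1 (fun x => `|- f x|%:E) b).
have -> : [set b] = `[a, c] `&` [set b].
  by apply/esym/setIidPr => _ ->; rewrite /= in_itv /= ab.
rewrite integral_mkcondr; apply: eq_integral => x; rewrite inE /= in_itv /= => /andP[ax xc].
rewrite /= /patch.
case: (ltgtP x b) => xb.
- rewrite mem_set; last by rewrite /= in_itv /= ax ltW.
  rewrite memNset; last by rewrite /= in_itv /= (lt_geF xb).
  rewrite memNset; last by move=> /= xb'; rewrite xb' ltxx in xb.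
  by rewrite addr0 subrr normr0.
- rewrite memNset; last by rewrite /= in_itv /= (lt_geF xb) andbF.
  rewrite mem_set; last by rewrite /= in_itv /= xc ltW.
  rewrite memNset; last by move=> /= xb'; rewrite xb' ltxx in xb.
  by rewrite add0r subrr normr0.
- rewrite xb mem_set; last by rewrite /= in_itv /= lexx ab.
  rewrite mem_set; last by rewrite /= in_itv /= lexx bc.
  by rewrite mem_set // opprD addNKr.
Qed.

End interval_integral.

(** * Calculus on intervals and strict differentiability *)

(** A supremum argument of the kind behind Cousin's lemma, standing in for compactness of [[a, b]].
    The local hypothesis concerns only intervals containing [t], so estimates centred at [t], such
    as differentiability at [t], can supply it, with a radius depending on [t]. *)
Lemma interval_concatenation (R : realType) (P : R -> R -> Prop) (a b : R) :
  a <= b ->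
  (forall x y z, a <= x -> x <= y -> y <= z -> z <= b ->
    P x y -> P y z -> P x z) ->
  (forall t, a <= t <= b -> exists2 d, 0 < d &
    forall x y, a <= x -> x <= t -> t <= y -> y <= b ->
      t - d < x -> y < t + d -> P x y) ->
  P a b.
Proof.
move=> ab Pcat Ploc.
pose E := [set t | a <= t <= b /\ P a t].
have Ea : E a.
  have [|d d0 Pd] := Ploc a; first by rewrite lexx.
  by split; [rewrite lexx|apply: Pd => //; lra].
have hsE : has_sup E by split; [exists a|exists b => t [/andP[]]].
have ac : a <= sup E by exact: ub_le_sup (proj2 hsE) _ Ea.
have cb : sup E <= b by apply: ge_sup; [exists a|move=> t [/andP[]]].
have [|d d0 Pd] := Ploc (sup E); first by rewrite ac cb.
have [t [/andP[at_ tb] Pat] ct] := sup_adherent d0 hsE.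
have tc : t <= sup E by apply: ub_le_sup (proj2 hsE) _ _; split => //; rewrite at_.
(* [y] exceeds the supremum unless it equals [b]; since [P a y] puts it in [E], it equals [b]. *)
pose y := Num.min b (sup E + d / 2).
have cy : sup E <= y by rewrite le_min cb; lra.
have yb : y <= b by rewrite ge_min lexx.
have yd : y < sup E + d by rewrite gt_min; apply/orP; right; lra.
have Pay : P a y.
  by apply: (Pcat a t y) => //; [exact: le_trans tc cy|exact: Pd].
have yE : y <= sup E.
  by apply: ub_le_sup (proj2 hsE) _ _; split => //; rewrite yb (le_trans ac cy).
have by_ : b <= y.
  move: yE; rewrite {1}/y ge_min => /orP[bc|]; first exact: le_trans bc cy.
  by move=> H; exfalso; lra.
by have -> : b = y by apply/le_anti; rewrite by_ yb.
Qed.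

(** * Frechet derivatives and the mean value inequality *)

Section mean_value.
Context (R : realType) (V W : normedModType R).

Lemma differentiable_approx (g : V -> W) (z : V) : differentiable g z ->
  forall e : R, 0 < e -> exists2 d : R, 0 < d &
    forall w, `|w| < d -> `|g (z + w) - g z - 'd g z w| <= e * `|w|.
Proof.
move=> /diff_locallyP [_ /eqaddoP gz] e e0.
have /nbhs_ballP [d /= d0 dH] := gz _ e0.
exists d => // w wd; have := dH w.
rewrite -ball_normE /= sub0r normrN => /(_ wd).
by move=> H; rewrite [z + w]addrC -addrA -opprD; exact: H.
Qed.

Lemma continuous_linear_bound (L : {linear V -> W}) : continuous L ->
  exists2 K : R, 0 < K & forall v, `|L v| <= K * `|v|.
Proof.
move=> cL; have /linear_boundedP [M [_ MH]] := continuous_linear_bounded (0 : V) (cL 0).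
exists (`|M| + 1); first by rewrite ltr_wpDl.
by apply: MH; rewrite (le_lt_trans (ler_norm _)) // ltrDl.
Qed.

Lemma differentiable_of_approx (g : V -> W) (z : V) (L : {linear V -> W}) K :
  (forall v, `|L v| <= K * `|v|) ->
  (forall e : R, 0 < e -> exists2 d : R, 0 < d &
    forall w, `|w| < d -> `|g (z + w) - g z - L w| <= e * `|w|) ->
  differentiable g z /\ 'd g z = L :> (V -> W).
Proof.
move=> LK gL; have cL := linear_bound_continuous LK.
have gzE : g \o shift z = cst (g z) + L +o_ (0 : V) id.
  apply/eqaddoP => e e0; have [d d0 dH] := gL e e0.
  apply/nbhs_ballP; exists d => //= w; rewrite -ball_normE /= sub0r normrN => wd.
  have := dH w wd; rewrite [z + w]addrC -addrA -opprD; exact.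
have dgL := diff_unique cL gzE.
split => //; apply/diff_locallyP; rewrite dgL; split => //.
Qed.

(** The difference of [g] and [A] is followed along the segment from [y'] to [y]. Pointwise
    differentiability bounds its increments on both sides of each parameter, up to a slack [eta],
    and concatenation adds these bounds up. *)
Lemma mean_value_ball (g : V -> W) (A : {linear V -> W}) (c : V) (r e : R) :
  (forall z, `|z - c| <= r -> differentiable g z) ->
  (forall z, `|z - c| <= r -> forall v, `|'d g z v - A v| <= e * `|v|) ->
  forall y y', `|y - c| <= r -> `|y' - c| <= r ->
    `|g y - g y' - A (y - y')| <= e * `|y - y'|.
Proof.
move=> dg gA y y' yr y'r.
have [->|yy'] := eqVneq y y'; first by rewrite !subrr linear0 subrr !normr0 mulr0.
set v := y - y'.
have v0 : 0 < `|v| by rewrite normr_gt0 subr_eq0.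
pose h t := g (y' + t *: v) - A (t *: v).
apply/ler_addgt0Pr => eta0 eta00.
pose eta := eta0 / `|v|.
have eta_gt0 : 0 < eta by rewrite divr_gt0.
have ball t : 0 <= t <= 1 -> `|y' + t *: v - c| <= r.
  move=> /andP[t0 t1].
  have -> : y' + t *: v - c = t *: (y - c) + (1 - t) *: (y' - c).
    rewrite scalerBl scale1r addrCA -scalerBr opprB addrA subrK.
    by rewrite addrAC.
  apply: le_trans (ler_normD _ _) _; rewrite !normrZ !ger0_norm ?subr_ge0 //.
  nra.
suff : `|h 1 - h 0| <= (e + eta) * (1 - 0) * `|v|.
  rewrite /h !scale1r !scale0r linear0 addr0 subr0 [y' + v]addrC subrK.
  rewrite addrAC subr0 mulr1 mulrDl => /le_trans; apply.
  by rewrite /eta divfK // gt_eqF.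
apply: (@interval_concatenation _ (fun s t => `|h t - h s| <= (e + eta) * (t - s) * `|v|)) => //.
  move=> s t u _ _ _ _ st tu.
  rewrite -(subrK (h t) (h u)) -addrA (le_trans (ler_normD _ _)) //.
  apply: le_trans (lerD tu st) _; lra.
move=> t t01; have [d d0 dH] := differentiable_approx (dg _ (ball t t01)) eta_gt0.
have dev s : `|s - t| < d / `|v| -> `|h s - h t| <= (e + eta) * `|s - t| * `|v|.
  move=> std; have /dH : `|(s - t) *: v| < d by rewrite normrZ -ltr_pdivlMr.
  have -> : y' + t *: v + (s - t) *: v = y' + s *: v.
    by rewrite -addrA -scalerDl [t + _]addrC subrK.
  move=> Hd; have -> : h s - h t =
      (g (y' + s *: v) - g (y' + t *: v) - 'd g (y' + t *: v) ((s - t) *: v)) +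
      ('d g (y' + t *: v) ((s - t) *: v) - A ((s - t) *: v)).
    rewrite addrA subrK /h (scalerBl s t v) (linearB A).
    by rewrite [in LHS]opprD addrACA -opprD.
  apply: le_trans (ler_normD _ _) _; apply: le_trans (lerD Hd (gA _ (ball t t01) _)) _.
  rewrite !normrZ; lra.
exists (d / `|v|); first by rewrite divr_gt0.
move=> s u _ st tu _ sd ud.
have /dev H1 : `|s - t| < d / `|v| by rewrite ler0_norm ?subr_le0 //; lra.
have /dev H2 : `|u - t| < d / `|v| by rewrite ger0_norm ?subr_ge0 //; lra.
move: H1 H2; rewrite ler0_norm ?subr_le0 // (ger0_norm (x := u - t)) ?subr_ge0 //.
rewrite -[h s - h t]opprB normrN => H1 H2.
rewrite -(subrK (h t) (h u)) -addrA (le_trans (ler_normD _ _)) //.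
apply: le_trans (lerD H2 H1) _; lra.
Qed.

End mean_value.

Lemma addrAK (V : zmodType) (x y : V) : x + y - x = y.
Proof. by rewrite addrAC subrr add0r. Qed.

(** * The operator norm and continuity of derivatives *)

Section operator_norm.
Context (R : realType) (U W : normedModType R).

Lemma opnorm_leP (L : U -> W) (e : R) : (forall a v, L (a *: v) = a *: L v) ->
  0 <= e -> ((opnorm L <= e%:E)%E <-> forall v, `|L v| <= e * `|v|).
Proof.
move=> Lh e0; split => [Le v|Lv].
  have [->|v0] := eqVneq v 0.
    by rewrite -(scale0r (0 : U)) Lh !scale0r !normr0 mulr0.
  have nv : 0 < `|v| by rewrite normr_gt0.
  rewrite -ler_pdivrMr //.
  have -> : `|L v| / `|v| = `|L (`|v|^-1 *: v)|.
    by rewrite Lh normrZ normfV normr_id mulrC.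
  rewrite -lee_fin; apply: le_trans Le; apply: ereal_sup_ubound.
  exists (`|v|^-1 *: v) => //=; rewrite normrZ normfV normr_id mulVf //.
  by rewrite gt_eqF.
apply: ge_ereal_sup => _ [v /= v1 <-]; rewrite lee_fin.
by apply: le_trans (Lv v) _; rewrite ler_piMr.
Qed.

Lemma opnorm_ge0 (L : U -> W) : (0 <= opnorm L)%E.
Proof.
apply: (@le_trans _ _ (`|L 0|%:E)); first by rewrite lee_fin.
by apply: ereal_sup_ubound; exists 0 => //=; rewrite normr0.
Qed.

Lemma L_continuous_onP (P : topologicalType) (A : set P)
    (D : P -> {linear U -> W}) :
  L_continuous_on A (fun p => D p : U -> W) <->
  forall p, A p -> forall e : R, 0 < e ->
    \forall q \near within A (nbhs p), forall v, `|D q v - D p v| <= e * `|v|.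
Proof.
have DDh p q a v : (D q \- D p) (a *: v) = a *: (D q \- D p) v.
  by rewrite /= (linearZZ (D q)) (linearZZ (D p)) scalerBr.
split => [LD p Ap e e0|LD p Ap].
  have /fine_cvgP [fin0 /cvgr0Pnorm_lt /(_ _ e0) lt0] := LD p Ap.
  near=> q; apply/(opnorm_leP _ (ltW e0)); first exact: DDh.
  have fq : opnorm (D q \- D p) \is a fin_num by near: q; exact: fin0.
  rewrite -(fineK fq) lee_fin ltW //; apply: le_lt_trans (ler_norm _) _.
  by near: q; exact: lt0.
have near_le (e : R) : 0 < e -> \forall q \near within A (nbhs p),
    (opnorm (D q \- D p)%R <= e%:E)%E.
  move=> e0; have := LD p Ap _ e0; apply: filterS => q Dq.
  by apply/(opnorm_leP _ (ltW e0)) => //; exact: DDh.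
have fin (e : R) q : (opnorm (D q \- D p)%R <= e%:E)%E -> opnorm (D q \- D p) \is a fin_num.
  by move=> le; rewrite ge0_fin_numE ?opnorm_ge0 // (le_lt_trans le) ?ltry.
apply: (proj2 (fine_cvgP _ _)); split.
  by have := near_le 1 ltr01; apply: filterS => q; exact: fin.
apply/cvgr0Pnorm_le => e e0; have := near_le _ e0; apply: filterS => q le.
rewrite ger0_norm ?fine_ge0 ?opnorm_ge0 //.
by rewrite -lee_fin fineK // (fin _ _ le).
Unshelve. all: by end_near. Qed.

(** By homogeneity it is enough to test on a multiple [h *: v] so short that both the assumed
    estimate and the one defining the differential apply. This is how strict differentiability at
    one point controls the differentials at nearby points. *)
Lemma differential_close (g : U -> W) (z : U) (L : {linear U -> W}) (e d : R) :
  differentiable g z -> 0 < d ->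
  (forall w, `|w| < d -> `|g (z + w) - g z - L w| <= e * `|w|) ->
  forall v, `|'d g z v - L v| <= e * `|v|.
Proof.
move=> dg d0 gL v; apply/ler_addgt0Pr => eta eta0.
have v1 : 0 < `|v| + 1 by rewrite ltr_wpDl.
have e10 : 0 < eta / (`|v| + 1) by rewrite divr_gt0.
have [d1 d10 dH] := differentiable_approx dg e10.
pose h := Num.min d d1 / (`|v| + 1).
have h0 : 0 < h by rewrite divr_gt0 // lt_min d0.
have hv : `|h *: v| < Num.min d d1.
  rewrite normrZ gtr0_norm // /h mulrAC ltr_pdivrMr // ltr_pM2l ?lt_min ?d0 //.
  by rewrite ltrDl.
move: hv; rewrite lt_min => /andP[/gL H1 /dH H2].
have : `|'d g z (h *: v) - L (h *: v)| <= e * `|h *: v| + eta / (`|v| + 1) * `|h *: v|.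
  rewrite (_ : 'd g z _ - _ = (g (z + h *: v) - g z - L (h *: v)) -
      (g (z + h *: v) - g z - 'd g z (h *: v))).
    exact: le_trans (ler_normB _ _) (lerD H1 H2).
  by rewrite opprB [RHS]addrC addrA subrK.
rewrite (linearZZ L) linearZZ -scalerBr normrZ (gtr0_norm h0) normrZ (gtr0_norm h0).
rewrite [X in _ <= X -> _](_ : _ = h * (e * `|v| + eta / (`|v| + 1) * `|v|)); last by ring.
rewrite ler_pM2l // => /le_trans; apply.
rewrite lerD2l mulrAC ler_pdivrMr // ler_wpM2l ?(ltW eta0) //.
by rewrite lerDl.
Qed.

End operator_norm.

Section near_triples.
Context (R : realType) (V : normedModType R).

Lemma near_tripleP (s0 t0 : R) (x0 : V) (Q : R * R * V -> Prop) :
  (\forall q \near nbhs (s0, t0, x0), Q q) <->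
  exists2 d : R, 0 < d & forall s t x, `|s - s0| < d -> `|t - t0| < d ->
    `|x - x0| < d -> Q (s, t, x).
Proof.
split=> [/nbhs_ballP [d /= d0 dQ]|[d d0 dQ]].
  exists d => // s t x ss tt xx; apply: dQ.
  by split; [split|]; rewrite -ball_normE /= distrC.
apply/nbhs_ballP; exists d => // -[[s t] x] [[]] /=.
by rewrite -!ball_normE /= => ss tt xx; apply: dQ; rewrite distrC.
Qed.

Lemma near_pairP (t0 : R) (x0 : V) (Q : R * V -> Prop) :
  (\forall q \near nbhs (t0, x0), Q q) <->
  exists2 d : R, 0 < d & forall t x, `|t - t0| < d ->
    `|x - x0| < d -> Q (t, x).
Proof.
split=> [/nbhs_ballP [d /= d0 dQ]|[d d0 dQ]].
  exists d => // t x tt xx; apply: dQ.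
  by split; rewrite -ball_normE /= distrC.
apply/nbhs_ballP; exists d => // -[t x] [] /=.
by rewrite -!ball_normE /= => tt xx; apply: dQ; rewrite distrC.
Qed.

End near_triples.

(** A strict derivative [L] at [p] approximates increments based at every [q] near [p], so the
    differential at [q] is within [e] of [L]: strict derivatives at all points are automatically
    continuous. *)
Lemma continuously_differentiable_of_strict (R : realType)
    (U W : normedModType R) (A : set U) (F : U -> W) :
  (forall p, A p -> exists (L : {linear U -> W}) K,
    (forall v, `|L v| <= K * `|v|) /\
    forall e : R, 0 < e -> exists2 d : R, 0 < d & forall q q', `|q - p| < d -> `|q' - p| < d ->
      `|F q - F q' - L (q - q')| <= e * `|q - q'|) ->
  continuously_differentiable_on A F.
Proof.
move=> AF.
have dF p (Ap : A p) (L : {linear U -> W}) K : (forall v, `|L v| <= K * `|v|) ->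
    (forall e : R, 0 < e -> exists2 d : R, 0 < d & forall q q', `|q - p| < d -> `|q' - p| < d ->
      `|F q - F q' - L (q - q')| <= e * `|q - q'|) ->
    differentiable F p /\ 'd F p = L :> (U -> W).
  move=> LK FL; apply: (differentiable_of_approx LK) => e /FL [d d0 dH].
  exists d => // w wd; have := dH (p + w) p.
  by rewrite addrAK subrr normr0; apply.
split.
  by move=> p Ap; have [L [K [LK FL]]] := AF p Ap; have [] := dF p Ap L K LK FL.
apply/L_continuous_onP => p Ap e e0.
have [L [K [LK FL]]] := AF p Ap; have [_ dFL] := dF p Ap L K LK FL.
have [d d0 dH] := FL e e0.
(* Half the radius, so that [q] and [q + w] both stay within [d] of [p]. *)
have d20 : 0 < d / 2 by rewrite divr_gt0.
rewrite near_withinE; apply/nbhs_ballP; exists (d / 2) => //= q.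
rewrite -ball_normE /= distrC => qp Aq v; rewrite dFL.
have [L' [K' [LK' FL']]] := AF q Aq; have [dFq _] := dF q Aq L' K' LK' FL'.
apply: (differential_close dFq d20) => w wd.
have := dH (q + w) q; rewrite addrAK; apply.
  rewrite addrAC (le_lt_trans (ler_normD _ _)) //.
  by rewrite [ltRHS]splitr ltrD.
by apply: lt_trans qp _; lra.
Qed.

(** The version with parameters: [(s, t)] ranges over [A] only, which need not be open. The estimate
    is returned with the differential itself because joint differentiability and the perturbation
    formula rely on it. *)
Lemma C001_of_strict (R : realType) (V : normedModType R) (A : set (R * R))
    (g : R -> R -> V -> V) :
  {within A `*` setT, continuous (fun p : R * R * V => g p.1.1 p.1.2 p.2)} ->
  (forall s0 t0 x0, A (s0, t0) -> exists (L : {linear V -> V}) K,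
    (forall v, `|L v| <= K * `|v|) /\
    forall e : R, 0 < e -> exists2 d : R, 0 < d & forall s t x y, A (s, t) ->
      `|s - s0| < d -> `|t - t0| < d -> `|x - x0| < d -> `|y - x0| < d ->
      `|g s t x - g s t y - L (x - y)| <= e * `|x - y|) ->
  C001 A g /\
  (forall s0 t0 x0, A (s0, t0) ->
    forall e : R, 0 < e -> exists2 d : R, 0 < d & forall s t x y, A (s, t) ->
      `|s - s0| < d -> `|t - t0| < d -> `|x - x0| < d -> `|y - x0| < d ->
      `|g s t x - g s t y - 'd (g s0 t0) x0 (x - y)| <= e * `|x - y|).
Proof.
move=> cg AF.
have dF s0 t0 x0 (Ap : A (s0, t0)) (L : {linear V -> V}) K :
    (forall v, `|L v| <= K * `|v|) ->
    (forall e : R, 0 < e -> exists2 d : R, 0 < d & forall s t x y, A (s, t) ->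
      `|s - s0| < d -> `|t - t0| < d -> `|x - x0| < d -> `|y - x0| < d ->
      `|g s t x - g s t y - L (x - y)| <= e * `|x - y|) ->
    differentiable (g s0 t0) x0 /\ 'd (g s0 t0) x0 = L :> (V -> V).
  move=> LK FL; apply: (differentiable_of_approx LK) => e /FL [d d0 dH].
  exists d => // w wd; have := dH s0 t0 (x0 + w) x0.
  by rewrite addrAK !subrr !normr0; apply.
split; last first.
  move=> s0 t0 x0 A0 e e0; have [L [K [LK FL]]] := AF s0 t0 x0 A0.
  have [_ dFL] := dF s0 t0 x0 A0 L K LK FL.
  by rewrite dFL; exact: FL.
split => //.
  move=> s t x Ap; have [L [K [LK FL]]] := AF s t x Ap.
  by have [] := dF s t x Ap L K LK FL.
apply: (proj2 (@L_continuous_onP R V V (R * R * V)%type (A `*` setT) (fun p => 'd (g p.1.1 p.1.2) (p.2)))).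
move=> [[s0 t0] x0] [/= Ap _] e e0.
have [L [K [LK FL]]] := AF _ _ x0 Ap; have [_ dFL] := dF _ _ _ Ap L K LK FL.
have [d d0 dH] := FL e e0.
have d20 : 0 < d / 2 by rewrite divr_gt0.
rewrite near_withinE; apply/near_tripleP; exists (d / 2) => // s t x ss tt xx [/= Aq _] v.
rewrite dFL.
have [L' [K' [LK' FL']]] := AF s t x Aq; have [dFq _] := dF _ _ _ Aq L' K' LK' FL'.
apply: (differential_close dFq d20) => w wd.
have := dH s t (x + w) x Aq; rewrite addrAK; apply.
- by apply: lt_trans ss _; lra.
- by apply: lt_trans tt _; lra.
- rewrite addrAC (le_lt_trans (ler_normD _ _)) //.
  by rewrite [ltRHS]splitr ltrD.
- by apply: lt_trans xx _; lra.
Qed.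

Lemma subr_chain (V : zmodType) (b c a d : V) :
  a - d = (a - b) + ((b - c) + (c - d)).
Proof. by rewrite !addrA !subrK. Qed.

Lemma subrACA (V : zmodType) (x y z u : V) :
  x - y - (z - u) = x - z - (y - u).
Proof. by rewrite !opprD addrACA. Qed.

Lemma subr_recenter (V : zmodType) (x y z u : V) :
  x - z - (u + (y - z)) = x - y - u.
Proof. by rewrite [u + _]addrC opprD opprB !addrA subrK. Qed.

Lemma within_continuous_itvP (R : realType) (V : normedModType R) (a b : R)
    (f : R -> V) :
  {within `[a, b], continuous f} <->
  forall t, a <= t <= b -> forall e, 0 < e -> exists2 d, 0 < d &
    forall r, a <= r <= b -> `|r - t| < d -> `|f r - f t| < e.
Proof.
split=> [/subspace_continuousP cf t tab e e0|cf].
  have /cvgrPdist_lt /(_ _ e0) := cf t tab.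
  rewrite near_withinE => /nbhs_ballP [d /= d0 dH]; exists d => // r rab rt.
  by rewrite distrC; apply: dH => //; rewrite -ball_normE /= distrC.
apply/subspace_continuousP => t tab; apply/cvgrPdist_lt => e e0.
have [d d0 dH] := cf t tab e e0.
rewrite near_withinE; apply/nbhs_ballP; exists d => // r.
rewrite -ball_normE /= distrC => rt rab; rewrite distrC; exact: dH.
Qed.

(* The bound [rho] makes the lemma a continuation principle as well: the
   integral inequality is only required as long as [u] stays below [rho]. *)
Lemma gronwall (R : realType) (u : R -> R) (a b c L rho : R) :
  {within `[a, b], continuous u} -> 0 <= c ->
  c * expR (L * (b - a)) < rho -> 0 <= L -> u a <= c ->
  (forall t B, a <= t <= b -> 0 <= B ->
    (forall r, a <= r <= t -> u r <= rho) ->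
    (forall r, a <= r <= t -> u r <= B * expR (L * (r - a))) ->
    u t <= c + B * (expR (L * (t - a)) - 1)) ->
  forall t, a <= t <= b -> u t <= c * expR (L * (t - a)).
Proof.
move=> cu c0 crho L0 ua H t /andP[a_t tb]; have ab := le_trans a_t tb.
apply/ler_addgt0Pr => e e0.
pose Eb := expR (L * (b - a)).
have Eb0 : 0 < Eb by exact: expR_gt0.
(* Small enough that the enlarged bound [(c + eta) * Eb] stays below [rho] and exceeds [c * Eb] by
   at most [e]. *)
pose eta := Num.min (e / Eb) ((rho - c * Eb) / Eb).
have eta0 : 0 < eta by rewrite lt_min !divr_gt0 // subr_gt0.
have expE r : a <= r <= b -> expR (L * (r - a)) <= Eb.
  by move=> /andP[ar rb]; rewrite ler_expR ler_wpM2l // lerB.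
have etae : eta * Eb <= e by rewrite -ler_pdivlMr // ge_min lexx.
have etarho : (c + eta) * Eb <= rho.
  by rewrite mulrDl -lerBrDl -ler_pdivlMr // ge_min lexx orbT.
have c'0 : 0 < c + eta by rewrite ltr_wpDl.
pose h r := u r - (c + eta) * expR (L * (r - a)).
pose P t := forall r, a <= r <= t -> h r <= 0.
have ch : {within `[a, b], continuous h}.
  move=> x; apply: cvgB; first exact: cu.
  apply: cvgMr; apply: (@continuous_subspaceT _ _ _ (fun r => expR (L * (r - a)))) => y.
  apply: continuous_comp; last exact: continuous_expR.
  by apply: cvgMr; apply: cvgB; [exact: cvg_id|exact: cvg_cst].
move/within_continuous_itvP in ch.
suff Pb : P a -> P b.
  have /Pb : P a.
    move=> r /le_anti <-; rewrite /h subrr mulr0 expR0 mulr1 subr_le0.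
    by rewrite (le_trans ua) // lerDl ltW.
  move=> /(_ t); rewrite a_t tb => /(_ isT); rewrite subr_le0 => /le_trans; apply.
  rewrite mulrDl lerD2l (le_trans _ etae) // ler_wpM2l ?(ltW eta0) //.
  by apply: expE; rewrite a_t.
(* The property concatenated is an implication, so that it holds vacuously wherever [P] has already
   failed. *)
apply: (@interval_concatenation _ (fun x y => P x -> P y)) => //.
  by move=> x y z _ _ _ _ xy yz /xy.
move=> s sab; have /andP[as_ sb] := sab; have [Ps|nPs] := pselect (P s).
  (* With [B = c + eta] the hypothesis improves [h s <= 0] to [h s <= - eta], the gain being the
     excess of [B] over [c]; continuity spends it to go beyond [s]. *)
  have hs : h s <= - eta.
    have := H s (c + eta) sab (ltW c'0).
    rewrite /h; move=> /(_ _ _)/le_trans us; rewrite lerBlDr; apply: us.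
    - move=> r rs; have := Ps r rs; rewrite subr_le0 => /le_trans; apply.
      apply: le_trans etarho; rewrite ler_wpM2l ?(ltW c'0) //.
      by apply: expE; move: rs => /andP[-> rs]; rewrite (le_trans rs).
    - by move=> r rs; have := Ps r rs; rewrite subr_le0.
    - lra.
  have [d d0 dH] := ch s sab eta eta0.
  exists d => // x y ax xs sy yb xd yd _ r /andP[ar ry].
  have [rs|sr] := leP r s; first by apply: Ps; rewrite ar.
  have := dH r; rewrite ar (le_trans ry yb) => /(_ isT).
  rewrite ger0_norm ?subr_ge0 ?(ltW sr) // => /(_ ltac:(lra)).
  by rewrite ltr_norml => /andP[_]; lra.
(* If [h] is positive at some [r0 < s], then [P x] fails for all [x] past [r0]; if it is positive at
   [s] itself, continuity makes it positive slightly before, and again [P x] fails. *)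
have [r0 /andP[ar0 r0s] hr0] : exists2 r, a <= r <= s & 0 < h r.
  apply: contrapT => /forall2NP nr; apply: nPs => r ras.
  by have [|/negP] := nr r; rewrite ?ras // -leNgt.
move: r0s; rewrite le_eqVlt => /orP[/eqP r0s|r0s].
  rewrite r0s in hr0; have [d d0 dH] := ch s sab _ hr0.
  exists d => // x y ax xs sy yb xd yd Px.
  have := dH x; rewrite ax (le_trans xs sb) => /(_ isT).
  rewrite ler0_norm ?subr_le0 // => /(_ ltac:(lra)).
  have := Px x; rewrite ax lexx => /(_ isT) hx.
  by rewrite ltr_norml => /andP[+ _]; lra.
exists (s - r0); first by rewrite subr_gt0.
move=> x y ax xs sy yb xd yd Px.
by have := Px r0; rewrite ar0 => /(_ ltac:(lra)); rewrite leNgt hr0.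
Qed.

Lemma cvg_norm_le (R : realType) (V : normedModType R) (u : nat -> V) (l c : V)
    (k : R) (N : nat) :
  u n @[n --> \oo] --> l -> (forall n, (N <= n)%N -> `|u n - c| <= k) ->
  `|l - c| <= k.
Proof.
move=> ul uk; have cu : `|u n - c| @[n --> \oo] --> `|l - c|.
  by apply: cvg_norm; apply: cvgB => //; exact: cvg_cst.
apply: (@ler_cvg_to _ \oo _ _ (fun n => `|u n - c|) (fun=> k)) => //.
  exact: cvg_cst.
by exists N => // n /= /uk.
Qed.

Lemma ex_small_scale (R : realType) (x d : R) : 0 < d ->
  exists N : nat, forall n, (N <= n)%N -> n.+1%:R^-1 * x < d.
Proof.
move=> d0; exists (Num.truncn (`|x| / d)) => n Nn.
rewrite ltr_pdivrMl ?ltr0n //; apply: le_lt_trans (ler_norm _) _.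
rewrite -ltr_pdivrMr //; apply: lt_le_trans (truncnS_gt _) _.
by rewrite ler_nat ltnS.
Qed.

(** * Strict derivatives from almost proportional increments *)

Section strict_differentiability.
Context (R : realType) (V W : completeNormedModType R).

Section at_point.
Context (G : V -> W) (x0 : V).
(** A derivative-free form of strict differentiability at [x0]: a strict derivative would give it
    with error [2 * e], and completeness of [W] gives the converse below. *)
Hypothesis almost_linear : forall e : R, 0 < e -> exists2 d : R, 0 < d &
  forall y z y' z' (k : R), `|y - x0| < d -> `|z - x0| < d -> `|y' - x0| < d ->
    `|z' - x0| < d -> y - z = k *: (y' - z') ->
    `|G y - G z - k *: (G y' - G z')| <= e * `|y - z|.

Let q (v : V) (n : nat) := n.+1%:R *: (G (x0 + n.+1%:R^-1 *: v) - G x0).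

Let small (d : R) (v : V) : 0 < d -> exists N, forall n, (N <= n)%N ->
  `|x0 + n.+1%:R^-1 *: v - x0| < d.
Proof.
move=> d0; have [N HN] := ex_small_scale `|v| d0; exists N => n Nn.
by rewrite addrAK normrZ ger0_norm ?invr_ge0 ?ler0n // HN.
Qed.

Let q_cauchy (v : V) (e : R) : 0 < e -> exists N, forall m n, (N <= m)%N ->
  (N <= n)%N -> `|q v n - q v m| <= e * `|v|.
Proof.
move=> e0; have [d d0 dH] := almost_linear e0.
have [N HN] := small v d0; exists N => m n Nm Nn.
have n0 : (n.+1%:R : R) != 0 by rewrite pnatr_eq0.
have m0 : (m.+1%:R : R) != 0 by rewrite pnatr_eq0.
(* The increments [v/(n+1)] and [v/(m+1)] are proportional with this ratio; multiplying by [n+1]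
   compares the two quotients. *)
have := dH (x0 + n.+1%:R^-1 *: v) x0 (x0 + m.+1%:R^-1 *: v) x0 (n.+1%:R^-1 * m.+1%:R).
rewrite subrr normr0 => /(_ (HN n Nn) d0 (HN m Nm) d0).
rewrite !addrAK scalerA mulfK // => /(_ erefl).
rewrite normrZ normfV normr_nat mulrCA ler_pdivlMl ?ltr0n //.
rewrite /q; set D := G (x0 + m.+1%:R^-1 *: v) - G x0 => H.
rewrite -[m.+1%:R in X in _ - X](mulVKf n0) -scalerA -scalerBr.
by rewrite normrZ normr_nat.
Qed.

Lemma strict_derivative : exists L : {linear V -> W},
  (forall v (e : R), 0 < e -> exists N, forall n, (N <= n)%N ->
    `|q v n - L v| <= e * `|v|) /\
  forall e : R, 0 < e -> exists2 d : R, 0 < d & forall y z,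
    `|y - x0| < d -> `|z - x0| < d -> `|G y - G z - L (y - z)| <= e * `|y - z|.
Proof.
have qcvg v : cvg (q v n @[n --> \oo]).
  apply/cauchy_cvgP/cauchy_ballP => e e0.
  have v1 : 0 < `|v| + 1 by rewrite ltr_wpDl.
  have e1 : 0 < e / (`|v| + 1) by rewrite divr_gt0.
  have [N HN] := q_cauchy v e1.
  pose Q := [set y | exists2 n, (N <= n)%N & q v n = y].
  have nQ : nbhs (q v n @[n --> \oo]) Q by exists N => // n /= Nn; exists n.
  exists (Q, Q) => // -[_ _] [[m Nm <-] [n Nn <-]] /=.
  rewrite -ball_normE /=; apply: le_lt_trans (HN _ _ Nn Nm) _.
  by rewrite mulrAC ltr_pdivrMr // ltr_pM2l // ltrDl.
pose L0 v : W := lim (q v n @[n --> \oo]).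
have qL v : q v n @[n --> \oo] --> L0 v by exact: qcvg.
(* The step from [x0 + w/(n+1)] to [x0 + (k v + w)/(n+1)] is [k] times the step from [x0] to
   [x0 + v/(n+1)]; in the limit this is additivity and homogeneity at once. *)
have L0lin : linear L0.
  move=> k v w; apply/eqP; rewrite -subr_eq0 -normr_le0; apply/ler_addgt0Pr => e e0.
  rewrite add0r.
  have v1 : 0 < `|k *: v| + 1 by rewrite ltr_wpDl.
  have e1 : 0 < e / (`|k *: v| + 1) by rewrite divr_gt0.
  have [d d0 dH] := almost_linear e1.
  have [N1 H1] := small (k *: v + w) d0.
  have [N2 H2] := small w d0.
  have [N3 H3] := small v d0.
  have cv : q (k *: v + w) n - (k *: q v n + q w n) @[n --> \oo] -->
      L0 (k *: v + w) - (k *: L0 v + L0 w).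
    apply: cvgB; first exact: qL.
    by apply: cvgD; [apply: cvgZr|]; exact: qL.
  rewrite -[X in `|X|]subr0.
  apply: (cvg_norm_le (N := maxn N1 (maxn N2 N3)) cv) => n.
  rewrite !geq_max => /andP[/H1 h1 /andP[/H2 h2 /H3 h3]].
  have := dH _ _ _ x0 k h1 h2 h3; rewrite subrr normr0 => /(_ d0).
  rewrite addrAK.
  have -> : x0 + n.+1%:R^-1 *: (k *: v + w) - (x0 + n.+1%:R^-1 *: w) =
      n.+1%:R^-1 *: (k *: v).
    by rewrite opprD addrACA subrr add0r -scalerBr addrK.
  rewrite scalerA mulrC -scalerA => /(_ erefl).
  set D := _ - _ - _ => HD.
  have -> : q (k *: v + w) n - (k *: q v n + q w n) - 0 = n.+1%:R *: D.
    rewrite subr0 /q /D [k *: (n.+1%:R *: _)]scalerA [k * _]mulrC -scalerA -scalerDr.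
    rewrite -scalerBr; congr (_ *: _).
    exact: subr_recenter.
  rewrite normrZ normr_nat -ler_pdivlMl ?ltr0n //; apply: le_trans HD _.
  have -> : `|k *: (n.+1%:R^-1 *: v)| = n.+1%:R^-1 * `|k *: v|.
    by rewrite !normrZ normfV normr_nat mulrCA.
  rewrite mulrCA ler_pM2l ?invr_gt0 ?ltr0n //.
  by rewrite mulrAC ler_pdivrMr // ler_pM2l // lerDl.
pose Lm := GRing.isLinear.Build R V W *:%R L0 L0lin.
pose L : {linear V -> W} := HB.pack L0 Lm.
exists L; split.
  move=> v e e0; have [N HN] := q_cauchy v e0; exists N => n Nn.
  rewrite distrC; apply: (cvg_norm_le (N := N) (qL v)) => m Nm.
  by apply: HN.
(* Any [y - z] is [n+1] times the step [(y - z)/(n+1)] from [x0]; letting [n] grow replaces the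
   rescaled increment of [G] over that step by [L (y - z)]. *)
move=> e e0; have [d d0 dH] := almost_linear e0; exists d => // y z yd zd.
have [N HN] := small (y - z) d0.
rewrite distrC; apply: (cvg_norm_le (N := N) (qL (y - z))) => n Nn.
rewrite distrC /q; have := dH y z (x0 + n.+1%:R^-1 *: (y - z)) x0 n.+1%:R.
rewrite subrr normr0 => /(_ yd zd (HN n Nn) d0); rewrite addrAK; apply.
by rewrite scalerA mulfV ?scale1r // pnatr_eq0.
Qed.

End at_point.

(** Uniform closeness of [g p] to [g p0] gives errors that do not shrink with [x - y]. So the
    increment is first rescaled to a fixed length [r] by almost proportionality at [p], there
    transferred from [p] to [p0], and compared with [L] by the strict derivative at [p0]. *)
Lemma strict_partial_derivative (P : Type) (A : P -> Prop) (near_p0 : R -> P -> Prop)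
    (p0 : P) (g : P -> V -> W) (x0 : V) :
  (forall d, 0 < d -> near_p0 d p0) -> A p0 ->
  (forall d d' p, d <= d' -> near_p0 d p -> near_p0 d' p) ->
  (forall e : R, 0 < e -> exists2 d : R, 0 < d &
    forall p, A p -> near_p0 d p -> forall y z y' z' (k : R),
    `|y - x0| < d -> `|z - x0| < d -> `|y' - x0| < d ->
    `|z' - x0| < d -> y - z = k *: (y' - z') ->
    `|g p y - g p z - k *: (g p y' - g p z')| <= e * `|y - z|) ->
  (exists2 d0 : R, 0 < d0 & forall e : R, 0 < e -> exists2 d : R, 0 < d &
    forall p, A p -> near_p0 d p -> forall x, `|x - x0| < d0 ->
      `|g p x - g p0 x| <= e) ->
  (exists (K d : R), 0 < d /\ forall y z, `|y - x0| < d -> `|z - x0| < d ->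
    `|g p0 y - g p0 z| <= K * `|y - z|) ->
  exists (L : {linear V -> W}) K,
    (forall v, `|L v| <= K * `|v|) /\
    forall e : R, 0 < e -> exists2 d : R, 0 < d & forall p x y, A p ->
      near_p0 d p -> `|x - x0| < d -> `|y - x0| < d ->
      `|g p x - g p y - L (x - y)| <= e * `|x - y|.
Proof.
move=> np0 Ap0 nmono H1 [d0 d00 H2] [K [dK [dK0 HK]]].
have [e e0|L [Lq LG]] := @strict_derivative (g p0) x0.
  by have [d dp dH] := H1 e e0; exists d => //; apply: dH => //; exact: np0.
(* The Lipschitz bound of [g p0] holds for its difference quotients, hence for their limit. *)
have LK v : `|L v| <= K * `|v|.
  apply/ler_addgt0Pr => e e0.
  have v1 : 0 < `|v| + 1 by rewrite ltr_wpDl.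
  have e1 : 0 < e / (`|v| + 1) by rewrite divr_gt0.
  have [N1 HN1] := Lq v _ e1.
  have [N2 HN2] := ex_small_scale `|v| dK0.
  pose n := maxn N1 N2; have h1 := HN1 n (leq_maxl _ _).
  have h2 := HN2 n (leq_maxr _ _).
  have := HK (x0 + n.+1%:R^-1 *: v) x0.
  rewrite subrr normr0 addrAK normrZ normfV normr_nat => /(_ h2 dK0).
  rewrite mulrCA ler_pdivlMl ?ltr0n // -(@normr_nat R n.+1) -normrZ normr_nat => h3.
  rewrite -[L v](subKr (n.+1%:R *: (g p0 (x0 + n.+1%:R^-1 *: v) - g p0 x0))).
  apply: le_trans (ler_normB _ _) _; apply: lerD => //.
  apply: le_trans h1 _.
  by rewrite mulrAC ler_pdivrMr // ler_pM2l // lerDl.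
exists L, K; split => // e e0.
have e3 : 0 < e / 3 by rewrite divr_gt0.
have [d1 d10 h1] := H1 _ e3; have [d2 d20 h2] := LG _ e3.
pose r := Num.min d0 (Num.min d1 d2) / 2.
have r0 : 0 < r by rewrite divr_gt0 // !lt_min d00 d10.
have [rd0 rd1 rd2] : [/\ r < d0, r < d1 & r < d2].
  have : r < Num.min d0 (Num.min d1 d2).
    by rewrite /r ltr_pdivrMr // ltr_pMr ?ltr1n // !lt_min d00 d10.
  by rewrite !lt_min => /andP[-> /andP[-> ->]].
(* Two values of [g p] are replaced by values of [g p0], at a cost of [e / 6 * r] each; relative to
   the length [r] this is [e / 3]. *)
have er : 0 < e / 6 * r by rewrite mulr_gt0 // divr_gt0.
have [d3 d30 h3] := H2 _ er.
exists (Num.min d1 d3); first by rewrite lt_min d10.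
move=> p x y Ap np; rewrite !lt_min => /andP[xd1 xd3] /andP[yd1 yd3].
have np1 : near_p0 d1 p by apply: nmono np; rewrite ge_min lexx.
have np3 : near_p0 d3 p by apply: nmono np; rewrite ge_min lexx orbT.
have [->|xy] := eqVneq x y; first by rewrite !subrr linear0 subrr !normr0 mulr0.
have v0 : 0 < `|x - y| by rewrite normr_gt0 subr_eq0.
set v := x - y in v0 *.
pose k := `|v| / r; have k0 : 0 < k by rewrite divr_gt0.
pose w := k^-1 *: v.
have vw : v = k *: w by rewrite /w scalerA divff ?scale1r // gt_eqF.
have wr : `|w| = r.
  rewrite /w normrZ gtr0_norm ?invr_gt0 // /k invf_div divfK //.
  by rewrite gt_eqF.
have kr : `|v| = k * r by rewrite /k divfK // gt_eqF.
have w0 : x0 + w - x0 = w by exact: addrAK.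
have vE : x - y = v by [].
clearbody w k v r.
have x00 : `|x0 - x0| = 0 by rewrite subrr normr0.
have b1 := h1 p Ap np1 x y (x0 + w) x0 k xd1 yd1.
rewrite w0 wr x00 vE in b1; have {}b1 := b1 rd1 d10 vw.
have b2 : `|k *: (g p (x0 + w) - g p x0) - k *: (g p0 (x0 + w) - g p0 x0)| <= e / 3 * `|v|.
  rewrite -scalerBr normrZ gtr0_norm // subrACA.
  have c1 := h3 p Ap np3 (x0 + w); rewrite w0 wr in c1.
  have c2 := h3 p Ap np3 x0; rewrite x00 in c2.
  rewrite -ler_pdivlMl //.
  apply: le_trans (_ : e / 6 * r + e / 6 * r <= _); last first.
    rewrite kr mulrCA mulKf ?gt_eqF //.
    lra.
  exact: le_trans (ler_normB _ _) (lerD (c1 rd0) (c2 d00)).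
have b3 : `|k *: (g p0 (x0 + w) - g p0 x0) - L v| <= e / 3 * `|v|.
  have := h2 (x0 + w) x0; rewrite w0 wr x00 => /(_ rd2 d20).
  rewrite kr vw (linearZZ L) -scalerBr normrZ gtr0_norm //.
  by rewrite mulrCA ler_pM2l.
rewrite (subr_chain (k *: (g p (x0 + w) - g p x0)) (k *: (g p0 (x0 + w) - g p0 x0))).
apply: le_trans (ler_normD _ _) _.
apply: le_trans (lerD b1 (le_trans (ler_normD _ _) (lerD b2 b3))) _.
lra.
Qed.

End strict_differentiability.

(** * The flow of the differential equation *)

(** Compactness of [[a, b]] for constants: concatenation keeps the larger of two constants, which is
    why [Q] must be monotone in it. *)
Lemma interval_uniform (R : realType) (Q : R -> R -> Prop) (a b : R) : a <= b ->
  (forall t c c', 0 < c -> c <= c' -> Q t c -> Q t c') ->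
  (forall t, a <= t <= b -> exists2 d, 0 < d & exists2 c, 0 < c &
     forall r, a <= r <= b -> `|r - t| < d -> Q r c) ->
  exists2 c, 0 < c & forall r, a <= r <= b -> Q r c.
Proof.
move=> ab Qmono Qloc.
apply: (@interval_concatenation _
  (fun x y => exists2 c, 0 < c & forall r, x <= r <= y -> Q r c)) => //.
  move=> x y z _ _ _ _ [c c0 cQ] [c' c'0 cQ']; exists (Num.max c c').
    by rewrite lt_max c0.
  move=> r /andP[xr rz]; have [ry|yr] := leP r y.
    by apply: (Qmono _ c) => //; [rewrite le_max lexx|apply: cQ; rewrite xr].
  by apply: (Qmono _ c') => //; [rewrite le_max lexx orbT|apply: cQ'; rewrite ltW].
move=> t tab; have [d d0 [c c0 cQ]] := Qloc t tab; exists d => // x y ax xt ty yb xd yd.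
exists c => // r /andP[xr ry]; apply: cQ; first by rewrite (le_trans ax xr) (le_trans ry).
by rewrite ltr_distl; apply/andP; split; lra.
Qed.

Lemma sub_within_continuous (R : realType) (Z : topologicalType) (a b c e : R)
    (y : R -> Z) : a <= b -> c <= e ->
  {within `[a, e], continuous y} -> {within `[b, c], continuous y}.
Proof.
move=> ab ce; apply: continuous_subspaceW => r /=; rewrite !in_itv /=.
by move=> /andP[br rc]; rewrite (le_trans ab br) (le_trans rc ce).
Qed.

(** * The vector field near a curve *)

Section vector_field.
Context (R : realType) (V : completeNormedModType R) (T : R) (f : R -> V -> V).
Hypothesis f_C01 : C01 `[0, T] f.
Notation mu := (@lebesgue_measure R).
Notation bint a b g := (bochner_integral mu `[a, b] g).

Lemma curve_continuous (a b : R) (y : R -> V) : 0 <= a -> b <= T ->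
  {within `[a, b], continuous y} ->
  {within `[a, b], continuous (fun r => f r (y r))}.
Proof.
move=> a0 bT /subspace_continuousP cy; apply/subspace_continuousP => t tab.
have [/subspace_continuousP cf _ _] := f_C01.
have sub r : `[a, b]%classic r -> `[0, T]%classic r.
  by rewrite /= !in_itv /= => /andP[/(le_trans a0) -> /le_trans]; apply.
apply: (cvg_comp (fun r => (r, y r)) (fun p : R * V => f p.1 p.2)
  (G := within (`[0, T]%classic `*` setT) (nbhs (t, y t)))); last first.
  by apply: cf; split => //; exact: sub.
move=> U; rewrite /within /= => /nbhs_ballP [e /= e0 eU].
have H1 : \forall r \near t, `[a, b]%classic r -> ball (y t) e (y r) :=
  cy t tab _ (nbhsx_ballx _ _ e0).
have H2 : \forall r \near t, ball t e r by exact: nbhsx_ballx.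
suff : \forall r \near t, `[a, b]%classic r -> U (r, y r) by [].
near=> r => rab.
apply: eU; last by split => //; exact: sub.
split; first by near: r.
by move: rab => /=; near: r.
Unshelve. all: by end_near. Qed.

Lemma curve_integrable (a b : R) (y : R -> V) : 0 <= a -> b <= T ->
  {within `[a, b], continuous y} ->
  bochner_integrable mu `[a, b] (fun r => f r (y r)).
Proof.
by move=> a0 bT cy; apply: bochner_integrable_itv_continuous; exact: curve_continuous.
Qed.

Lemma f_near (t : R) (x : V) (e : R) : 0 <= t <= T -> 0 < e ->
  exists2 d : R, 0 < d & forall r y, 0 <= r <= T -> `|r - t| < d ->
    `|y - x| < d -> `|f r y - f t x| < e /\
    forall v, `|'d (f r) y v - 'd (f t) x v| <= e * `|v|.
Proof.
move=> tT e0; have [/subspace_continuousP cf _ Lf] := f_C01.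
have tx : (`[0, T]%classic `*` setT) (t, x) by split => //=; rewrite in_itv.
have {cf} := cf _ tx; move=> /cvgrPdist_lt /(_ _ e0); rewrite near_withinE.
move=> /near_pairP [d1 d10 H1].
have := proj1 (@L_continuous_onP R V V (R * V)%type (`[0, T]%classic `*` setT)
  (fun p => 'd (f p.1) (p.2))) Lf _ tx _ e0.
rewrite near_withinE => /near_pairP [d2 d20 H2].
exists (Num.min d1 d2); first by rewrite lt_min d10.
move=> r y rT; rewrite !lt_min => /andP[r1 r2] /andP[y1 y2].
have ry : (`[0, T]%classic `*` setT) (r, y) by split => //=; rewrite in_itv.
split; first by rewrite distrC; exact: H1.
by move=> v; exact: H2.
Qed.

Hypothesis T0 : 0 < T.

(** The last clause is strict differentiability of [f r] at [xi r] with a radius uniform in [r]. The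
    differentials at [(r, y)] and [(r, xi r)] are both compared with the one at [(t, xi t)] for [r]
    near [t], and the radius is then glued in time. *)
Lemma tube (xi : R -> V) : {within `[0, T], continuous xi} ->
  exists L M : R, [/\ 0 < L, 0 < M,
    (forall r, 0 <= r <= T -> forall v, `|'d (f r) (xi r) v| <= L * `|v|),
    (forall r, 0 <= r <= T -> `|f r (xi r)| <= M) &
    (forall e, 0 < e -> exists2 rho, 0 < rho & forall r, 0 <= r <= T ->
      forall y y', `|y - xi r| <= rho -> `|y' - xi r| <= rho ->
      `|f r y - f r y' - 'd (f r) (xi r) (y - y')| <= e * `|y - y'|)].
Proof.
move=> /within_continuous_itvP cxi.
have near_xi t e : 0 <= t <= T -> 0 < e -> exists2 d : R, 0 < d &
    forall r y, 0 <= r <= T -> `|r - t| < d -> `|y - xi r| <= d ->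
    `|f r y - f t (xi t)| < e /\
    forall v, `|'d (f r) y v - 'd (f t) (xi t) v| <= e * `|v|.
  move=> tT e0; have [d d0 dH] := f_near (xi t) tT e0.
  have d20 : 0 < d / 2 by rewrite divr_gt0.
  have [d1 d10 d1H] := cxi t tT _ d20.
  exists (Num.min d1 (d / 2)); first by rewrite lt_min d10.
  move=> r y rT; rewrite lt_min le_min => /andP[r1 r2] /andP[y1 y2].
  apply: dH => //; first by apply: lt_trans r2 _; lra.
  rewrite -(subrK (xi r) y) -addrA (le_lt_trans (ler_normD _ _)) //.
  have := d1H r rT r1; lra.
have [L L0 HL] : exists2 L : R, 0 < L & forall r, 0 <= r <= T ->
    forall v, `|'d (f r) (xi r) v| <= L * `|v|.
  apply: interval_uniform (ltW T0) _ _.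
    move=> t c c' _ cc' H v; apply: le_trans (H v) _.
    by rewrite ler_wpM2r.
  move=> t tT; have [d d0 dH] := near_xi t 1 tT ltr01.
  have [_ df _] := f_C01.
  have tT' : `[0, T]%classic t by rewrite /= in_itv.
  have [K K0 HK] := continuous_linear_bound (diff_continuous (df _ (xi t) tT')).
  exists d => //; exists (1 + K); first by rewrite addr_gt0.
  move=> r rT rt v.
  have [|_ /(_ v) H] := dH r (xi r) rT rt; first by rewrite subrr normr0 ltW.
  rewrite -(subrK ('d (f t) (xi t) v) ('d (f r) (xi r) v)) mulrDl.
  exact: le_trans (ler_normD _ _) (lerD H (HK v)).
have [M M0 HM] : exists2 M : R, 0 < M & forall r, 0 <= r <= T -> `|f r (xi r)| <= M.
  apply: interval_uniform (ltW T0) _ _.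
    by move=> t c c' _ cc' /le_trans; apply.
  move=> t tT; have [d d0 dH] := near_xi t 1 tT ltr01.
  exists d => //; exists (1 + `|f t (xi t)|); first by rewrite ltr_pwDl.
  move=> r rT rt.
  have [|H _] := dH r (xi r) rT rt; first by rewrite subrr normr0 ltW.
  rewrite -(subrK (f t (xi t)) (f r (xi r))).
  by apply: le_trans (ler_normD _ _) (lerD (ltW H) _).
exists L, M; split => // e e0.
have e20 : 0 < e / 2 by rewrite divr_gt0.
(* The radius is encoded as [c^-1] because [interval_uniform] produces constants that may only be
   enlarged. *)
have [c c0 Hc] : exists2 c : R, 0 < c & forall r, 0 <= r <= T ->
    forall y, `|y - xi r| <= c^-1 ->
    forall v, `|'d (f r) y v - 'd (f r) (xi r) v| <= e * `|v|.
  apply: interval_uniform (ltW T0) _ _.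
    move=> t c c' c0 cc' H y yc; apply: H; apply: le_trans yc _.
    by rewrite lef_pV2 // posrE (lt_le_trans c0).
  move=> t tT; have [d d0 dH] := near_xi t _ tT e20.
  exists d => //; exists d^-1; first by rewrite invr_gt0.
  move=> r rT rt y; rewrite invrK => yd v.
  have [_ /(_ v) H1] := dH r y rT rt yd.
  have [|_ /(_ v) H2] := dH r (xi r) rT rt; first by rewrite subrr normr0 ltW.
  rewrite -(subrK ('d (f t) (xi t) v) ('d (f r) y v)) -addrA.
  rewrite [X in _ + X](_ : _ = - ('d (f r) (xi r) v - 'd (f t) (xi t) v)); last first.
    by rewrite opprB.
  apply: le_trans (ler_normB _ _) _; apply: le_trans (lerD H1 H2) _; lra.
exists c^-1; first by rewrite invr_gt0.
move=> r rT y y' yc yc'; have [_ df _] := f_C01.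
apply: mean_value_ball yc yc'.
  by move=> z _; apply: df; rewrite /= in_itv.
by move=> z zc v; exact: Hc.
Qed.

End vector_field.

Lemma mul_double_half (F : realFieldType) (x y z : F) : 2 * x * y * z / 2 = x * (y * z).
Proof. by field. Qed.

Lemma mul_double_cube (F : realFieldType) (x y z : F) : z != 0 ->
  2 * (x / (2 * z * z * z)) * z * y * z * z = x * y.
Proof. by move=> z0; field. Qed.

Lemma subr_insert (U : zmodType) (x y a b : U) :
  x - y = (a - b) + ((x - a) - (y - b)).
Proof. by rewrite [(x - a) - _]subrACA [RHS]addrC subrK. Qed.

Lemma subr_telescope (U : zmodType) (z w x i p q : U) :
  z - w = (z - x - i) + ((x - q) - ((p - q) + (w - p - i))).
Proof.
have -> : p - q + (w - p - i) = w - q - i.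
  by rewrite addrA [_ + (w - p)]addrC addrA subrK.
have -> : x - q - (w - q - i) = x - w + i.
  by rewrite opprB [i - _]addrC addrA opprB addrA subrK.
by rewrite [x - w + i]addrC addrA subrK addrA subrK.
Qed.

Section flow.
Context (R : realType) (V : completeNormedModType R) (T : R) (f : R -> V -> V).
Hypothesis f_C01 : C01 `[0, T] f.
Hypothesis T0 : 0 < T.
Notation mu := (@lebesgue_measure R).
Notation bint a b g := (bochner_integral mu `[a, b] g).
Context (X : R -> R -> V -> V).
Hypothesis X_cont : forall x s, 0 <= s <= T ->
  {within `[s, T], continuous (fun t => X s t x)}.
Hypothesis X_eq : forall x s, 0 <= s <= T -> forall t, s <= t <= T ->
  X s t x = x + bint s t (fun r => f r (X s r x)).

Lemma flow_integrable s a b x : 0 <= s <= T -> s <= a -> b <= T ->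
  bochner_integrable mu `[a, b] (fun r => f r (X s r x)).
Proof.
move=> sT sa bT; apply: (bochner_integrable_sub_itv sa bT).
apply: (curve_integrable f_C01 (y := fun r => X s r x)) => //; first by case/andP: sT.
exact: X_cont.
Qed.

Lemma flow_id s x : 0 <= s <= T -> X s s x = x.
Proof.
move=> sT; have /andP[s0 sT'] := sT.
rewrite X_eq // ?lexx // bochner_integral_itv0 ?addr0 //.
exact: flow_integrable.
Qed.

Lemma flow_increment s a b x : 0 <= s <= T -> s <= a -> a <= b -> b <= T ->
  X s b x - X s a x = bint a b (fun r => f r (X s r x)).
Proof.
move=> sT sa ab bT; have sb := le_trans sa ab.
rewrite (X_eq _ sT (t := b)) ?sb // (X_eq _ sT (t := a)) ?sa ?(le_trans ab) //.
rewrite (@bochner_integral_itv_split _ _ s a b) ?sa //; last exact: flow_integrable.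
by rewrite opprD addrACA subrr add0r addrC addKr.
Qed.

(** [z] may be any curve whose deviation from [xi] obeys the integral inequality with total defect
    [c]; this covers comparison with a frozen trajectory. The smallness of [c] keeps [z] in the tube
    where [f] is Lipschitz, by the continuation form of [gronwall]. *)
Lemma stability (xi z : R -> V) (u c L rho : R) : 0 <= u <= T ->
  {within `[u, T], continuous xi} -> {within `[u, T], continuous z} -> 0 <= L ->
  (forall r, u <= r <= T -> forall y, `|y - xi r| <= rho ->
    `|f r y - f r (xi r)| <= L * `|y - xi r|) ->
  0 <= c -> c * expR (L * (T - u)) < rho -> `|z u - xi u| <= c ->
  (forall t, u <= t <= T -> `|z t - xi t| <=
    c + `|bint u t (fun r => f r (z r) - f r (xi r))|) ->
  forall t, u <= t <= T -> `|z t - xi t| <= c * expR (L * (t - u)).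
Proof.
move=> /andP[u0 uT] cxi cz L0 fL c0 crho zu zint.
apply: (gronwall (rho := rho)) => //.
  move=> x; apply: cvg_norm; apply: cvgB; [exact: cz|exact: cxi].
move=> t B /andP[ut tT] B0 zrho zB; apply: le_trans (zint t _) _; first by rewrite ut.
rewrite lerD2l; apply: le_norm_bochner_integral_expR => //.
  have sub (y : R -> V) : {within `[u, T], continuous y} ->
      bochner_integrable mu `[u, t] (fun r => f r (y r)).
    move=> cy; apply: (curve_integrable f_C01 (y := y)) => //.
    exact: sub_within_continuous cy.
  by apply: bochner_integrableB; [exact: measurable_itv|exact: sub|exact: sub].
move=> r /andP[ur rt]; apply: le_trans (fL r _ _ _) _.
- by rewrite ur (le_trans rt).
- by apply: zrho; rewrite ur.
- by rewrite mulrCA ler_wpM2l // zB // ur.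
Qed.

Lemma bochner_integral_difference a b (g h : R -> V) : 0 <= a -> b <= T ->
  {within `[a, b], continuous g} -> {within `[a, b], continuous h} ->
  bint a b (fun r => f r (g r) - f r (h r)) =
  bint a b (fun r => f r (g r)) - bint a b (fun r => f r (h r)).
Proof.
move=> a0 bT cg ch; rewrite -bochner_integralB //.
- exact: lebesgue_measure_itvcc_fin.
- exact: (curve_integrable f_C01 (y := g)).
- exact: (curve_integrable f_C01 (y := h)).
Qed.

Lemma flow_sub_cont s a b x : 0 <= s <= T -> s <= a -> b <= T ->
  {within `[a, b], continuous (fun r => X s r x)}.
Proof. by move=> sT sa bT; exact: (sub_within_continuous (y := fun r => X s r x) sa bT (X_cont sT)). Qed.

Section base_curve.
Context (s0 : R) (x0 : V).
Hypothesis s0T : 0 <= s0 <= T.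

(* The trajectory through [(s0, x0)], frozen before time [s0] so that it can be
   compared with trajectories started slightly earlier. *)
Let xi r := X s0 (Num.max r s0) x0.

Let xiE r : s0 <= r -> xi r = X s0 r x0.
Proof. by rewrite /xi => /max_l ->. Qed.

Let xi0 r : r <= s0 -> xi r = x0.
Proof. by rewrite /xi => /max_r ->; rewrite flow_id. Qed.

Let xi_cont : {within `[0, T], continuous xi}.
Proof.
apply/within_continuous_itvP => t /andP[t0 tT] e e0.
have /andP[s00 s0T'] := s0T.
have /within_continuous_itvP cX := X_cont (x := x0) s0T.
have [|d d0 dH] := cX (Num.max t s0) _ _ e0.
  by rewrite le_max lexx orbT ge_max tT.
exists d => // r /andP[r0 rT] rt; apply: dH.
  by rewrite le_max lexx orbT ge_max rT.
apply: le_lt_trans rt; case: (leP r s0) => rs; case: (leP t s0) => ts //.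
- by rewrite subrr normr0.
- rewrite distrC [leRHS]distrC !gtr0_norm ?subr_gt0 //; first lra.
  exact: le_lt_trans ts.
- rewrite !gtr0_norm ?subr_gt0 //; first lra.
  exact: le_lt_trans rs.
Qed.

Let xi_sub_cont u t : 0 <= u -> t <= T -> {within `[u, t], continuous xi}.
Proof. by move=> u0 tT; exact: sub_within_continuous xi_cont. Qed.

Let xi_int u t : 0 <= u -> t <= T ->
  bochner_integrable mu `[u, t] (fun r => f r (xi r)).
Proof. by move=> u0 tT; apply: (curve_integrable f_C01 (y := xi)) => //; exact: xi_sub_cont. Qed.

Let xi_near_solution (M : R) u t : 0 <= M ->
  (forall r, 0 <= r <= T -> `|f r (xi r)| <= M) -> 0 <= u -> u <= t -> t <= T ->
  `|xi t - xi u - bint u t (fun r => f r (xi r))| <= M * `|u - s0|.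
Proof.
move=> M0 fM u0 ut tT; have /andP[s00 s0T'] := s0T.
have bnd a b : 0 <= a -> a <= b -> b <= T ->
    `|bint a b (fun r => f r (xi r))| <= M * (b - a).
  move=> a0 ab bT; apply: le_norm_bochner_integral_itv => //; first exact: xi_int.
  by move=> r /andP[ar rb]; apply: fM; rewrite (le_trans a0 ar) (le_trans rb bT).
have after a b : s0 <= a -> a <= b -> b <= T ->
    xi b - xi a = bint a b (fun r => f r (xi r)).
  move=> sa ab bT; rewrite (xiE sa) (xiE (le_trans sa ab)) (flow_increment x0 s0T sa ab bT).
  apply: eq_bochner_integral; [exact: measurable_itv|exact: lebesgue_measure_itvcc_fin| |exact: flow_integrable].
  by move=> r /=; rewrite in_itv /= => /andP[ar _]; rewrite xiE // (le_trans sa).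
have [us|su] := leP u s0; last first.
  by rewrite after ?(ltW su) // subrr normr0 mulr_ge0.
have [ts|st] := leP t s0.
  rewrite (xi0 us) (xi0 ts) subrr sub0r normrN; apply: le_trans (bnd _ _ u0 ut tT) _.
  rewrite distrC ger0_norm ?subr_ge0 //; apply: ler_wpM2l => //.
  by rewrite lerD2r.
rewrite (@bochner_integral_itv_split _ _ u s0 t) ?us ?(ltW st) //; last exact: xi_int.
rewrite -(after s0 t) ?lexx ?(ltW st) // (xi0 us) (xi0 (lexx s0)).
rewrite opprD addrCA subrr addr0 normrN.
apply: le_trans (bnd _ _ u0 us s0T') _.
by rewrite distrC ger0_norm ?subr_ge0.
Qed.

Let xi_near_start (M : R) u : 0 <= M ->
  (forall r, 0 <= r <= T -> `|f r (xi r)| <= M) -> 0 <= u -> u <= T ->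
  `|xi u - x0| <= M * `|u - s0|.
Proof.
move=> M0 fM u0 uT; have /andP[s00 s0T'] := s0T.
have [us|su] := leP u s0; first by rewrite xi0 // subrr normr0 mulr_ge0.
have := xi_near_solution M0 fM s00 (ltW su) uT.
rewrite subrr normr0 mulr0 normr_le0 subr_eq0 => /eqP.
rewrite (xi0 (lexx s0)) => ->; rewrite ger0_norm ?subr_ge0 ?(ltW su) //.
apply: le_norm_bochner_integral_itv; [exact: ltW|exact: xi_int|].
by move=> r /andP[sr ru]; apply: fM; rewrite (le_trans s00) // (le_trans ru).
Qed.

(** All three estimates hold up to the final time [T] on one neighbourhood of initial data, which is
    where continuation enters. They supply continuity in the times, continuity in the initial value,
    and the almost proportionality from which the derivative is built. *)
Lemma flow_local : exists C M : R, [/\ 0 < C, 0 < M &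
  exists2 d : R, 0 < d &
    [/\ (forall s x t t', 0 <= s <= T -> `|s - s0| < d -> `|x - x0| < d ->
          s <= t -> t <= t' -> t' <= T -> `|X s t' x - X s t x| <= M * (t' - t)),
        (forall s x y t, 0 <= s <= T -> `|s - s0| < d -> `|x - x0| < d ->
          `|y - x0| < d -> s <= t <= T -> `|X s t x - X s t y| <= C * `|x - y|) &
        (forall e, 0 < e -> exists2 d' : R, 0 < d' &
          forall s y z y' z' k t, 0 <= s <= T -> `|s - s0| < d' ->
            `|y - x0| < d' -> `|z - x0| < d' -> `|y' - x0| < d' ->
            `|z' - x0| < d' -> s <= t <= T -> y - z = k *: (y' - z') ->
          `|X s t y - X s t z - k *: (X s t y' - X s t z')| <= e * `|y - z|)]].
Proof.
have [L [M [L0 M0 HL HM Hrho]]] := tube f_C01 T0 xi_cont.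
have Lip e rho : 0 <= e -> (forall r, 0 <= r <= T ->
      forall y y', `|y - xi r| <= rho -> `|y' - xi r| <= rho ->
      `|f r y - f r y' - 'd (f r) (xi r) (y - y')| <= e * `|y - y'|) ->
    forall r, 0 <= r <= T ->
      forall y y', `|y - xi r| <= rho -> `|y' - xi r| <= rho ->
      `|f r y - f r y'| <= (L + e) * `|y - y'|.
  move=> e0 H r rT y y' yr y'r.
  rewrite -(subrK ('d (f r) (xi r) (y - y')) (f r y - f r y')) addrC mulrDl.
  by apply: le_trans (ler_normD _ _) (lerD (HL _ rT _) (H r rT y y' yr y'r)).
have [rho1 rho10 H1] := Hrho 1 ltr01.
have Lip1 := Lip 1 rho1 ler01 H1.
(* Lipschitz constant of [f] on the tube of radius [rho1]: [L] from the differential, 1 from the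
   linearization error. That it is at least 1 is used at the end. *)
pose L1 := L + 1; have L10 : 0 < L1 by rewrite addr_gt0.
pose EL := expR (L1 * T); have EL0 : 0 < EL := expR_gt0 _.
have expE a b : 0 <= a -> b <= T -> expR (L1 * (b - a)) <= EL.
  move=> a0 bT; rewrite ler_expR ler_wpM2l ?(ltW L10) //.
  by rewrite (le_trans _ bT) // gerBl.
have stay rho : 0 < rho -> rho <= rho1 -> exists2 d : R, 0 < d &
    forall s x, 0 <= s <= T -> `|s - s0| < d -> `|x - x0| < d ->
    forall t, s <= t <= T -> `|X s t x - xi t| <= rho.
  (* [(1 + 2 * M) * d] bounds the total defect against [xi]: [d] for [x - x0], [M * d] for
     [xi s - x0], and [M * d] because [xi] is only a near solution. Amplified by [EL] it becomes
     [rho / 2]. *)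
  move=> rho0 rhorho1; pose d := rho / ((1 + 2 * M) * EL) / 2.
  have Me : 0 < (1 + 2 * M) * EL by rewrite mulr_gt0 // addr_gt0 // mulr_gt0.
  have d0 : 0 < d by rewrite !divr_gt0.
  exists d => // s x sT ss xx t sTt; have /andP[s0' sT'] := sT.
  pose c := (1 + 2 * M) * d.
  have c0 : 0 <= c by rewrite mulr_ge0 ?(ltW d0) // addr_ge0 // mulr_ge0 // ltW.
  have crho : c * EL < rho.
    have -> : c * EL = rho / 2.
      rewrite /c /d; field; rewrite !gt_eqF //.
      by rewrite addr_gt0 // mulr_gt0.
    by lra.
  have Md0 : 0 <= M * d by rewrite mulr_ge0 // ltW.
  have xs : `|xi s - x0| <= M * d.
    apply: le_trans (xi_near_start (ltW M0) HM s0' sT') _.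
    by rewrite ler_wpM2l ?(ltW M0) // ltW.
  apply: (@le_trans _ _ (c * expR (L1 * (t - s)))); last first.
    apply: le_trans (ltW crho); apply: ler_wpM2l => //.
    by apply: expE => //; case/andP: sTt.
  apply: (@stability xi (fun t => X s t x) s c L1 rho1) => //.
  - exact: xi_sub_cont.
  - exact: X_cont.
  - exact: ltW.
  - move=> r /andP[sr rT] y yr; apply: Lip1 => //.
      by rewrite (le_trans s0').
    by rewrite subrr normr0 ltW.
  - apply: lt_le_trans rhorho1; apply: le_lt_trans crho; apply: ler_wpM2l => //.
    exact: expE.
  - rewrite flow_id // -(subrK x0 x) -addrA (le_trans (ler_normD _ _)) //.
    rewrite [`|x0 - _|]distrC; rewrite /c; have := ltW xx; move: xs Md0; lra.
  - move=> t' /andP[st' t'T].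
    rewrite bochner_integral_difference //; [|exact: flow_sub_cont|exact: xi_sub_cont].
    rewrite -flow_increment // flow_id //.
    set I := bint _ _ _.
    have ns : `|xi t' - xi s - I| <= M * d.
      apply: le_trans (xi_near_solution (ltW M0) HM s0' st' t'T) _.
      by rewrite ler_wpM2l ?(ltW M0) // ltW.
    have -> : X s t' x - xi t' = (X s t' x - x - I) +
        ((x - x0) - ((xi s - x0) + (xi t' - xi s - I))).
      exact: subr_telescope.
    rewrite addrC; apply: le_trans (ler_normD _ _) _; rewrite lerD2r.
    apply: le_trans (ler_normB _ _) _.
    have := ler_normD (xi s - x0) (xi t' - xi s - I).
    rewrite /c; have := ltW xx; move: xs ns; lra.
have [d1 d10 stay1] := stay rho1 rho10 (lexx _).
(* One trajectory stays within [rho1 / 4] of [xi] and the other may deviate from it by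
   [rho1 * 3 / 4], so both remain in the tube of radius [rho1]. *)
have rho20 : 0 < rho1 / 4 by rewrite divr_gt0.
have [d2 d20 stay2] := stay (rho1 / 4) rho20 ltac:(lra).
pose M1 := M + L1 * rho1.
have M10 : 0 < M1 by rewrite addr_gt0 // mulr_gt0.
exists EL, M1; split => //.
(* Two initial values this close to [x0] differ by at most [rho1 / 2 / EL], which Gronwall's factor
   turns into [rho1 / 2], below the permitted [rho1 * 3 / 4]. *)
have d30 : 0 < rho1 / 2 / EL / 2 by rewrite !divr_gt0.
pose d := Num.min d1 (Num.min d2 (rho1 / 2 / EL / 2)).
have d0 : 0 < d by rewrite !lt_min d10 d20.
have lipX s x y t : 0 <= s <= T -> `|s - s0| < d -> `|x - x0| < d ->
    `|y - x0| < d -> s <= t <= T -> `|X s t x - X s t y| <= EL * `|x - y|.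
  move=> sT; rewrite !lt_min => /andP[_ /andP[s2 _]] /andP[_ /andP[x2 x3]].
  move=> /andP[_ /andP[y2 y3]] sTt; have /andP[s0' sT'] := sT.
  have xy : `|x - y| <= rho1 / 2 / EL / 2 + rho1 / 2 / EL / 2.
    rewrite -(subrK x0 x) -addrA; apply: le_trans (ler_normD _ _) _.
    by rewrite [`|x0 - y|]distrC lerD // ltW.
  apply: (@le_trans _ _ (`|x - y| * expR (L1 * (t - s)))); last first.
    rewrite mulrC; apply: ler_wpM2r => //; apply: expE => //.
    by case/andP: sTt.
  apply: (@stability (fun t => X s t y) (fun t => X s t x) s `|x - y| L1 (rho1 * 3 / 4)) => //.
  - exact: X_cont.
  - exact: X_cont.
  - exact: ltW.
  - move=> r /andP[sr rT] y' yr; apply: Lip1.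
    + by rewrite (le_trans s0').
    + rewrite -(subrK (X s r y) y') -addrA; apply: le_trans (ler_normD _ _) _.
      have := stay2 s y sT s2 y2 r; rewrite sr rT => /(_ isT); move: yr; lra.
    + by apply: le_trans (stay2 s y sT s2 y2 r _) _; [rewrite sr|lra].
  - apply: (@le_lt_trans _ _ (rho1 / 2)); last lra.
    apply: (@le_trans _ _ (`|x - y| * EL)).
      by apply: ler_wpM2l => //; exact: expE.
    by rewrite -ler_pdivlMr //; apply: le_trans xy _; rewrite -splitr.
  - by rewrite !flow_id.
  - move=> t' /andP[st' t'T].
    rewrite bochner_integral_difference //; [|exact: flow_sub_cont|exact: flow_sub_cont].
    rewrite -!flow_increment // !flow_id // subrACA.
    rewrite -{1}(subrK (x - y) (X s t' x - X s t' y)) addrC.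
    exact: ler_normD.
exists d => //; split => //.
  move=> s x t t' sT; rewrite !lt_min => /andP[s1 _] /andP[x1 _] st tt' t'T.
  have /andP[s0' sT'] := sT.
  rewrite flow_increment //; apply: le_norm_bochner_integral_itv => //.
    exact: flow_integrable.
  move=> r /andP[tr rt']; have rT : 0 <= r <= T.
    by rewrite (le_trans s0' (le_trans st tr)) (le_trans rt').
  have sr := stay1 s x sT s1 x1 r.
  rewrite (le_trans st tr) (le_trans rt' t'T) in sr.
  rewrite -(subrK (f r (xi r)) (f r (X s r x))) addrC.
  apply: le_trans (ler_normD _ _) (lerD (HM r rT) _).
  apply: le_trans (Lip1 r rT _ _ (sr isT) _) _.
    by rewrite subrr normr0 ltW.
  by rewrite ler_wpM2l ?(ltW L10) // sr.
(* The three factors [EL] come from the Lipschitz bound of the flow, the integration of the forcing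
   [kappa], and Gronwall's exponential; the 2 from two linearization errors. *)
move=> e e0; pose e' := e / (2 * EL * EL * EL).
have e'0 : 0 < e' by rewrite divr_gt0 // !mulr_gt0.
have [rhoe rhoe0 He] := Hrho e' e'0.
have rhom : 0 < Num.min rho1 rhoe by rewrite lt_min rho10.
have [d3 d30' stay3] := stay _ rhom ltac:(by rewrite ge_min lexx).
clearbody d; exists (Num.min d d3); first by rewrite lt_min d0.
move=> s y z y' z' k t sT; rewrite !lt_min => /andP[s1 s3] /andP[y1 y3].
move=> /andP[z1 z3] /andP[y'1 y'3] /andP[z'1 z'3] sTt yzk; have /andP[s0' sT'] := sT.
(* [W] vanishes at [s] exactly because the increments are proportional, and linearizing [f] along
   [xi] gives it the inequality of a linear equation with forcing [kappa]. *)
pose W r := X s r y - X s r z - k *: (X s r y' - X s r z').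
pose kappa := 2 * e' * EL * `|y - z|.
have kappa0 : 0 <= kappa by rewrite mulr_ge0 // mulr_ge0 ?(ltW EL0) // mulr_ge0 ?(ltW e'0).
have cd u v : {within `[s, T], continuous (fun r => X s r u - X s r v)}.
  by move=> r; apply: cvgB; exact: X_cont.
have cW : {within `[s, T], continuous W}.
  by move=> r; apply: cvgB; [exact: cd|apply: cvgZr; exact: cd].
pose D u v r := f r (X s r u) - f r (X s r v).
have Dint u v a b : s <= a -> b <= T -> bochner_integrable mu `[a, b] (D u v).
  move=> sa bT; apply: bochner_integrableB; [exact: measurable_itv|exact: flow_integrable|exact: flow_integrable].
have kb (v : V) : `|k *: v| <= `|k| * `|v| by rewrite normrZ.
have Wint r : s <= r <= T -> W r = bint s r (fun r => D y z r - k *: D y' z' r).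
  move=> /andP[sr rT].
  have kint : bochner_integrable mu `[s, r] (fun q => k *: D y' z' q).
    apply: (bochner_integrable_linear (L := *:%R k) _ kb); first exact: measurable_itv.
    exact: Dint.
  rewrite bochner_integralB //; [|exact: lebesgue_measure_itvcc_fin|exact: Dint].
  rewrite [X in _ - X](_ : _ = k *: bint s r (D y' z')); last first.
    apply: (bochner_integral_linear (L := *:%R k) _ _ kb); [exact: measurable_itv| |exact: Dint].
    exact: lebesgue_measure_itvcc_fin.
  rewrite !bochner_integral_difference //; try exact: flow_sub_cont.
  rewrite -!flow_increment // !flow_id // (subrACA _ y) (subrACA _ y').
  by rewrite scalerBr -yzk [RHS]subrACA subrr subr0.
have WB r : s <= r <= T -> `|D y z r - k *: D y' z' r| <= L1 * `|W r| + kappa.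
  move=> /andP[sr rT]; have r0T : 0 <= r <= T by rewrite (le_trans s0').
  have sre : s <= r <= T by rewrite sr.
  have inE u : `|u - x0| < d3 -> `|X s r u - xi r| <= rhoe.
    by move=> ud; apply: le_trans (stay3 s u sT s3 ud r sre) _; rewrite ge_min lexx orbT.
  pose A := 'd (f r) (xi r).
  have E1 : `|D y z r - A (X s r y - X s r z)| <= kappa / 2.
    apply: le_trans (He r r0T _ _ (inE _ y3) (inE _ z3)) _.
    apply: le_trans (ler_wpM2l (ltW e'0) (lipX s y z r sT s1 y1 z1 sre)) _.
    by rewrite /kappa mul_double_half.
  have E2 : `|k *: (D y' z' r - A (X s r y' - X s r z'))| <= kappa / 2.
    rewrite normrZ.
    apply: le_trans (ler_wpM2l (normr_ge0 k) (He r r0T _ _ (inE _ y'3) (inE _ z'3))) _.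
    rewrite mulrCA.
    have := ler_wpM2l (normr_ge0 k) (lipX s y' z' r sT s1 y'1 z'1 sre).
    rewrite [X in _ <= X]mulrCA (_ : `|k| * `|y' - z'| = `|y - z|) => [H|]; last by rewrite yzk normrZ.
    apply: le_trans (ler_wpM2l (ltW e'0) H) _.
    by rewrite /kappa mul_double_half.
  have -> : D y z r - k *: D y' z' r = A (W r) +
      ((D y z r - A (X s r y - X s r z)) - k *: (D y' z' r - A (X s r y' - X s r z'))).
    rewrite /W (linearB A) [A (k *: _)]linearZZ [k *: (D _ _ _ - _)]scalerBr.
    exact: subr_insert.
  apply: le_trans (ler_normD _ _) _; apply: lerD.
    apply: le_trans (HL r r0T _) _; apply: ler_wpM2r => //.
    by rewrite /L1 lerDl.
  apply: le_trans (ler_normB _ _) _; by apply: le_trans (lerD E1 E2) _; rewrite -splitr.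
suff : `|W t| <= kappa * EL * expR (L1 * (t - s)).
  move=> /le_trans; apply.
  apply: (@le_trans _ _ (kappa * EL * EL)).
    apply: ler_wpM2l; first by rewrite mulr_ge0 // ltW.
    by apply: expE => //; case/andP: sTt.
  by rewrite /kappa /e' mul_double_cube // gt_eqF.
(* The bound [WB] holds whatever the size of [W], so any [rho] above the expected bound serves. *)
apply: (@gronwall _ (fun r => `|W r|) s T (kappa * EL) L1 (kappa * EL * expR (L1 * (T - s)) + 1)) => //.
- by move=> r; apply: cvg_norm; exact: cW.
- by rewrite mulr_ge0 // ltW.
- by rewrite ltrDl.
- exact: ltW.
- by rewrite /W !flow_id // yzk subrr normr0 mulr_ge0 // ltW.
move=> r B /andP[sr rT] B0 _ BW; rewrite Wint ?sr //.
(* As [L1] and the exponential are at least 1, [kappa] is at most its product with both; one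
   exponential integral then covers the two terms. *)
apply: (@le_trans _ _ ((B + kappa) * (expR (L1 * (r - s)) - 1))).
  apply: le_norm_bochner_integral_expR => //.
    apply: bochner_integrableB; [exact: measurable_itv|exact: Dint|].
    apply: (bochner_integrable_linear (L := *:%R k) _ kb); first exact: measurable_itv.
    exact: Dint.
  move=> q /andP[sq qr]; apply: le_trans (WB q _) _; first by rewrite sq (le_trans qr).
  have := BW q; rewrite sq qr => /(_ isT) Bq.
  have E1 : 1 <= expR (L1 * (q - s)).
    by rewrite -expR0 ler_expR mulr_ge0 ?subr_ge0 // ltW.
  have L11 : 1 <= L1 by rewrite /L1 lerDr ltW.
  rewrite [leRHS]mulrDl lerD //.
    by rewrite mulrCA ler_wpM2l // ltW.
  by rewrite ler_peMr // -[1]mulr1 ler_pM.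
rewrite [leLHS]mulrDl addrC lerD2r; apply: ler_wpM2l => //.
by rewrite lerBlDr (le_trans (expE _ _ s0' rT)) // lerDl.

Qed.

(** Stability with defect 0: the smallness condition becomes [0 < rho], so no a priori bound on the
    distance from [z] to the trajectory enters. *)
Lemma flow_unique (z : R -> V) : {within `[s0, T], continuous z} ->
  (forall t, s0 <= t <= T -> z t = x0 + bint s0 t (fun r => f r (z r))) ->
  forall t, s0 <= t <= T -> z t = X s0 t x0.
Proof.
move=> cz zE t st; have /andP[s00 s0T'] := s0T.
have [L [M [L0 M0 HL HM Hrho]]] := tube f_C01 T0 xi_cont.
have [rho rho0 H1] := Hrho 1 ltr01.
have zs0 : z s0 = x0.
  rewrite zE ?lexx // bochner_integral_itv0 ?addr0 //.
  apply: (curve_integrable f_C01 (y := z)) => //.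
  exact: sub_within_continuous cz.
have /andP[st1 tT] := st; rewrite -xiE //.
apply/eqP; rewrite -subr_eq0 -normr_le0 -(mul0r (expR ((L + 1) * (t - s0)))).
apply: (@stability xi z s0 0 (L + 1) rho) => //.
- exact: xi_sub_cont.
- by rewrite addr_ge0 // ltW.
- move=> r /andP[sr rT] y yr; have r0T : 0 <= r <= T by rewrite (le_trans s00).
  rewrite -(subrK ('d (f r) (xi r) (y - xi r)) (f r y - f r (xi r))) addrC mulrDl.
  apply: le_trans (ler_normD _ _) (lerD (HL _ r0T _) (H1 r r0T y (xi r) yr _)).
  by rewrite subrr normr0 ltW.
- by rewrite mul0r.
- by rewrite zs0 xi0 // subrr normr0.
- move=> r /andP[sr rT]; rewrite add0r bochner_integral_difference //; last 2 first.
  + exact: sub_within_continuous cz.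
  + exact: xi_sub_cont.
  rewrite zE ?sr // xiE // X_eq ?sr // opprD addrACA subrr add0r.
  rewrite le_eqVlt; apply/orP; left; apply/eqP; congr (`|_ - _|).
  apply: eq_bochner_integral; [exact: measurable_itv|exact: lebesgue_measure_itvcc_fin| |exact: flow_integrable].
  by move=> q /=; rewrite in_itv /= => /andP[sq _]; rewrite xiE.
Qed.

End base_curve.

Lemma flow_semigroup s u t x : 0 <= s -> s <= u -> u <= t -> t <= T ->
  X u t (X s u x) = X s t x.
Proof.
move=> s0 su ut tT; have uT := le_trans ut tT.
have sT : 0 <= s <= T by rewrite s0 (le_trans su).
have uT' : 0 <= u <= T by rewrite (le_trans s0 su).
apply/esym; apply: (flow_unique uT' (z := fun r => X s r x)).
- exact: flow_sub_cont.
- move=> r /andP[ur rT]; apply/esym; rewrite -flow_increment //.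
  by rewrite addrC subrK.
- by rewrite ut.
Qed.

(** Continuity in the times, uniform over a ball of initial values whose radius does not depend on
    [e]: this is the closeness of [g p] to [g p0] demanded by [strict_partial_derivative]. *)
Lemma flow_equicontinuous s0 t0 x0 : 0 <= s0 -> s0 <= t0 -> t0 <= T ->
  exists2 d0 : R, 0 < d0 & forall e, 0 < e -> exists2 d : R, 0 < d &
    forall s t, 0 <= s -> s <= t -> t <= T -> `|s - s0| < d -> `|t - t0| < d ->
    forall x, `|x - x0| < d0 -> `|X s t x - X s0 t0 x| <= e.
Proof.
move=> s00 s0t0 t0T; have s0T : 0 <= s0 <= T by rewrite s00 (le_trans s0t0).
have [C [M [C0 M0 [d d0 [Ht Hx _]]]]] := flow_local x0 s0T.
(* The other half is kept in reserve: moving from one starting time to the other shifts [x] by at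
   most [M * |s - s0|], made less than [d / 2]. *)
exists (d / 2); first by rewrite divr_gt0.
move=> e e0; pose B := M + C * M + M.
have B0 : 0 < B by rewrite !addr_gt0 // mulr_gt0.
have eB : 0 < e / B by rewrite divr_gt0.
have dM : 0 < d / 2 / M by rewrite !divr_gt0.
exists (Num.min d (Num.min (e / B) (d / 2 / M))); first by rewrite !lt_min d0 eB.
move=> s t s_0 st tT; rewrite !lt_min => /andP[s1 /andP[s2 s3]] /andP[t1 /andP[t2 t3]].
move=> x xd; have sT : 0 <= s <= T by rewrite s_0 (le_trans st).
have xd' : `|x - x0| < d by apply: lt_trans xd _; lra.
have s00' : `|s0 - s0| < d by rewrite subrr normr0.
(* [t] may precede [s0], where [X s0 t] carries no information; the two flows are compared at a time
   after both starts. *)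
pose t' := Num.max t t0.
have tt' : t <= t' by rewrite le_max lexx.
have t0t' : t0 <= t' by rewrite le_max lexx orbT.
have t'T : t' <= T by rewrite ge_max tT.
have t'd : t' - t <= e / B /\ t' - t0 <= e / B.
  rewrite /t'; case: (leP t t0) => tt0.
    rewrite subrr; split; last exact: ltW.
    by apply: le_trans (ltW t2); rewrite distrC ger0_norm ?subr_ge0.
  rewrite subrr; split; first exact: ltW.
  by apply: le_trans (ltW t2); rewrite ger0_norm ?subr_ge0 // ltW.
have E1 : `|X s t' x - X s t x| <= M * (e / B).
  apply: le_trans (Ht s x t t' sT s1 xd' st tt' t'T) _.
  by rewrite ler_pM2l //; case: t'd.
have E3 : `|X s0 t' x - X s0 t0 x| <= M * (e / B).
  apply: le_trans (Ht s0 x t0 t' s0T s00' xd' s0t0 t0t' t'T) _.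
  by rewrite ler_pM2l //; case: t'd.
have Ms : M * `|s - s0| < d / 2.
  by rewrite mulrC -ltr_pdivlMr.
have near_x z : `|z - x| <= M * `|s - s0| -> `|z - x0| < d.
  move=> zx; rewrite -(subrK x z) -addrA; apply: le_lt_trans (ler_normD _ _) _.
  move: zx Ms xd; lra.
(* The earlier trajectory is restarted at the later starting time; its displacement until then is at
   most [M * |s - s0|], which the Lipschitz bound multiplies by [C]. *)
have E2 : `|X s t' x - X s0 t' x| <= C * M * (e / B).
  apply: (@le_trans _ _ (C * (M * `|s - s0|))); last first.
    by rewrite -mulrA !ler_pM2l // ltW.
  have [ss0|s0s] := leP s s0.
    have s0t' : s0 <= t' <= T by rewrite t'T (le_trans s0t0).
    rewrite -(@flow_semigroup s s0 t' x) //; last by case/andP: s0t'.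
    have zx : `|X s s0 x - x| <= M * `|s - s0|.
      have := Ht s x s s0 sT s1 xd' (lexx _) ss0; rewrite flow_id //.
      by rewrite [`|s - s0|]distrC ger0_norm ?subr_ge0 //; apply; case/andP: s0T.
    apply: le_trans (Hx s0 _ _ t' s0T s00' (near_x _ zx) xd' s0t') _.
    by rewrite ler_pM2l.
  have st' : s <= t' <= T by rewrite t'T (le_trans st).
  rewrite -(@flow_semigroup s0 s t' x) ?(ltW s0s) //; last by case/andP: st'.
  have zx : `|X s0 s x - x| <= M * `|s - s0|.
    have := Ht s0 x s0 s s0T s00' xd' (lexx _) (ltW s0s); rewrite flow_id //.
    by rewrite ger0_norm ?subr_ge0 ?(ltW s0s) //; apply; case/andP: sT.
  rewrite distrC.
  apply: le_trans (Hx s _ _ t' sT s1 (near_x _ zx) xd' st') _.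
  by rewrite ler_pM2l.
rewrite (subr_chain (X s t' x) (X s0 t' x)).
apply: le_trans (ler_normD _ _) _.
rewrite distrC in E1; apply: le_trans (lerD E1 (le_trans (ler_normD _ _) (lerD E2 E3))) _.
have -> : M * (e / B) + (C * M * (e / B) + M * (e / B)) = B * (e / B) by rewrite /B; ring.
by rewrite mulrCA divff ?mulr1 // gt_eqF.
Qed.

End flow.

Lemma subr_regroup (U : zmodType) (a b c d e g : U) :
  a - c - ((d - e) + g) = (a - b - d) + (e + (b - c - g)).
Proof.
have -> : a - c = (a - b) + (b - c) by rewrite addrA subrK.
by rewrite opprD addrACA opprB [RHS]addrA [a - b + (e - d)]addrA [a - b + e - d]addrAC.
Qed.

Lemma bochner_integral_cst (R : realType) (V : completeNormedModType R) (a b : R)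
    (c : V) : a <= b ->
  bochner_integral (@lebesgue_measure R) `[a, b] (fun=> c) = (b - a) *: c.
Proof.
move=> ab; have mD : measurable (`[a, b]%classic : set (measurableTypeR R)) by exact: measurable_itv.
have muD := lebesgue_measure_itvcc_fin a b.
have s1 : simple_on (`[a, b]%classic : set (measurableTypeR R)) (fun=> tt).
  split; first exact: finite_finset.
  by move=> []; rewrite (_ : _ `&` _ = `[a, b]%classic) //; apply/seteqP; split => x // [].
apply: bochner_integralE => //; split.
  exact/countably_based_strongly_measurable/countably_based_cst.
exists (fun _ _ => c); split.
- by move=> n; apply/bochner_simpleP => //; exact: (simple_on_comp (fun=> c) s1).
- rewrite (_ : (fun n => _) = fun=> 0%E); first exact: cvg_cst.
  apply: funext => n; apply: integral0_eq => x _; by rewrite subrr normr0.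
- rewrite (_ : (fun n => _) = fun=> (b - a) *: c); first exact: cvg_cst.
  apply: funext => n; rewrite (bochner_sintegral_comp mD muD (fun=> c) s1).
  rewrite (_ : [set tt | _ in _] = [set tt]); last first.
    apply/seteqP; split => [[]//|[] _]; exists a => //.
    by rewrite /= in_itv /= lexx.
  rewrite fsbig_set1; congr (_ *: _).
  rewrite -[RHS]/(fine (b - a)%:E) -(lebesgue_measure_itvcc ab).
  by congr (fine (lebesgue_measure _)); apply/seteqP; split => x // [].
Qed.

(** * Regularity of the flow in all variables *)

Section flow_regularity.
Context (R : realType) (V : completeNormedModType R) (T : R) (f : R -> V -> V).
Hypothesis f_C01 : C01 `[0, T] f.
Hypothesis T0 : 0 < T.
Notation mu := (@lebesgue_measure R).
Notation bint a b g := (bochner_integral mu `[a, b] g).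
Context (X : R -> R -> V -> V).
Hypothesis X_cont : forall x s, 0 <= s <= T ->
  {within `[s, T], continuous (fun t => X s t x)}.
Hypothesis X_eq : forall x s, 0 <= s <= T -> forall t, s <= t <= T ->
  X s t x = x + bint s t (fun r => f r (X s r x)).

Let A := [set p : R * R | [/\ p.1 \in `[0, T], p.2 \in `[0, T] & p.1 <= p.2]].

Let AE s t : A (s, t) <-> [/\ 0 <= s, s <= t & t <= T].
Proof.
rewrite /A /= !in_itv /=; split => [[/andP[-> _] /andP[_ ->] ->]//|[s0 st tT]].
by rewrite s0 st tT (le_trans s0 st) (le_trans st tT).
Qed.

Let local := flow_local f_C01 T0 X_cont X_eq.
Let equicontinuous := flow_equicontinuous f_C01 T0 X_cont X_eq.
Let semigroup := flow_semigroup f_C01 T0 X_cont X_eq.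
Let increment := flow_increment f_C01 X_cont X_eq.

Lemma flow_continuous s0 t0 x0 : 0 <= s0 -> s0 <= t0 -> t0 <= T ->
  forall e, 0 < e -> exists2 d : R, 0 < d & forall s t x, 0 <= s -> s <= t -> t <= T ->
    `|s - s0| < d -> `|t - t0| < d -> `|x - x0| < d ->
    `|X s t x - X s0 t0 x0| < e.
Proof.
move=> s00 st0 t0T e e0; have s0T : 0 <= s0 <= T by rewrite s00 (le_trans st0).
have [C [M [C0 M0 [d d0 [_ Hx _]]]]] := local x0 s0T.
have [d1 d10 H1] := equicontinuous x0 s00 st0 t0T.
have e2 : 0 < e / 2 by rewrite divr_gt0.
have [d2 d20 H2] := H1 _ e2.
have e2C : 0 < e / 2 / C by rewrite !divr_gt0.
exists (Num.min d (Num.min d1 (Num.min d2 (e / 2 / C)))).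
  by rewrite !lt_min d0 d10 d20.
move=> s t x s_0 st tT; rewrite !lt_min => /andP[_ /andP[_ /andP[s2 _]]].
move=> /andP[_ /andP[_ /andP[t2 _]]] /andP[x1 /andP[x2 /andP[x3 x4]]].
have E1 := H2 s t s_0 st tT s2 t2 x x2.
have E2 : `|X s0 t0 x - X s0 t0 x0| < e / 2.
  apply: le_lt_trans (Hx s0 x x0 t0 s0T _ x1 _ _) _; rewrite ?subrr ?normr0 ?st0 //.
  by rewrite mulrC -ltr_pdivlMr.
rewrite -(subrK (X s0 t0 x) (X s t x)) -addrA.
apply: le_lt_trans (ler_normD _ _) _; rewrite [ltRHS]splitr.
exact: ler_ltD.
Qed.

Lemma flow_C001 : C001 A X /\
  (forall s0 t0 x0, A (s0, t0) ->
    forall e : R, 0 < e -> exists2 d : R, 0 < d & forall s t x y, A (s, t) ->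
      `|s - s0| < d -> `|t - t0| < d -> `|x - x0| < d -> `|y - x0| < d ->
      `|X s t x - X s t y - 'd (X s0 t0) x0 (x - y)| <= e * `|x - y|).
Proof.
apply: C001_of_strict.
  apply/subspace_continuousP => -[[s0 t0] x0] [/= /AE[s00 st0 t0T] _].
  apply/cvgrPdist_lt => e e0; rewrite near_withinE; apply/near_tripleP.
  have [d d0 dH] := flow_continuous x0 s00 st0 t0T e0.
  exists d => // s t x sd td xd [/= /AE[s_0 st tT] _].
  by rewrite distrC; exact: dH.
move=> s0 t0 x0 A0; have /AE[s00 st0 t0T] := A0.
have s0T : 0 <= s0 <= T by rewrite s00 (le_trans st0).
have [C [M [C0 M0 [d d0 [Ht Hx H1]]]]] := local x0 s0T.
have [||||||L [K [LK LH]]] := @strict_partial_derivative R V V (R * R)%type A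
  (fun d p => `|p.1 - s0| < d /\ `|p.2 - t0| < d) (s0, t0) (fun p => X p.1 p.2) x0.
- by move=> e e0; rewrite /= !subrr !normr0.
- exact: A0.
- by move=> e e' p ee' [p1 p2]; split; [exact: lt_le_trans p1 ee'|exact: lt_le_trans p2 ee'].
- move=> e e0; have [d' d'0 H] := H1 e e0; exists d' => //.
  move=> [s t] /AE[s_0 st tT] /= [sd td] y z y' z' k yd zd y'd z'd yz.
  apply: H => //; [by rewrite s_0 (le_trans st)|by rewrite st].
- have [d1 d10 H2] := equicontinuous x0 s00 st0 t0T; exists d1 => // e e0.
  have [d2 d20 H3] := H2 e e0; exists d2 => // -[s t] /AE[s_0 st tT] /= [sd td] x xd.
  exact: H3.
- exists C, d; split => // y z yd zd; apply: Hx => //.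
    by rewrite subrr normr0.
  by rewrite /= st0.
exists L, K; split => // e e0; have [d' d'0 H] := LH e e0.
by exists d' => // s t x y Ast sd td xd yd; exact: (H (s, t)).
Qed.

(** Strict differentiability in the final time: both endpoints [a] and [b] vary, and so do [s] and
    [x]. The case [t0 = s0] also serves for the derivative in the starting time. *)
Lemma flow_increment_approx s0 t0 x0 : 0 <= s0 -> s0 <= t0 -> t0 <= T ->
  forall e, 0 < e -> exists2 d : R, 0 < d & forall s x a b, 0 <= s -> s <= a ->
    a <= b -> b <= T -> `|s - s0| < d -> `|x - x0| < d -> `|a - t0| < d ->
    `|b - t0| < d ->
    `|X s b x - X s a x - (b - a) *: f t0 (X s0 t0 x0)| <= e * (b - a).
Proof.
move=> s00 st0 t0T e e0; have t0T' : 0 <= t0 <= T by rewrite (le_trans s00).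
have [d1 d10 H1] := f_near f_C01 (X s0 t0 x0) t0T' e0.
have [d2 d20 H2] := flow_continuous x0 s00 st0 t0T d10.
exists (Num.min d1 d2); first by rewrite lt_min d10.
move=> s x a b s_0 sa ab bT; rewrite !lt_min => /andP[_ s2] /andP[_ x2] /andP[a1 a2] /andP[b1 b2].
have sT : 0 <= s <= T by rewrite s_0 (le_trans sa (le_trans ab bT)).
have int1 : bochner_integrable mu `[a, b] (fun r => f r (X s r x)).
  exact: (flow_integrable f_C01 X_cont).
have int2 : bochner_integrable mu `[a, b] (fun=> f t0 (X s0 t0 x0)).
  apply: bochner_integrable_itv_continuous; apply: continuous_subspaceT => r.
  exact: cvg_cst.
rewrite increment // -bochner_integral_cst // -bochner_integralB //; last 1 first.
- exact: lebesgue_measure_itvcc_fin.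
apply: le_norm_bochner_integral_itv => //.
  by apply: bochner_integrableB; [exact: measurable_itv| |].
move=> r /andP[ar rb]; have rd d : `|a - t0| < d -> `|b - t0| < d -> `|r - t0| < d.
  by rewrite !ltr_distl => /andP[a3 _] /andP[_ b4]; rewrite (lt_le_trans a3) // (le_lt_trans rb).
have sr := le_trans sa ar; have rT := le_trans rb bT.
have [|||H _] := H1 r (X s r x).
- by rewrite (le_trans s_0 sr).
- exact: rd.
- by apply: H2 => //; exact: rd.
exact: ltW.
Qed.

Lemma flow_continuously_differentiable :
  continuously_differentiable_on
    [set p : R * R * V | [/\ p.1.1 \in `]0, T[, p.1.2 \in `]0, T[
                               & p.1.1 < p.1.2]]
        (fun p => X p.1.1 p.1.2 p.2).
Proof.
have [[_ dX _] strict] := flow_C001.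
apply: continuously_differentiable_of_strict => -[[s0 t0] x0] [/=].
rewrite !in_itv /= => /andP[s00 s0T] /andP[t00 t0T] st0.
have A0 : A (s0, t0) by apply/AE; split; exact: ltW.
pose D := 'd (X s0 t0) x0.
have [K K0 DK] := continuous_linear_bound (diff_continuous (dX s0 t0 x0 A0)).
pose f0 := f s0 x0; pose f1 := f t0 (X s0 t0 x0).
(* To first order, starting later by [a] with the value changed by [v] amounts to starting at [s0]
   with the value changed by [v - a f0]; hence the derivative in the starting time is [- D f0]. *)
pose L0 (w : R * R * V) : V := D (w.2 - w.1.1 *: f0) + w.1.2 *: f1.
have L0lin : linear L0.
  move=> k [[a b] v] [[a' b'] v']; rewrite /L0 /=.
  rewrite [k *: (_ + _)]scalerDr -[k *: D _]linearZZ addrACA -linearD scalerA -scalerDl.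
  by congr (D _ + _); rewrite scalerBr scalerA addrACA -opprD -scalerDl.
pose Lm := GRing.isLinear.Build R (R * R * V)%type V *:%R L0 L0lin.
pose L : {linear (R * R * V)%type -> V} := HB.pack L0 Lm.
have prod_norms (w : R * R * V) : [/\ `|w.1.1| <= `|w|, `|w.1.2| <= `|w| & `|w.2| <= `|w|].
  by case: w => [[a b] v] /=; rewrite !prod_normE /= !le_max !lexx ?orbT.
exists L, (K * (1 + `|f0|) + `|f1|); split.
  move=> w; have [w1 w2 w3] := prod_norms w.
  apply: le_trans (ler_normD _ _) _; rewrite mulrDl -mulrA; apply: lerD.
    apply: le_trans (DK _) _; rewrite ler_pM2l // mulrDl mul1r.
    apply: le_trans (ler_normB _ _) _; apply: lerD => //.
    by rewrite normrZ mulrC ler_wpM2l.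
  by rewrite normrZ mulrC ler_wpM2l.
move=> e e0.
(* [2 + |f0|] bounds the ratio of [z - x'] to [m], [K] belongs to the change of start and the
   remaining 1 to the change of final time. *)
pose B := 3 + `|f0| + K; have B0 : 0 < B by rewrite addr_gt0 // ltr_wpDr.
pose e1 := Num.min 1 (e / B); have e10 : 0 < e1 by rewrite lt_min ltr01 divr_gt0.
have [d1 d10 H1] := strict s0 t0 x0 A0 e1 e10.
have s00' := ltW s00; have s0T' := ltW s0T; have t0T' := ltW t0T.
have [d2 d20 H2] := flow_increment_approx x0 s00' (lexx s0) s0T' e10.
have [d3 d30 H3] := flow_increment_approx x0 s00' (ltW st0) t0T' e10.
have [d4 d40 H4] := flow_continuous x0 s00' (lexx s0) s0T' d10.
rewrite (flow_id f_C01 X_cont X_eq) ?s00' // in H2 H4.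
(* Keeps all times in [[0, T]] and puts starting times before, final times after the midpoint of
   [s0] and [t0], so that every start precedes every end. *)
pose gap := Num.min s0 (Num.min (T - t0) ((t0 - s0) / 2)).
have gap0 : 0 < gap by rewrite !lt_min s00 subr_gt0 t0T divr_gt0 // subr_gt0.
have [gs gT gst] : [/\ gap <= s0, gap <= T - t0 & gap <= (t0 - s0) / 2].
  by split; rewrite /gap !ge_min lexx ?orbT.
clearbody gap; pose d := Num.min gap (Num.min (Num.min d1 d2) (Num.min d3 d4)).
have d0 : 0 < d by rewrite lt_min gap0 !lt_min d10 d20 d30.
have [dg dd1 dd2 dd3 dd4] : [/\ d <= gap, d <= d1, d <= d2, d <= d3 & d <= d4].
  by split; rewrite /d !ge_min lexx ?orbT.
clearbody d; exists d => //.
(* The claim is symmetric in the two triples, so the earlier start may be put first; its trajectory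
   is then restarted at the later one. *)
suff W s t x s' t' x' : s <= s' ->
    `|s - s0| < d -> `|t - t0| < d -> `|x - x0| < d ->
    `|s' - s0| < d -> `|t' - t0| < d -> `|x' - x0| < d ->
    `|X s t x - X s' t' x' - (D (x - x' - (s - s') *: f0) + (t - t') *: f1)| <=
    e * Num.max (Num.max `|s - s'| `|t - t'|) `|x - x'|.
  move=> [[s t] x] [[s' t'] x'] qd q'd.
  have [/= a1 a2 a3] := prod_norms ((s, t, x) - (s0, t0, x0)).
  have [/= b1 b2 b3] := prod_norms ((s', t', x') - (s0, t0, x0)).
  have [ss|ss] := leP s s'.
    apply: (W s t x s' t' x') => //; first [exact: le_lt_trans a1 qd|
      exact: le_lt_trans a2 qd|exact: le_lt_trans a3 qd|exact: le_lt_trans b1 q'd|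
      exact: le_lt_trans b2 q'd|exact: le_lt_trans b3 q'd].
  change (`|X s t x - X s' t' x' - (D (x - x' - (s - s') *: f0) + (t - t') *: f1)| <=
    e * Num.max (Num.max `|s - s'| `|t - t'|) `|x - x'|).
  rewrite -normrN [`|s - s'|]distrC [`|t - t'|]distrC [`|x - x'|]distrC.
  have -> : - (X s t x - X s' t' x' - (D (x - x' - (s - s') *: f0) + (t - t') *: f1)) =
      X s' t' x' - X s t x - (D (x' - x - (s' - s) *: f0) + (t' - t) *: f1).
    have -> : x' - x - (s' - s) *: f0 = - (x - x' - (s - s') *: f0).
      by rewrite -scaleNr opprB [RHS]opprB opprB addrC.
    have -> : (t' - t) *: f1 = - ((t - t') *: f1) by rewrite -scaleNr opprB.
    rewrite (linearN D) opprD opprB; congr (_ - _); exact: opprD.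
  apply: (W s' t' x' s t x) => //; first [exact: ltW|exact: le_lt_trans a1 qd|
    exact: le_lt_trans a2 qd|exact: le_lt_trans a3 qd|exact: le_lt_trans b1 q'd|
    exact: le_lt_trans b2 q'd|exact: le_lt_trans b3 q'd].
move=> ss' sd td xd s'd t'd x'd.
have lt_d r c c' : `|r - c| < d -> d <= c' -> c - c' < r < c + c'.
  rewrite ltr_distl => /andP[h1 h2] dc'.
  by rewrite (le_lt_trans _ h1) ?lerB // (lt_le_trans h2) // lerD2l.
have /andP[s_0 _] := lt_d _ _ _ sd (le_trans dg gs).
have {}s_0 : 0 <= s by apply/ltW; move: s_0; rewrite subrr.
have /andP[_ s'2] := lt_d _ _ _ s'd (le_trans dg gst).
have /andP[t1 _] := lt_d _ _ _ td (le_trans dg gst).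
have /andP[_ tT] := lt_d _ _ _ td (le_trans dg gT).
have /andP[t'1 _] := lt_d _ _ _ t'd (le_trans dg gst).
have /andP[_ t'T] := lt_d _ _ _ t'd (le_trans dg gT).
have {}tT : t <= T by apply: ltW; move: tT; rewrite addrC subrK.
have {}t'T : t' <= T by apply: ltW; move: t'T; rewrite addrC subrK.
have mid : s0 + (t0 - s0) / 2 = t0 - (t0 - s0) / 2 by field.
rewrite mid in s'2.
have s't : s' <= t by rewrite ltW // (lt_trans s'2).
have s't' : s' <= t' by rewrite ltW // (lt_trans s'2).
have s'0 : 0 <= s' by exact: le_trans ss'.
have s'T : s' <= T by exact: le_trans tT.
have lt_le r c : `|r - c| < d -> forall c', d <= c' -> `|r - c| < c'.
  by move=> rc c'; exact: lt_le_trans.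
set m := Num.max _ _.
have [m1 m2 m3] : [/\ `|s - s'| <= m, `|t - t'| <= m & `|x - x'| <= m].
  by split; rewrite /m !le_max lexx ?orbT.
clearbody m.
pose z := X s s' x.
have E2 : `|z - x - (s' - s) *: f0| <= e1 * `|s - s'|.
  have := H2 s x s s' s_0 (lexx _) ss' s'T.
  rewrite (flow_id f_C01 X_cont X_eq) ?s_0 ?(le_trans ss') // distrC.
  rewrite [`|s - s'|]distrC (ger0_norm (x := s' - s)) ?subr_ge0 // distrC.
  by apply; exact: lt_le.
have zd : `|z - x0| < d1.
  by apply: H4 => //; exact: lt_le.
have As't : A (s', t) by apply/AE.
have E1 := H1 s' t z x' As't (lt_le_trans s'd dd1) (lt_le_trans td dd1) zd
  (lt_le_trans x'd dd1).
have E3 : `|X s' t x' - X s' t' x' - (t - t') *: f1| <= e1 * `|t - t'|.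
  have [tt|tt] := leP t' t.
    rewrite ger0_norm ?subr_ge0 //; apply: H3 => //;
      first [exact: lt_le|exact: lt_le_trans dd3].
  have -> : X s' t x' - X s' t' x' - (t - t') *: f1 =
      - (X s' t' x' - X s' t x' - (t' - t) *: f1).
    by rewrite -[t - t']opprB scaleNr opprK [RHS]opprD opprB opprK.
  rewrite normrN -[`|t - t'|]normrN opprB.
  rewrite (ger0_norm (x := t' - t)) ?subr_ge0 ?(ltW tt) //; apply: H3 => //;
    first [exact: ltW|exact: lt_le|exact: lt_le_trans dd3].
rewrite -(semigroup x s_0 ss' s't tT) -/z.
have -> : X s' t z - X s' t' x' - (D (x - x' - (s - s') *: f0) + (t - t') *: f1) =
    (X s' t z - X s' t x' - D (z - x')) + (D (z - x - (s' - s) *: f0) +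
     (X s' t x' - X s' t' x' - (t - t') *: f1)).
  have -> : D (x - x' - (s - s') *: f0) = D (z - x') - D (z - x - (s' - s) *: f0).
    rewrite -linearB; congr (D _); rewrite -[s - s']opprB scaleNr opprK.
    have -> : x - x' = (x - z) + (z - x') by rewrite addrA subrK.
    by rewrite opprB opprB [RHS]addrCA [RHS]addrC; congr (_ + _); exact: addrC.
  exact: subr_regroup.
have zx' : `|z - x'| <= (2 + `|f0|) * m.
  have -> : z - x' = (z - x - (s' - s) *: f0) + ((s' - s) *: f0 + (x - x')).
    by rewrite addrA subrK addrA subrK.
  apply: le_trans (ler_normD _ _) _.
  have : `|(s' - s) *: f0 + (x - x')| <= m * `|f0| + m.
    apply: le_trans (ler_normD _ _) (lerD _ m3).
    by rewrite normrZ distrC ler_wpM2r.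
  have : `|z - x - (s' - s) *: f0| <= m.
    apply: le_trans E2 _; apply: le_trans m1.
    by rewrite ler_piMl // /e1 ge_min lexx.
  move=> h1 h2; apply: le_trans (lerD h1 h2) _.
  by rewrite le_eqVlt; apply/orP; left; apply/eqP; ring.
have D2 : `|D (z - x - (s' - s) *: f0)| <= K * (e1 * m).
  apply: le_trans (DK _) _; rewrite ler_pM2l //; apply: le_trans E2 _.
  by rewrite ler_pM2l.
apply: le_trans (ler_normD _ _) _.
have E1' : `|X s' t z - X s' t x' - D (z - x')| <= e1 * ((2 + `|f0|) * m).
  by apply: le_trans E1 _; rewrite ler_pM2l.
have E3' : `|X s' t x' - X s' t' x' - (t - t') *: f1| <= e1 * m.
  by apply: le_trans E3 _; rewrite ler_pM2l.
apply: le_trans (lerD E1' (le_trans (ler_normD _ _) (lerD D2 E3'))) _.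
have -> : e1 * ((2 + `|f0|) * m) + (K * (e1 * m) + e1 * m) = e1 * B * m.
  by rewrite /B; ring.
apply: ler_wpM2r; first exact: le_trans m1.
by rewrite -ler_pdivlMr // /e1 ge_min lexx orbT.
Qed.

End flow_regularity.

(** * The perturbation formula *)

Section norm_integral.
Context (R : realType) (V : completeNormedModType R).
Notation mu := (@lebesgue_measure R).
Notation bint a b g := (bochner_integral mu `[a, b] g).
Implicit Types g h : R -> V.

Lemma bochner_integrable_norm a b g : bochner_integrable mu `[a, b] g ->
  mu.-integrable `[a, b] (EFin \o (fun r => `|g r|)).
Proof.
move=> [cg gg]; apply/integrableP; split; first exact: measurable_norm.
apply: le_lt_trans gg; rewrite le_eqVlt; apply/orP; left; apply/eqP.
by apply: eq_integral => x _; rewrite /= normr_id.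
Qed.

Lemma norm_integral_split a b c g : a <= b -> b <= c ->
  bochner_integrable mu `[a, c] g ->
  \int[mu]_(r in `[a, c]) `|g r| =
  \int[mu]_(r in `[a, b]) `|g r| + \int[mu]_(r in `[b, c]) `|g r|.
Proof.
move=> ab bc ig; have := Rintegral_itvB (bochner_integrable_norm ig).
move=> /(_ b); rewrite !bnd_simp => /(_ ab bc).
rewrite Rintegral_itv_obnd_cbnd => [/eqP|].
  by rewrite subr_eq addrC => /eqP.
have : bochner_integrable mu `]b, c] g.
  apply: sub_bochner_integrable ig; [exact: measurable_itv|exact: measurable_itv|].
  by move=> r /=; rewrite !in_itv /= => /andP[/ltW/(le_trans ab) -> ->].
move=> [cg gg]; apply/integrableP; split; first exact: measurable_norm.
apply: le_lt_trans gg; rewrite le_eqVlt; apply/orP; left; apply/eqP.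
by apply: eq_integral => x _; rewrite /= normr_id.
Qed.

Lemma le_norm_bochner_integral_norm a b g h k : 0 <= k ->
  bochner_integrable mu `[a, b] g -> bochner_integrable mu `[a, b] h ->
  (forall r, a <= r <= b -> `|g r| <= k * `|h r|) ->
  `|bint a b g| <= k * \int[mu]_(r in `[a, b]) `|h r|.
Proof.
move=> k0 ig ih gh; rewrite -lee_fin.
apply: le_trans (le_norm_bochner_integral _ _ ig) _ => //.
  exact: lebesgue_measure_itvcc_fin.
have [ch hh] := ih; have [cg gg] := ig.
rewrite EFinM /Rintegral fineK; last first.
  by rewrite ge0_fin_numE //; apply: integral_ge0.
rewrite -ge0_integralZl_EFin //; last exact: measurable_norm.
apply: ge0_le_integral => //.
- exact: measurable_norm.
- by apply: measurable_funeM; exact: measurable_norm.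
Qed.

(** Increments of the primitive are dominated by those of the scalar primitive of [|g|]. *)
Lemma bochner_primitive_continuous a b g : a <= b ->
  bochner_integrable mu `[a, b] g -> {within `[a, b], continuous (fun t => bint a t g)}.
Proof.
move=> ab ig; apply/within_continuous_itvP => t tab e e0.
have := parameterized_integral_continuous ab (bochner_integrable_norm ig).
move=> /within_continuous_itvP /(_ t tab e e0) [d d0 dH]; exists d => // r rab rt.
apply: le_lt_trans (dH r rab rt).
have inc u v : a <= u -> u <= v -> v <= b -> `|bint a v g - bint a u g| <=
    parameterized_integral mu a v (fun r => `|g r|) -
    parameterized_integral mu a u (fun r => `|g r|).
  move=> au uv vb; have igv : bochner_integrable mu `[a, v] g.
    exact: bochner_integrable_sub_itv ig.
  have iuv : bochner_integrable mu `[u, v] g by exact: bochner_integrable_sub_itv ig.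
  rewrite /parameterized_integral (norm_integral_split au uv igv).
  rewrite (@bochner_integral_itv_split _ _ a u v) ?au // addrAC subrr add0r.
  rewrite addrAC subrr add0r -[leRHS]mul1r.
  by apply: le_norm_bochner_integral_norm => // q _; rewrite mul1r.
move: tab rab => /andP[at_ tb] /andP[ar rb].
have [tr|rt'] := leP t r; first by apply: le_trans (inc _ _ at_ tr rb) _; exact: ler_norm.
rewrite distrC [leRHS]distrC.
by apply: le_trans (inc _ _ ar (ltW rt') tb) _; exact: ler_norm.
Qed.

End norm_integral.

Lemma subr_insert_sum (U : zmodType) (u w i p q : U) :
  u - w - i = (u - w - (p + q)) + (p + (q - i)).
Proof. by rewrite [p + (q - i)]addrA [RHS]addrA subrK. Qed.

Lemma subr_concat (U : zmodType) (a b c x y : U) :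
  c - a - (x + y) = (c - b - y) + (b - a - x).
Proof.
have -> : c - a = (c - b) + (b - a) by rewrite addrA subrK.
by rewrite [x + y]addrC opprD addrACA.
Qed.

Section perturbation.
Context (R : realType) (V : completeNormedModType R) (T : R) (f : R -> V -> V).
Hypothesis f_C01 : C01 `[0, T] f.
Hypothesis T0 : 0 < T.
Notation mu := (@lebesgue_measure R).
Notation bint a b g := (bochner_integral mu `[a, b] g).
Context (X : R -> R -> V -> V).
Hypothesis X_cont : forall x s, 0 <= s <= T ->
  {within `[s, T], continuous (fun t => X s t x)}.
Hypothesis X_eq : forall x s, 0 <= s <= T -> forall t, s <= t <= T ->
  X s t x = x + bint s t (fun r => f r (X s r x)).
Context (Y E : R -> V).
Hypothesis Y_meas : strongly_measurable `[0, T] Y.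
Hypothesis E_meas : strongly_measurable `[0, T] E.
Hypothesis fYE_int : (\int[mu]_(tau in `[0%R, T])
                        (`|f tau (Y tau)| + `|E tau|)%:E < +oo)%E.
Hypothesis Y_eq : forall t, 0 <= t <= T ->
  Y t = Y 0 + bint 0 t (fun tau => f tau (Y tau) + E tau).

Let mT : measurable (`[0, T]%classic : set (measurableTypeR R)).
Proof. exact: measurable_itv. Qed.

Let cY : countably_based (`[0, T]%classic : set (measurableTypeR R)) Y.
Proof. exact: strongly_measurable_countably_based. Qed.

Let cE : countably_based (`[0, T]%classic : set (measurableTypeR R)) E.
Proof. exact: strongly_measurable_countably_based. Qed.

Let cfY : countably_based (`[0, T]%classic : set (measurableTypeR R))
  (fun r => f r (Y r)).
Proof.
have [cf _ _] := f_C01.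
have cid := countably_based_id mT.
apply: (countably_based_comp (A := `[0, T]%classic `*` setT)
  (G := fun p : R * V => f p.1 p.2) (h := fun r => (r, Y r))) => //.
exact: countably_based_pair.
Qed.

Let fY_int : bochner_integrable mu `[0, T] (fun r => f r (Y r)).
Proof.
split => //; apply: le_lt_trans fYE_int; apply: ge0_le_integral => //.
- exact: measurable_norm.
- rewrite (_ : (fun x => _) = (fun x => `|f x (Y x)|%:E + `|E x|%:E)%E) //.
  by apply: emeasurable_funD; exact: measurable_norm.
- by move=> r _; rewrite lee_fin lerDl.
Qed.

Let E_int : bochner_integrable mu `[0, T] E.
Proof.
split => //; apply: le_lt_trans fYE_int; apply: ge0_le_integral => //.
- exact: measurable_norm.
- rewrite (_ : (fun x => _) = (fun x => `|f x (Y x)|%:E + `|E x|%:E)%E) //.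
  by apply: emeasurable_funD; exact: measurable_norm.
- by move=> r _; rewrite lee_fin lerDr.
Qed.

Let fYE_integrable : bochner_integrable mu `[0, T] (fun r => f r (Y r) + E r).
Proof. exact: bochner_integrableD. Qed.

Let Y_cont : {within `[0, T], continuous Y}.
Proof.
have c := bochner_primitive_continuous (ltW T0) fYE_integrable.
apply/within_continuous_itvP => t tT e e0.
move/within_continuous_itvP : c => /(_ t tT e e0) [d d0 dH]; exists d => // r rT rt.
rewrite (Y_eq rT) (Y_eq tT) opprD addrACA subrr add0r; exact: dH.
Qed.

Let Y_increment a b : 0 <= a -> a <= b -> b <= T ->
  Y b - Y a = bint a b (fun r => f r (Y r)) + bint a b E.
Proof.
move=> a0 ab bT; have i0b : bochner_integrable mu `[0, b] (fun r => f r (Y r) + E r).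
  exact: bochner_integrable_sub_itv fYE_integrable.
rewrite Y_eq ?(le_trans a0 ab) // [Y a]Y_eq ?a0 ?(le_trans ab) //.
rewrite (@bochner_integral_itv_split _ _ 0 a b) ?a0 // opprD addrACA subrr add0r.
rewrite addrAC subrr add0r; apply: bochner_integralD.
- exact: measurable_itv.
- exact: lebesgue_measure_itvcc_fin.
- exact: bochner_integrable_sub_itv fY_int.
- exact: bochner_integrable_sub_itv E_int.
Qed.

Section fixed_time.
Context (t : R).
Hypothesis t0T : 0 <= t <= T.

Let D r := 'd (X r t) (Y r).

Let A := [set p : R * R | [/\ p.1 \in `[0, T], p.2 \in `[0, T] & p.1 <= p.2]].

Let At r : 0 <= r <= t -> A (r, t).
Proof.
move: t0T => /andP[t0 tT] /andP[r0 rt].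
by rewrite /A /= !in_itv /= r0 t0 tT rt (le_trans rt tT).
Qed.

Let D_bound r : 0 <= r <= t -> exists2 K : R, 0 < K & forall v, `|D r v| <= K * `|v|.
Proof.
move=> /At Ar; have [[_ dX _] _] := flow_C001 f_C01 T0 X_cont X_eq.
by apply: continuous_linear_bound; apply: diff_continuous; exact: dX.
Qed.

Let D_near r : 0 <= r <= t -> forall e, 0 < e -> exists2 d : R, 0 < d &
  forall q, 0 <= q <= t -> `|q - r| < d -> forall v, `|D q v - D r v| <= e * `|v|.
Proof.
move=> rt e e0; have [[_ _ LX] _] := flow_C001 f_C01 T0 X_cont X_eq.
have tT : t <= T by case/andP: t0T.
have ArV : (A `*` setT) (r, t, Y r) by split => //; exact: At.
have := proj1 (@L_continuous_onP R V V (R * R * V)%type (A `*` setT)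
  (fun p => 'd (X p.1.1 p.1.2) (p.2))) LX _ ArV _ e0.
rewrite near_withinE => /near_tripleP [d d0 dH].
have rT : 0 <= r <= T by case/andP: rt => -> /le_trans; apply.
have [d1 d10 d1H] := proj1 (within_continuous_itvP _ _ _) Y_cont r rT d d0.
exists (Num.min d d1); first by rewrite lt_min d0.
move=> q qt; rewrite lt_min => /andP[q1 q2] v.
have qT : 0 <= q <= T by case/andP: qt => -> /le_trans; apply.
apply: (dH q t (Y q)) => //; first by rewrite subrr normr0.
  exact: d1H.
by split => //; exact: At.
Qed.

(** [D r v] is jointly continuous in [(r, v)], because the differential is continuous in operator
    norm and bounded at each [r]; composition with the pair of the identity and [E] gives (iii). *)
Let DE_based : countably_based (`[0, t]%classic : set (measurableTypeR R))
  (fun r => D r (E r)).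
Proof.
have tT : t <= T by case/andP: t0T.
have mt : measurable (`[0, t]%classic : set (measurableTypeR R)) by exact: measurable_itv.
have cEt : countably_based (`[0, t]%classic : set (measurableTypeR R)) E.
  apply: countably_based_subset cE => // r /=; rewrite !in_itv /=.
  by move=> /andP[-> /le_trans]; apply.
have cid := countably_based_id mt.
apply: (countably_based_comp (A := `[0, t]%classic `*` setT)
  (G := fun p : R * V => D p.1 p.2) (h := fun r => (r, E r))) => //; last first.
  exact: countably_based_pair.
apply/subspace_continuousP => -[r v] [/= rt _]; rewrite in_itv /= in rt.
apply/cvgrPdist_lt => e e0; rewrite near_withinE; apply/near_pairP.
have [K K0 DK] := D_bound rt.
(* Within distance 1 of [v] one has [|w| <= |v| + 1], so the change of operator costs at most
   [e / 2]. *)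
have e1 : 0 < e / 2 / (`|v| + 1) by rewrite !divr_gt0 // ltr_wpDl.
have [d d0 dH] := D_near rt e1.
have e2 : 0 < e / 2 / K by rewrite !divr_gt0.
exists (Num.min d (Num.min 1 (e / 2 / K))); first by rewrite !lt_min d0 ltr01.
move=> q w; rewrite !lt_min => /andP[qd _] /andP[_ /andP[w1 w2]] [/= qt _].
rewrite in_itv /= in qt; suff : `|D q w - D r v| < e by rewrite distrC.
have -> : D q w - D r v = D q w - D r w + D r (w - v) by rewrite linearB addrA subrK.
apply: le_lt_trans (ler_normD _ _) _; rewrite [ltRHS]splitr; apply: ler_ltD.
  apply: le_trans (dH q qt qd w) _; rewrite mulrAC ler_pdivrMr ?ltr_wpDl //.
  rewrite ler_pM2l ?divr_gt0 // -(subrK v w).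
  by apply: le_trans (ler_normD _ _) _; rewrite addrC lerD2l ltW.
by apply: le_lt_trans (DK _) _; rewrite mulrC -ltr_pdivlMr.
Qed.

Lemma derivative_perturbation_measurable :
  strongly_measurable `[0%R, t] (fun r => 'd (X r t) (Y r) (E r)).
Proof. exact: countably_based_strongly_measurable DE_based. Qed.

Lemma derivative_perturbation_integrable :
  bochner_integrable mu `[0, t] (fun r => 'd (X r t) (Y r) (E r)).
Proof.
split; first exact: DE_based.
have tT : t <= T by case/andP: t0T.
(* Local operator bounds, valid by continuity in [r], are glued over [[0, t]]; the integrand is then
   dominated by a multiple of [|E|]. *)
have [K K0 HK] : exists2 K : R, 0 < K & forall r, 0 <= r <= t ->
    forall v, `|D r v| <= K * `|v|.
  apply: interval_uniform; first by case/andP: t0T.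
    by move=> r c c' _ cc' H v; apply: le_trans (H v) _; rewrite ler_wpM2r.
  move=> r rt; have [K K0 DK] := D_bound rt; have [d d0 dH] := D_near rt ltr01.
  exists d => //; exists (1 + K); first by rewrite addr_gt0.
  move=> q qt qr v; rewrite -(subrK (D r v) (D q v)) mulrDl.
  exact: le_trans (ler_normD _ _) (lerD (dH q qt qr v) (DK v)).
have [cEt Et] : bochner_integrable mu `[0, t] E by exact: bochner_integrable_sub_itv E_int.
apply: (@le_lt_trans _ _ (K%:E * \int[mu]_(r in `[0%R, t]) `|E r|%:E)%E).
  rewrite -ge0_integralZl_EFin //; [|exact: measurable_norm|exact: ltW].
  apply: ge0_le_integral => //.
  - exact: measurable_norm.
  - by apply: measurable_funeM; exact: measurable_norm.
  - by move=> r; rewrite /= in_itv /= => rt; rewrite -EFinM lee_fin HK.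
by rewrite lte_mul_pinfty // lee_fin ltW.
Qed.

Lemma perturbation_formula s : 0 <= s <= t ->
  Y t = X s t (Y s) + bint s t (fun r => 'd (X r t) (Y r) (E r)).
Proof.
move=> /andP[s0 st]; have /andP[t0 tT] := t0T.
have [_ strict] := flow_C001 f_C01 T0 X_cont X_eq.
pose N a b := \int[mu]_(r in `[a, b]) `|E r|.
pose err a b := X b t (Y b) - X a t (Y a) - bint a b (fun r => D r (E r)).
have DEint a b : 0 <= a -> b <= t ->
    bochner_integrable mu `[a, b] (fun r => D r (E r)).
  by move=> a0 bt; exact: bochner_integrable_sub_itv derivative_perturbation_integrable.
have Eint a b : 0 <= a -> b <= T -> bochner_integrable mu `[a, b] E.
  by move=> a0 bT; exact: bochner_integrable_sub_itv E_int.
have small e : 0 < e -> `|err s t| <= e * ((t - s) + N s t).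
  move=> e0.
  apply: (@interval_concatenation _ (fun a b => `|err a b| <= e * ((b - a) + N a b))) => //.
    move=> a b c sa ab bc ct ab' bc'; have a0 := le_trans s0 sa.
    have -> : err a c = err b c + err a b.
      rewrite /err (@bochner_integral_itv_split _ _ a b c) ?ab //; last exact: DEint.
      exact: subr_concat.
    have -> : N a c = N a b + N b c.
      by apply: norm_integral_split => //; apply: Eint => //; exact: le_trans tT.
    apply: le_trans (ler_normD _ _) _; apply: le_trans (lerD bc' ab') _.
    rewrite -mulrDr ler_pM2l // le_eqVlt; apply/orP; left; apply/eqP; ring.
  move=> r0 /andP[sr0 r0t]; have r00 := le_trans s0 sr0; have r0T := le_trans r0t tT.
  have r0t' : 0 <= r0 <= t by rewrite r00.
  have [K K0 DK] := D_bound r0t'.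
  (* The three local errors add up to at most [e1 * (2 + K)] times [(b - a) + N a b]. [K] bounds the
     derivative at [r0] only; concatenation lets it, and the radii, depend on [r0]. *)
  pose e1 := Num.min 1 (e / (2 + K)).
  have e10 : 0 < e1 by rewrite lt_min ltr01 divr_gt0 // addr_gt0.
  have [e11 e1e] : e1 <= 1 /\ e1 * (2 + K) <= e.
    by rewrite -ler_pdivlMr ?addr_gt0 // /e1 !ge_min !lexx orbT.
  clearbody e1.
  have [d1 d10 H1] := strict r0 t (Y r0) (At r0t') e1 e10.
  have [d2 d20 H2] := D_near r0t' e10.
  have r0T' : 0 <= r0 <= T by rewrite r00.
  have e12 : 0 < e1 / 2 by rewrite divr_gt0.
  have [d3 d30 H3] := f_near f_C01 (Y r0) r0T' e12.
  have m13 : 0 < Num.min d1 d3 by rewrite lt_min d10.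
  have [d4 d40 H4] := flow_continuous f_C01 T0 X_cont X_eq (Y r0) r00 (lexx r0) r0T m13.
  have m134 : 0 < Num.min (Num.min d1 d3) d4 by rewrite lt_min m13.
  have [d5 d50 H5] := proj1 (within_continuous_itvP _ _ _) Y_cont r0 r0T' _ m134.
  rewrite (flow_id f_C01 X_cont X_eq) // in H4.
  exists (Num.min (Num.min d1 d2) (Num.min (Num.min d3 d4) d5)).
    by rewrite !lt_min d10 d20 d30 d40.
  move=> a b sa ar0 r0b bt ad bd; have ab := le_trans ar0 r0b.
  have a0 := le_trans s0 sa; have bT := le_trans bt tT.
  have near_r r : a <= r <= b -> [/\ 0 <= r <= T, `|r - r0| < d1, `|r - r0| < d2,
      `|r - r0| < d3 & `|r - r0| < d4 /\ `|r - r0| < d5].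
    move=> /andP[ar rb]; have : `|r - r0| < Num.min (Num.min d1 d2) (Num.min (Num.min d3 d4) d5).
      by rewrite ltr_distl (lt_le_trans ad ar) (le_lt_trans rb bd).
    rewrite !lt_min (le_trans a0 ar) (le_trans rb bT).
    by move=> /andP[/andP[-> ->] /andP[/andP[-> ->] ->]].
  have near_Y r : a <= r <= b -> [/\ `|Y r - Y r0| < d1, `|Y r - Y r0| < d3 & `|Y r - Y r0| < d4].
    move=> rab; have [rT _ _ _ [_ r5]] := near_r r rab.
    by have := H5 r rT r5; rewrite !lt_min => /andP[/andP[-> ->] ->].
  have aab : a <= a <= b by rewrite lexx.
  have bab : a <= b <= b by rewrite lexx andbT.
  have [aT a1 a2 a3 [a4 a5]] := near_r a aab.
  have [bT' b1 b2 b3 [b4 b5]] := near_r b bab.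
  have [Ya1 Ya3 Ya4] := near_Y a aab; have [Yb1 Yb3 Yb4] := near_Y b bab.
  have near_X r : a <= r <= b -> `|X a r (Y a) - Y r0| < d1 /\ `|X a r (Y a) - Y r0| < d3.
    move=> rab; have [rT _ _ _ [r4 _]] := near_r r rab; have /andP[ar rb] := rab.
    have := H4 a r (Y a) a0 ar (le_trans rb bT) a4 r4 Ya4.
    by rewrite lt_min => /andP.
  (* By the flow property [X a t (Y a)] is [X b t z], so the increment along the curve is that of
     the single map [X b t] between [z] and [Y b]. *)
  pose z := X a b (Y a).
  have [z1 z3] := near_X b bab.
  have fint (y : R -> V) : {within `[a, b], continuous y} ->
      bochner_integrable mu `[a, b] (fun r => f r (y r)).
    by move=> cy'; exact: (curve_integrable f_C01 (y := y)).
  have cXa : {within `[a, b], continuous (fun r => X a r (Y a))}.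
    exact: (flow_sub_cont X_cont).
  have cYa : {within `[a, b], continuous Y} by exact: sub_within_continuous Y_cont.
  (* The deviation of [Y b] from the unperturbed value [z] is the integral of [E] up to [I1], which
     is at most [e1 * (b - a)] because both values of [f] are close to [f r0 (Y r0)]. *)
  pose I1 := bint a b (fun r => f r (Y r) - f r (X a r (Y a))).
  have Yz : Y b - z = I1 + bint a b E.
    rewrite /I1 (bochner_integral_difference f_C01) // -(flow_increment f_C01 X_cont X_eq) //.
    rewrite (flow_id f_C01 X_cont X_eq) // -/z.
    rewrite addrAC -(Y_increment a0 ab bT).
    by rewrite opprB addrA subrK.
  have I1b : `|I1| <= e1 * (b - a).
    apply: le_norm_bochner_integral_itv => //.
      by apply: bochner_integrableB; [exact: measurable_itv|exact: fint|exact: fint].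
    move=> r rab; have [rT _ _ r3 _] := near_r r rab.
    have [_ Yr3 _] := near_Y r rab; have [_ Xr3] := near_X r rab.
    have [h1 _] := H3 r _ rT r3 Yr3; have [h2 _] := H3 r _ rT r3 Xr3.
    rewrite -(subrK (f r0 (Y r0)) (f r (Y r))) -addrA.
    apply: le_trans (ler_normD _ _) _; rewrite [leRHS]splitr; apply: lerD; first exact: ltW.
    by rewrite distrC ltW.
  have IEb : `|bint a b E| <= N a b.
    rewrite -[leRHS]mul1r; apply: le_norm_bochner_integral_norm => //; try exact: Eint.
    by move=> r _; rewrite mul1r.
  pose DL : {linear V -> V} := D r0.
  have DEr : bochner_integrable mu `[a, b] (DL \o E).
    by apply: (bochner_integrable_linear _ DK); [exact: measurable_itv|exact: Eint].
  (* Freezing the derivative at [r0] lets it pass through the integral. *)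
  have E1 : `|D r0 (bint a b E) - bint a b (fun r => D r (E r))| <= e1 * N a b.
    rewrite -(bochner_integral_linear _ _ DK (Eint a b a0 bT)) //; last first.
      exact: lebesgue_measure_itvcc_fin.
    rewrite -bochner_integralB; [|exact: measurable_itv|exact: lebesgue_measure_itvcc_fin|exact: DEr|exact: DEint].
    apply: le_norm_bochner_integral_norm; [exact: ltW| |exact: Eint|].
      by apply: bochner_integrableB; [exact: measurable_itv| |exact: DEint].
    move=> r rab; have [rT _ r2 _ _] := near_r r rab; rewrite /= distrC.
    apply: H2 => //; move: rab => /andP[ar rb].
    by rewrite (le_trans a0 ar) (le_trans rb bt).
  have bt' : 0 <= b <= t by rewrite bt (le_trans a0 ab).
  have tt : `|t - t| < d1 by rewrite subrr normr0.
  have E2 := H1 b t (Y b) z (At bt') b1 tt Yb1 z1.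
  have -> : err a b = (X b t (Y b) - X b t z - D r0 (Y b - z)) +
      (D r0 I1 + (D r0 (bint a b E) - bint a b (fun r => D r (E r)))).
    have DD : D r0 (I1 + bint a b E) = D r0 I1 + D r0 (bint a b E).
      exact: (linearD DL).
    rewrite Yz DD /err /z.
    rewrite (flow_semigroup f_C01 T0 X_cont X_eq (Y a) a0 ab bt tT).
    exact: subr_insert_sum.
  have N0 : 0 <= N a b by apply: Rintegral_ge0.
  have Yzb : `|Y b - z| <= (b - a) + N a b.
    rewrite Yz; apply: le_trans (ler_normD _ _) (lerD _ IEb).
    by apply: le_trans I1b _; rewrite ler_piMl // subr_ge0.
  apply: le_trans (ler_normD _ _) _.
  have E2' : `|X b t (Y b) - X b t z - D r0 (Y b - z)| <= e1 * ((b - a) + N a b).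
    by apply: le_trans E2 _; rewrite ler_pM2l.
  have E3 : `|D r0 I1| <= e1 * (K * (b - a)).
    by apply: le_trans (DK _) _; rewrite mulrCA ler_pM2l.
  apply: le_trans (lerD E2' (le_trans (ler_normD _ _) (lerD E3 E1))) _.
  apply: (@le_trans _ _ (e1 * (2 + K) * (b - a + N a b))); last first.
    by apply: ler_wpM2r => //; rewrite addr_ge0 // subr_ge0.
  have KN : 0 <= e1 * (K * N a b) by rewrite !mulr_ge0 // ltW.
  have ba : 0 <= e1 * (b - a) by rewrite mulr_ge0 ?subr_ge0 // ltW.
  have -> : e1 * (2 + K) * (b - a + N a b) =
      e1 * (b - a + N a b) + (e1 * (K * (b - a)) + e1 * N a b) +
      (e1 * (K * N a b) + e1 * (b - a)) by ring.
  by rewrite lerDl addr_ge0.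
have N0 : 0 <= N s t by apply: Rintegral_ge0.
have B0 : 0 < (t - s) + N s t + 1 by rewrite ltr_wpDl // addr_ge0 // subr_ge0.
have : `|err s t| <= 0.
  apply/ler_addgt0Pr => e e0; rewrite add0r.
  have e1 : 0 < e / ((t - s) + N s t + 1) by rewrite divr_gt0.
  apply: le_trans (small _ e1) _; rewrite mulrAC ler_pdivrMr // ler_pM2l //.
  by rewrite lerDl.
rewrite normr_le0 /err (flow_id f_C01 X_cont X_eq) // !subr_eq0 => /eqP.
by move=> H; rewrite -[LHS](subrK (X s t (Y s))) H addrC.
Qed.

End fixed_time.
End perturbation.

Theorem corollary5p2 (R : realType) (V : completeNormedModType R)
    (V_nontrivial : exists v : V, v != 0)
    (T : R) (T_gt0 : 0 < T)
    (f : R -> V -> V) (f_C01 : C01 `[0, T] f)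
    (Y E : R -> V)
    (Y_meas : strongly_measurable `[0, T] Y)
    (E_meas : strongly_measurable `[0, T] E)
    (X : R -> R -> V -> V)
    (X_cont : forall (x : V) (s : R), s \in `[0, T] ->
       {within `[s, T], continuous (fun t => X s t x)})
    (X_eq : forall (x : V) (s : R), s \in `[0, T] ->
       forall t : R, t \in `[s, T] ->
       X s t x = x + bochner_integral lebesgue_measure `[s, t]
                       (fun tau => f tau (X s tau x)))
    (fYE_int : (\int[lebesgue_measure]_(tau in `[0%R, T])
                  (`|f tau (Y tau)| + `|E tau|)%:E < +oo)%E)
    (Y_eq : forall t : R, t \in `[0, T] ->
       Y t = Y 0 + bochner_integral lebesgue_measure `[0%R, t]
                     (fun tau => f tau (Y tau) + E tau)) :
  [/\ C001 [set p : R * R | [/\ p.1 \in `[0, T], p.2 \in `[0, T]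
                              & p.1 <= p.2]] X,
      continuously_differentiable_on
        [set p : R * R * V | [/\ p.1.1 \in `]0, T[, p.1.2 \in `]0, T[
                               & p.1.1 < p.1.2]]
        (fun p => X p.1.1 p.1.2 p.2),
      (forall t : R, t \in `[0, T] ->
         strongly_measurable `[0%R, t]
           (fun tau => 'd (X tau t) (Y tau) (E tau))),
      (forall t : R, t \in `[0, T] ->
         (\int[lebesgue_measure]_(tau in `[0%R, t])
            `|'d (X tau t) (Y tau) (E tau)|%:E < +oo)%E) &
      (forall s t : R, s \in `[0, T] -> t \in `[s, T] ->
         Y t = X s t (Y s) + bochner_integral lebesgue_measure `[s, t]
                 (fun tau => 'd (X tau t) (Y tau) (E tau)))].
Proof.
have {}X_cont x s : 0 <= s <= T -> {within `[s, T], continuous (fun t => X s t x)}.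
  by move=> sT; apply: X_cont; rewrite in_itv.
have {}X_eq x s : 0 <= s <= T -> forall t, s <= t <= T ->
    X s t x = x + bochner_integral lebesgue_measure `[s, t] (fun r => f r (X s r x)).
  by move=> sT t st; apply: X_eq; rewrite in_itv.
have {}Y_eq t : 0 <= t <= T -> Y t = Y 0 +
    bochner_integral lebesgue_measure `[0%R, t] (fun tau => f tau (Y tau) + E tau).
  by move=> tT; apply: Y_eq; rewrite in_itv.
split.
- by have [] := flow_C001 f_C01 T_gt0 X_cont X_eq.
- exact: (flow_continuously_differentiable f_C01 T_gt0 X_cont X_eq).
- move=> t; rewrite in_itv /= => tT.
  exact: (derivative_perturbation_measurable f_C01 T_gt0 X_cont X_eq Y_meas E_meas fYE_int Y_eq tT).
- move=> t; rewrite in_itv /= => tT.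
  by have [] := derivative_perturbation_integrable f_C01 T_gt0 X_cont X_eq Y_meas E_meas fYE_int Y_eq tT.
- move=> s t; rewrite !in_itv /= => /andP[s0 sT] /andP[st tT].
  apply: (perturbation_formula f_C01 T_gt0 X_cont X_eq Y_meas E_meas fYE_int Y_eq).
    by rewrite (le_trans s0 st).
  by rewrite s0.
Qed.
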